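(* Assume there exists a barrier digit $b$. Then $f_H(\alpha)=\hat\tau^*(\alpha)$ for every $\alpha\in(\underline{\alpha},\alpha^* )$, where $f_H(\alpha)=\dim_H\{x\in\operatorname{supp}\mu:\dim\mu(x)=\alpha\}$ and $\hat\tau^*(\alpha)=\inf_{q\in\mathbb R}(q\alpha-\hat\tau(q))$ is the Legendre transform of $\hat\tau$.
   Context: Fix integers $d\ge 3$ and $m\ge d$ and a probability vector $\mathbf p=(p_0,\dots,p_m)$ with all $p_i>0$ which is regular, normalized so that $p_0\le p_m\le p_i$ for all $1\le i\le m-1$. Let $\mathcal A=\{0,\dots,m\}$; $\mathcal A^k$ is the set of words of length $k$, $\mathcal A^*=\bigcup_{k\ge0}\mathcal A^k$, $\mathcal A^{\mathbb N}$ the set of infinite sequences; $|\sigma|$ is the length of $\sigma$, $\sigma_j$ its $j$-th letter; $(\sigma,\sigma')$ denotes concatenation. Put $\delta=-1/\log d$ and $\xi=m/(d-1)$. Define $\pi(\sigma)=\sum_{i}\sigma_i d^{-i}$ for finite or infinite words. Let $\mu$ be the unique compactly supported Borel probability measure with $\mu(A)=\sum_{i=0}^m p_i\,\mu(dA-i)$ for all Borel $A$; its support is $[0,\xi]$. For $\sigma\in\mathcal A^k$ let $\mathbf p(\sigma)=\prod_{j=1}^k p_{\sigma_j}$ and $\eta(\sigma)=\sum\{\mathbf p(\sigma'):\sigma'\in\mathcal A^k,\ \pi(\sigma')=\pi(\sigma)\}$. For each $k$, $\Xi_k\subset\mathcal A^k$ is a fixed set containing exactly one word from each nonempty class $\{\sigma\in\mathcal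 A^k:\pi(\sigma)=s\}$. Let $a=1+\lfloor (m-d)/(d-1)\rfloor$, set $p_j=0$ for $j\notin\mathcal A$, and let $M_i$ ($i\in\mathcal A$) be the $(2a+1)\times(2a+1)$ matrix indexed by $\{-a,\dots,a\}^2$ with $M_i(k,l)=p_{k+i-ld}$; $M(\sigma)=M_{\sigma_k}\cdots M_{\sigma_1}$; $\rho$ is spectral radius and $\tilde\rho(\mathcal M)=\limsup_{k}\left(\sup\{\rho(A_1\cdots A_k):A_i\in\mathcal M\}\right)^{1/k}$. Set $\underline{\alpha}=\delta\log\tilde\rho(M_0,\dots,M_m)$ and $\alpha^*=\delta\log\inf\{\rho(M(\sigma))^{1/|\sigma|}:\sigma\in\mathcal A^*,\ \sigma_1\notin\{0,m\}\}$. A digit $b\in\mathcal A$ is a barrier digit if for every $\omega\in\mathcal A^{\mathbb N}$ with $\omega_1=b$ one has $\pi(\omega)-1<0<\xi<\pi(\omega)+1$. Given a barrier digit $b$, $\hat\tau(q)=\lim_{k\to\infty}\delta k^{-1}\log\sum_{\sigma\in\Xi_{k-1}}\eta(b,\sigma)^q$ (this limit exists for all $q$). Local dimension $\dim\mu(x)=\lim_{r\to0^+}\log\mu(B(x,r))/\log r$ when it exists; $\dim_H$ is Hausdorff dimension, with $\dim_H\varnothing=-\infty$. *)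

(* Defs.v *)
From HB Require Import structures.
From mathcomp Require Import all_boot all_order all_algebra.
From mathcomp Require Import all_classical all_reals all_analysis.
From mathcomp Require complex.
Import complex.ComplexField.
Set Implicit Arguments. Unset Strict Implicit. Unset Printing Implicit Defensive.
Import Order.TTheory GRing.Theory Num.Theory.
Import numFieldNormedType.Exports.
Local Open Scope classical_set_scope.
Local Open Scope ring_scope.

Section Defs.
Context {R : realType}.

(* diameter of a set (only used for sets of diameter <= delta, hence bounded) *)
Definition diamR (U : set R) : R := sup [set `|x - y| | x in U & y in U].

Definition delta_cover (delta : R) (E : set R) (U : nat -> set R) : Prop :=
  E `<=` \bigcup_n U n /\
  (forall n x y, U n x -> U n y -> `|x - y| <= delta).

Definition hausdorff_pre (s delta : R) (E : set R) : \bar R :=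
  ereal_inf [set (\sum_(0 <= n <oo) ((diamR (U n)) `^ s)%:E)%E
            | U in delta_cover delta E].

Definition hausdorff_measure (s : R) (E : set R) : \bar R :=
  ereal_sup [set hausdorff_pre s delta E | delta in [set delta : R | 0 < delta]].

(* dim_H E = inf {s : H^s(E) = 0}, with dim_H set0 = -oo.  For nonempty E
   it is enough to take s > 0 (this avoids the convention 0^0). *)
Definition hausdorff_dim (E : set R) : \bar R :=
  if E == set0 then -oo%E
  else ereal_inf [set s%:E | s in [set s : R | 0 < s /\ hausdorff_measure s E = 0%E]].

Definition msupport (mu : set R -> \bar R) : set R :=
  [set x | forall r : R, 0 < r -> (0 < mu (ball x r))%E].

Definition local_dim_is (mu : set R -> \bar R) (x alpha : R) : Prop :=
  (fun r : R => ln (fine (mu (ball x r))) / ln r) @ 0^'+ --> alpha.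

Definition fH (mu : set R -> \bar R) (alpha : R) : \bar R :=
  hausdorff_dim [set x | msupport mu x /\ local_dim_is mu x alpha].

Variables (d m : nat).

Definition digit := 'I_m.+1.

Definition delta : R := - (ln (d%:R : R))^-1.
Definition xi : R := (m%:R : R) / (d%:R - 1).

Definition piw k (s : k.-tuple digit) : R :=
  \sum_(j < k) ((tnth s j : nat)%:R : R) / (d%:R ^+ j.+1).

(* pi of an infinite word omega_1 omega_2 ... (omega_{j+1} = omega j) *)
Definition piinf (w : nat -> digit) : R :=
  limn (series (fun j => ((w j : nat)%:R : R) / (d%:R ^+ j.+1))).

Definition barrier_digit (b : digit) : Prop :=
  forall w : nat -> digit, w 0%N = b ->
    piinf w - 1 < 0 /\ 0 < xi /\ xi < piinf w + 1.

Variable p : digit -> R.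

Definition pw k (s : k.-tuple digit) : R := \prod_(j < k) p (tnth s j).

Definition eta k (s : k.-tuple digit) : R :=
  \sum_(s' : k.-tuple digit | piw s' == piw s) pw s'.

Definition is_Xi (Xi : forall k, {set k.-tuple digit}) : Prop :=
  forall k (s : k.-tuple digit), exists! t, t \in Xi k /\ piw t = piw s.

Definition tauhat (b : digit) (Xi : forall k, {set k.-tuple digit}) (q : R) : R :=
  limn (fun k : nat => delta / k%:R *
     ln (\sum_(s in Xi k.-1) (eta [tuple of b :: s]) `^ q)).

Definition tauhat_star b Xi (alpha : R) : \bar R :=
  ereal_inf [set (q * alpha - tauhat b Xi q)%:E | q in [set: R]].

Definition aa : nat := ((m - d) %/ (d - 1)).+1.
Definition NN : nat := (aa.*2).+1.   (* indices -a..a, i.e. 2a+1 of them *)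

Definition pz (j : int) : R :=
  if (0 <= j)%R && (j <= m%:Z)%R then p (inord `|j|%N) else 0.

(* M_i(k,l) = p_{k+i-ld}, with row/column index r <-> r - a *)
Definition Mi (i : digit) : 'M[R]_NN :=
  \matrix_(k < NN, l < NN)
    pz ((k : nat)%:Z - aa%:Z + (i : nat)%:Z - ((l : nat)%:Z - aa%:Z) * d%:Z).

Definition Mw k (s : k.-tuple digit) : 'M[R]_NN :=
  \prod_(i <- rev (val s)) Mi i.

Definition toC (x : R) : complex.complex R := complex.Complex x 0.
Definition spec_rad n (A : 'M[R]_n) : R :=
  sup [set Num.sqrt (complex.Re z ^+ 2 + complex.Im z ^+ 2)
      | z in [set z : complex.complex R | eigenvalue (map_mx toC A) z]].

Definition jsr : R :=
  limn_sup (fun k : nat =>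
    (\big[Num.max/0]_(s : k.-tuple digit) spec_rad (Mw s)) `^ (k%:R^-1)).

(* delta * log x, extended: delta * log 0 = +oo (delta < 0) *)
Definition dlog (x : R) : \bar R :=
  if x == 0 then +oo%E else (delta * ln x)%:E.

Definition alpha_low : \bar R := dlog jsr.

Definition alpha_star : \bar R :=
  dlog (inf [set x : R | exists k (s : k.+1.-tuple digit),
             (tnth s ord0 : nat) != 0%N /\ (tnth s ord0 : nat) != m /\
             x = spec_rad (Mw s) `^ (k.+1%:R^-1)]).

End Defs.

(* Main.v *)
(* The argument reduces everything to the integer-coded weights [mass n z]: the total
   weight of the words of length [n] whose base-[d] value is [z]. A barrier digit [b] yields
   blocks, values of words starting with [b], that never exchange carries with the words
   preceding them, so [mass] is multiplicative along concatenations with blocks. Hence the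
   logarithms of the exponential sums over blocks are superadditive in the length, and
   [- tauhat q * ln d] is their exponential growth rate, the pressure.

   Upper bound: up to finitely many points, every point of the level set lies in cylinders
   at all scales that can be prefixed by [b] at bounded cost; covering by these cylinders and
   comparing with the exponential sum at [q] shows that the Hausdorff measure of dimension [s]
   vanishes for [s > q * alpha - tauhat q].

   Lower bound: the two strict inequalities on [alpha] provide blocks whose mass decays faster,
   respectively slower, than [alpha] prescribes, so at a fixed large level the function
   [q |-> q * alpha + pressure q / ln d] is minimal at some [q] where the tilted mean of the
   deviation from [alpha] vanishes. Chebyshev's inequality then gives, among the [i^2]-fold
   concatenations, almost the full exponential number of words with deviation [O(i)].
   Concatenating choices of such words for [i = 1, 2, ...] gives a Moran set inside the level
   set, and reading the choices as mixed radix digits parametrizes it by [0, 1) with an inverse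
   of Hoelder exponent arbitrarily close to the desired dimension. *)
Require Import Defs.
From HB Require Import structures.
From mathcomp Require Import all_boot all_order all_algebra.
From mathcomp Require Import all_classical all_reals all_analysis.
From mathcomp Require Import measurable_realfun.
From mathcomp Require Import complex.
From mathcomp Require Import zify ring lra.
Set Implicit Arguments. Unset Strict Implicit. Unset Printing Implicit Defensive.
Import Order.TTheory GRing.Theory Num.Theory.
Import numFieldNormedType.Exports.
Local Open Scope classical_set_scope.
Local Open Scope ring_scope.

(** * Weights of words *)

Section Words.
Context {R : realType} (d m : nat) (p : 'I_m.+1 -> R).

(** The pressure sees only words that start with [b], while a point of the level set is covered by
    arbitrary words. Prefixing [b] to a value [v] of length [k] opens up representations with
    leading digit [b - 1] or [b + 1] and tail [v + d ^ k] or [v - d ^ k]. Their mass is controlled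
    by that of [v] only away from [0] and [maxval k]; hence the end points [0] and [xi] are split
    off, and the cost depends on the power of [d] separating a point from them. The bounds on
    [alpha] are spectral. They become statements on masses because the entries of the products of
    the [Mi] are themselves masses. The heavy and the light block are brought to one common length,
    so that a single exponential sum grows in both directions of [q]. The squares [i ^ 2] balance
    two errors: after [j] stages the prefix has length of order [j ^ 3], while the accumulated
    deviation and the length of the newest stage are only of order [j ^ 2]. Neither the fluctuations
    nor the jump between consecutive scales is then visible in the local dimension. *)

Fixpoint maxval (n : nat) : nat :=
  if n is n'.+1 then (m * d ^ n' + maxval n')%N else 0%N.

Fixpoint wval (s : seq 'I_m.+1) : nat :=
  if s is i :: s' then (i * d ^ size s' + wval s')%N else 0%N.

(* [mass n z] is the total [p]-weight of the words of length [n] with value [z]. *)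
Fixpoint mass (n : nat) (z : int) : R :=
  if n is n'.+1 then \sum_(i < m.+1) p i * mass n' (z - (i : nat)%:Z * (d ^ n')%N%:Z)
  else (z == 0)%:R.

Lemma wval_rcons s i : wval (rcons s i) = (d * wval s + i)%N.
Proof.
elim: s => [|j s IH] /=; first by rewrite expn0; lia.
by rewrite IH size_rcons expnS; lia.
Qed.

Lemma wval_le s : (wval s <= maxval (size s))%N.
Proof.
elim: s => //= i s IH; apply: leq_add => //.
by rewrite leq_mul2r -ltnS ltn_ord orbT.
Qed.

(** Subtraction-free form of the geometric sum [m * (d ^ n - 1) / (d - 1)]. *)
Lemma maxval_geom n : (0 < d)%N -> (maxval n * d.-1 + m = m * d ^ n)%N.
Proof.
move=> d0; elim: n => [|n IH] /=; first by rewrite expn0; lia.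
rewrite expnS; nia.
Qed.

Lemma maxvalD k l : maxval (k + l) = (maxval k * d ^ l + maxval l)%N.
Proof. by elim: k => //= k IH; rewrite IH expnD; lia. Qed.

(** Greedy expansion: the leading digit is as large as possible, capped at [m]. If the cap is
    inactive, the remainder is below [d ^ n], hence at most [maxval n], because [d <= m + 1]. *)
Lemma wval_surj n v : (0 < d)%N -> (d <= m.+1)%N -> (v <= maxval n)%N ->
  exists s : n.-tuple 'I_m.+1, wval s = v.
Proof.
move=> d0 dm; elim: n v => [|n IH] v.
  by rewrite leqn0 => /eqP ->; exists [tuple].
move=> vn.
pose c := minn m (v %/ d ^ n).
have dn0 : (0 < d ^ n)%N by rewrite expn_gt0 d0.
have cm : (c < m.+1)%N by rewrite ltnS geq_minl.
have cv : (c * d ^ n <= v)%N.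
  apply: leq_trans (leq_divM v (d ^ n)).
  by rewrite leq_mul2r geq_minr orbT.
have rest : (v - c * d ^ n <= maxval n)%N.
  rewrite leq_subLR /c.
  case: (leqP m (v %/ d ^ n)) => h.
    by move: vn => /=.
  have := ltn_ceil v dn0; have := maxval_geom n d0; have : (d.-1 <= m)%N by lia.
  move=> h1 h2 h3.
  have : (d ^ n <= (maxval n).+1)%N.
    case: (posnP d.-1) => d1.
      have -> : d = 1%N by lia.
      by rewrite exp1n.
    rewrite -(leq_pmul2r d1); nia.
  lia.
have [s hs] := IH _ rest.
exists [tuple of Ordinal cm :: s] => /=.
by rewrite size_tuple hs; lia.
Qed.

Hypothesis p_gt0 : forall i, 0 < p i.
Hypothesis p_sum1 : \sum_i p i = 1.

Lemma mass_ge0 n z : 0 <= mass n z.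
Proof.
elim: n z => [|n IH] z /=; first by rewrite ler0n.
by apply: sumr_ge0 => i _; rewrite mulr_ge0 // ltW.
Qed.

Lemma mass_term n z (i : 'I_m.+1) :
  p i * mass n (z - (i : nat)%:Z * (d ^ n)%N%:Z) <= mass n.+1 z.
Proof.
rewrite /= (bigD1 i) //= lerDl.
by apply: sumr_ge0 => j _; rewrite mulr_ge0 ?mass_ge0 // ltW.
Qed.

Lemma mass_out n z : (z < 0) || ((maxval n)%:Z < z) -> mass n z = 0.
Proof.
elim: n z => [|n IH] z /= hz; first by case: eqP => // z0; lia.
rewrite big1 // => i _; rewrite IH ?mulr0 //.
have := ltn_ord i => im.
have : (i * d ^ n <= m * d ^ n)%N by rewrite leq_mul2r -ltnS im orbT.
lia.
Qed.

Lemma mass_in n z : mass n z != 0 -> 0 <= z /\ z <= (maxval n)%:Z.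
Proof.
move=> h; have := @mass_out n z.
case: (boolP (_ || _)) => [_ /(_ isT) e|]; first by rewrite e eqxx in h.
by rewrite negb_or -!leNgt => /andP[].
Qed.

Lemma mass_le1 n z : mass n z <= 1.
Proof.
elim: n z => [|n IH] z /=; first by case: eqP.
rewrite -p_sum1; apply: ler_sum => i _.
by rewrite -[leRHS]mulr1 ler_wpM2l // ltW.
Qed.

Definition weight (s : seq 'I_m.+1) : R := \prod_(i <- s) p i.

Lemma weight_gt0 s : 0 < weight s.
Proof. by rewrite /weight; elim/big_ind: _ => // *; rewrite mulr_gt0. Qed.

Lemma mass_ge_weight s : weight s <= mass (size s) (wval s)%:Z.
Proof.
elim: s => [|i s IH]; first by rewrite /weight big_nil /=.
apply: le_trans (mass_term _ _ i).
rewrite /weight big_cons ler_pM2l //.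
rewrite [X in mass _ X](_ : _ = (wval s)%:Z) //.
rewrite [wval _]/= -/(size s); lia.
Qed.

Lemma mass_gt0 n v : (0 < d)%N -> (d <= m.+1)%N -> (v <= maxval n)%N ->
  0 < mass n v%:Z.
Proof.
move=> d0 dm /(wval_surj d0 dm)[s <-].
by have := mass_ge_weight s; rewrite size_tuple; apply: lt_le_trans (weight_gt0 s).
Qed.

Lemma mass_lb pm n v : (0 < d)%N -> (d <= m.+1)%N ->
  0 < pm -> (forall i, pm <= p i) -> (v <= maxval n)%N -> pm ^+ n <= mass n v%:Z.
Proof.
move=> d0 dm pm0 hp /(wval_surj d0 dm)[s <-].
have := mass_ge_weight s; rewrite size_tuple; apply: le_trans.
rewrite /weight -[in X in X <= _](size_tuple s).
elim: (tval s) => [|i t IH]; first by rewrite big_nil expr0.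
by rewrite big_cons /= exprS ler_pM // ?exprn_ge0 // ltW.
Qed.

Lemma sum_cons_tuple k (F : seq 'I_m.+1 -> R) :
  \sum_(s : k.+1.-tuple 'I_m.+1) F s =
  \sum_(i < m.+1) \sum_(s : k.-tuple 'I_m.+1) F (i :: s).
Proof.
rewrite pair_big /=.
rewrite (reindex (fun x : 'I_m.+1 * k.-tuple 'I_m.+1 => [tuple of x.1 :: x.2])) //=.
exists (fun s => (thead s, [tuple of behead s])) => [[i s] _|s _] /=.
  by congr pair; apply/val_inj.
by apply/val_inj; case: s => -[].
Qed.

Lemma mass_sum_words k (F : nat -> R) :
  \sum_(s : k.-tuple 'I_m.+1) weight s * F (wval s) =
  \sum_(v < (maxval k).+1) mass k v%:Z * F v.
Proof.
(* Grouping words by value reduces the claim to the total weight of one fibre, where induction on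
   the leading letter reproduces the recursion of [mass]. *)
suff H (z : int) : \sum_(s : k.-tuple 'I_m.+1 | (wval s)%:Z == z) weight s = mass k z.
  have hw (s : k.-tuple 'I_m.+1) : (wval s < (maxval k).+1)%N.
    by rewrite ltnS -[in X in (_ <= maxval X)%N](size_tuple s) wval_le.
  rewrite (partition_big (fun s => Ordinal (hw s)) xpredT) //=.
  apply: eq_bigr => v _; rewrite -H mulr_suml.
  apply: eq_big => [s|s /eqP <-] //=.
rewrite big_mkcond /=.
rewrite (eq_bigr (fun s : k.-tuple 'I_m.+1 =>
  (fun s => if (wval s)%:Z == z then weight s else 0) (tval s))) //.
elim: k z => [|k IH] z.
  rewrite (big_pred1 [tuple]); last by move=> s; apply/esym/eqP; exact: tuple0.
  by rewrite /weight big_nil /= -/(0%:Z) [0%:Z == z]eq_sym; case: (z == 0).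
rewrite (@sum_cons_tuple k (fun s => if (wval s)%:Z == z then weight s else 0)) /=; apply: eq_bigr => i _.
rewrite -IH mulr_sumr; apply: eq_bigr => s _ /=.
rewrite size_tuple /weight big_cons.
have -> : ((i * d ^ k + wval s)%N%:Z == z) = ((wval s)%:Z == z - i%:Z * (d ^ k)%N%:Z).
  by apply/eqP/eqP; lia.
by case: ifP => _; rewrite ?mulr0.
Qed.

Lemma mass_words k (z : int) :
  \sum_(s : k.-tuple 'I_m.+1 | (wval s)%:Z == z) weight s = mass k z.
Proof.
case: (boolP ((z < 0) || ((maxval k)%:Z < z))) => hz.
  rewrite mass_out // big_pred0 // => s.
  have := wval_le s; rewrite size_tuple => h; apply/negbTE/negP => /eqP e; rewrite -e in hz; move: h hz; set w := wval _; move: (maxval k) w => M w; lia.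
have [v -> hv] : exists2 v : nat, z = v%:Z & (v < (maxval k).+1)%N.
  by exists `|z|%N; lia.
have := mass_sum_words k (fun x => (x == v)%:R).
rewrite (bigD1 (Ordinal hv)) //= eqxx mulr1 [X in _ + X]big1 ?addr0.
  by move=> <-; rewrite big_mkcond; apply: eq_bigr => s _; rewrite eqz_nat; case: eqP; rewrite ?mulr1 ?mulr0.
by move=> i; rewrite -val_eqE /= => /negbTE ->; rewrite mulr0.
Qed.

Lemma piwE k (s : k.-tuple 'I_m.+1) : (0 < d)%N ->
  piw d s = (wval s)%:R / d%:R ^+ k :> R.
Proof.
move=> d0; have d0' : d%:R != 0 :> R by rewrite pnatr_eq0 -lt0n.
rewrite /piw; elim: k s => [|k IH] s.
  by rewrite big_ord0 (tuple0 s) mul0r.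
case/tupleP: s => i s; rewrite big_ord_recl tnth0 expr1.
have -> : wval [tuple of i :: s] = (i * d ^ k + wval s)%N by rewrite /= (size_tuple s).
rewrite natrD mulrDl natrM; congr (_ + _).
  by rewrite natrX exprS; field; rewrite expf_neq0.
rewrite exprS.
have -> : \sum_(i0 < k) (tnth (cons_tuple i s) (lift ord0 i0) : nat)%:R / d%:R ^+ (bump 0 i0).+1 = (\sum_(j < k) (tnth s j : nat)%:R / d%:R ^+ j.+1) / d%:R :> R.
  rewrite mulr_suml; apply: eq_bigr => j _; rewrite tnthS /bump /= add1n [in LHS]exprS.
  by field; rewrite ?d0' ?expf_neq0.
rewrite IH; field.
by rewrite expf_neq0.
Qed.

Lemma etaE k (s : k.-tuple 'I_m.+1) : (0 < d)%N -> Defs.eta d p s = mass k (wval s)%:Z.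
Proof.
move=> d0; rewrite /Defs.eta -mass_words; apply: eq_big => [t|t _].
  rewrite !piwE // (inj_eq (mulIf _)) ?eqr_nat //.
  by rewrite invr_neq0 // expf_neq0 // pnatr_eq0 -lt0n.
by rewrite /pw /weight big_tuple.
Qed.

(** Greedy expansion reaches every integer from [0] to [maxval k], so these integers are in
    bijection with the representatives in [Xi k]. *)
Lemma sum_Xi (Xi : forall k, {set k.-tuple 'I_m.+1}) k (F : nat -> R) :
  (0 < d)%N -> (d <= m.+1)%N -> is_Xi (R:=R) d Xi ->
  \sum_(s in Xi k) F (wval s) = \sum_(v < (maxval k).+1) F v.
Proof.
move=> d0 dm hXi.
have hw (s : k.-tuple 'I_m.+1) : (wval s < (maxval k).+1)%N.
  by rewrite ltnS -[in X in (_ <= maxval X)%N](size_tuple s) wval_le.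
have piw_eq (s t : k.-tuple 'I_m.+1) : wval s = wval t -> piw d s = piw d t :> R.
  by move=> e; rewrite !piwE // e.
rewrite (partition_big (fun s => Ordinal (hw s)) xpredT) //=.
apply: eq_bigr => v _.
have [s hs] : exists s : k.-tuple 'I_m.+1, wval s = v by apply: wval_surj => //; rewrite -ltnS.
have [t [[tX ts] tu]] := hXi k s.
have wt : wval t = v.
  rewrite -hs; apply/eqP; rewrite -(eqr_nat R); apply/eqP; move: ts.
  rewrite !piwE // => /mulIf -> //.
  by rewrite invr_neq0 // expf_neq0 // pnatr_eq0 -lt0n.
rewrite (big_pred1 t) ?wt // => u /=.
apply/andP/eqP => [[uX /eqP/(congr1 val) /= uv]|->].
  by apply/esym/tu; split => //; apply: piw_eq; rewrite uv hs.
by split => //; apply/eqP/val_inj.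
Qed.

(* Separated blocks cannot exchange carries with whatever precedes them. *)
Definition carry_free l w := [/\ (w < d ^ l)%N, (maxval l < w + d ^ l)%N & (w <= maxval l)%N].

Lemma carry_free0 : carry_free 0 0.
Proof. by []. Qed.

(** Once all [k] leading digits are peeled off, a nonzero remainder [y] would need a word of length
    [l] with value [y * d ^ l + w]. The first inequality of [carry_free] makes this negative for
    [y <= -1], the second pushes it above [maxval l] for [y >= 1]. *)
Lemma mass_cat k l w y : carry_free l w ->
  mass (k + l) (y * (d ^ l)%N%:Z + w%:Z) = mass k y * mass l w%:Z.
Proof.
case=> w1 w2 w3; elim: k y => [|k IH] y.
  rewrite add0n /=; case: eqP => [->|y0]; first by rewrite mul0r add0r mul1r.
  rewrite mul0r mass_out //.
  have [y1|y1] : y <= -1 \/ 1 <= y by lia.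
    apply/orP; left; nia.
  apply/orP; right; nia.
rewrite addSn /= mulr_suml; apply: eq_bigr => i _.
by rewrite -mulrA -IH expnD; congr (_ * mass _ _); lia.
Qed.

Lemma carry_free_cat k l v w : carry_free k v -> carry_free l w ->
  carry_free (k + l) (v * d ^ l + w).
Proof.
case=> v1 v2 v3 [w1 w2 w3]; split; rewrite ?expnD ?maxvalD; nia.
Qed.

(** [mass] peels off leading digits, but the matrices [Mi] act on the last one. Here the last digit
    is [r - j * d] for a carry [j], and the hypothesis confines the carries to the index range of
    the matrices. *)
Lemma mass_rcons (a n : nat) (z r : int) :
  (forall j : int, (a%:Z < j) || (j < - a%:Z) -> pz p (r - j * d%:Z) = 0) ->
  mass n.+1 (d%:Z * z + r) =
  \sum_(l < a.*2.+1) pz p (r - ((l : nat)%:Z - a%:Z) * d%:Z) * mass n (z + ((l : nat)%:Z - a%:Z)).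
Proof.
move=> hr; elim: n z => [|n IH] z.
  transitivity (pz p (d%:Z * z + r)).
    rewrite /= /pz; case: ifP => hz.
      have hi : (`|(d%:Z * z + r)%R| < m.+1)%N by lia.
      rewrite (bigD1 (inord `|(d%:Z * z + r)%R|)) //= expn0 mulr1 inordK //.
      rewrite [X in p _ * X](_ : _ = 1) ?mulr1; last by case: eqP => //; lia.
      rewrite big1 ?addr0 // => j; rewrite -val_eqE /= inordK // => hj.
      by case: eqP; rewrite ?mulr0 //; lia.
    apply: big1 => i _; case: eqP; rewrite ?mulr0 // expn0 mulr1 => e.
    have := ltn_ord i; lia.
  (* [mass 0] selects the carry [- z]; if this is out of range, both sides vanish by [hr]. *)
  case: (boolP ((a%:Z < - z) || (- z < - a%:Z))) => hz.
    rewrite [LHS](_ : _ = pz p (r - (- z) * d%:Z)); last by congr pz; lia.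
    rewrite hr // big1 // => l _ /=; case: eqP; rewrite ?mulr0 // => e.
    have := ltn_ord l; lia.
  have hl : (`|(a%:Z - z)%R| < a.*2.+1)%N by lia.
  rewrite (bigD1 (Ordinal hl)) //= big1 ?addr0; last first.
    by move=> l; rewrite -val_eqE /= => hl'; case: eqP; rewrite ?mulr0 //; lia.
  case: eqP => [e|e]; last by lia.
  by rewrite mulr1; congr pz; lia.
rewrite [LHS]/=.
under eq_bigr => i _.
  rewrite (_ : d%:Z * z + r - i%:Z * (d ^ n.+1)%N%:Z = d%:Z * (z - i%:Z * (d ^ n)%N%:Z) + r); last by rewrite expnS; lia.
  rewrite -/(mass n.+1 _) IH mulr_sumr.
  over.
rewrite exchange_big /=; apply: eq_bigr => l _.
rewrite mulr_sumr; apply: eq_bigr => i _.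
rewrite mulrCA; congr (_ * (_ * mass _ _)); lia.
Qed.

(** The bridge between spectral radii and masses: row and column indices are the outgoing and
    incoming carries, and the product extends the word by one last digit at a time. *)
Lemma Mw_mass k (s : k.-tuple 'I_m.+1) (r l : 'I_(NN d m)) : (2 <= d)%N ->
  Mw d p s r l = mass k ((wval s)%:Z + ((r : nat)%:Z - (aa d m)%:Z) - ((l : nat)%:Z - (aa d m)%:Z) * (d ^ k)%N%:Z).
Proof.
move=> d2; rewrite /Mw /=; have := size_tuple s; move: (tval s) => {}s <-.
elim/last_ind: s r => [|s i IH] r.
  rewrite /= big_nil mxE expn0 -val_eqE /=.
  by congr (_%:R); apply/eqP/eqP; lia.
rewrite rev_rcons big_cons !mxE size_rcons wval_rcons expnS.
set A := aa d m.
rewrite (_ : (d * wval s + i)%N%:Z + ((r : nat)%:Z - A%:Z) - ((l : nat)%:Z - A%:Z) * (d * d ^ size s)%N%:Z = d%:Z * ((wval s)%:Z - ((l : nat)%:Z - A%:Z) * (d ^ size s)%N%:Z) + (i%:Z + ((r : nat)%:Z - A%:Z))); last by lia.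
rewrite (@mass_rcons A) => [|j hj].
  apply: eq_bigr => j _; rewrite IH mxE; congr (pz _ _ * mass _ _); rewrite -/A; first by ring.
  by ring.
rewrite /pz; case: ifP => // h; exfalso.
have : (m - d < A * (d - 1))%N by rewrite /A /aa; apply: ltn_ceil; lia.
move=> hA.
(* This is what the choice of [aa] provides: a digit plus a carry of absolute value at most [A]
   cannot produce a carry beyond [A]. *)
have key : (m + A < A.+1 * d)%N.
  have e : (A * (d - 1) + A = A * d)%N by rewrite -mulnSr; congr (_ * _)%N; lia.
  lia.
have hr : (r < A.*2.+1)%N by exact: ltn_ord r.
have hi := ltn_ord i.
move: h hr hi; move: (nat_of_ord r) (nat_of_ord i) => u v h hu hv.
case/orP: hj => hj.
  have : (A.+1 * d)%N%:Z <= j * d%:Z by rewrite PoszM ler_wpM2r //; lia.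
  lia.
have : j * d%:Z <= - (A.+1 * d)%N%:Z by rewrite PoszM -mulNr ler_wpM2r //; lia.
lia.
Qed.

End Words.

(** * Spectral radius *)

Section SpectralRadius.
Context {R : realType}.
Local Notation C := (complex.complex R).

Definition cmod (z : C) : R := Num.sqrt (complex.Re z ^+ 2 + complex.Im z ^+ 2).

Lemma cmodE z : cmod z = Normc.normc z.
Proof. by case: z. Qed.

Lemma cmod_ge0 z : 0 <= cmod z.
Proof. exact: sqrtr_ge0. Qed.

Lemma cmodM z w : cmod (z * w) = cmod z * cmod w.
Proof. by rewrite !cmodE Normc.normcM. Qed.

Lemma cmodD z w : cmod (z + w) <= cmod z + cmod w.
Proof. by rewrite !cmodE le_normcD. Qed.

Lemma cmod0 : cmod 0 = 0.
Proof. by rewrite cmodE Normc.normc0. Qed.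

Lemma cmod_eq0 z : cmod z = 0 -> z = 0.
Proof. by rewrite cmodE => /Normc.eq0_normc. Qed.

Lemma cmod_toC x : cmod (toC x) = `|x|.
Proof. by rewrite /cmod /toC /= expr0n /= addr0 sqrtr_sqr. Qed.

Lemma cmod_sum (I : finType) (F : I -> C) : cmod (\sum_i F i) <= \sum_i cmod (F i).
Proof.
elim/big_ind2: _ => [|x1 x2 y1 y2 h1 h2|//]; first by rewrite cmod0.
by apply: le_trans (cmodD _ _) _; apply: lerD.
Qed.

Lemma eigenvalue_le n (A : 'M[R]_n.+1) (c : R) z :
  (forall i j, `|A i j| <= c) -> eigenvalue (map_mx toC A) z -> cmod z <= n.+1%:R * c.
Proof.
move=> hA /eigenvalueP[v vA v0].
have [j hj] : exists j, v ord0 j != 0.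
  apply/existsP; apply: contraNT v0; rewrite negb_exists => /forallP h.
  by apply/eqP/rowP => j; rewrite mxE; apply/eqP; have := h j; rewrite negbK.
pose k := [arg max_(i > j) cmod (v ord0 i)]%O.
have hk i : cmod (v ord0 i) <= cmod (v ord0 k).
  by rewrite /k; case: arg_maxP => // l _; apply.
have k0 : 0 < cmod (v ord0 k).
  apply: lt_le_trans (hk j); rewrite lt_neqAle cmod_ge0 andbT eq_sym.
  by apply: contra hj => /eqP /cmod_eq0 ->.
rewrite -(ler_pM2r k0) -cmodM.
have /rowP/(_ k) := vA; rewrite !mxE => <-.
apply: le_trans (cmod_sum _) _.
have -> : n.+1%:R * c * cmod (v ord0 k) = \sum_(i < n.+1) c * cmod (v ord0 k).
  by rewrite sumr_const card_ord -[RHS]mulr_natl mulrA.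
apply: ler_sum => i _; rewrite cmodM mxE cmod_toC mulrC.
by apply: ler_pM; rewrite ?cmod_ge0.
Qed.

Definition cmods n (A : 'M[R]_n) : set R :=
  [set Num.sqrt (complex.Re z ^+ 2 + complex.Im z ^+ 2) | z in
    [set z : C | eigenvalue (map_mx toC A) z]].

(** Without this bound [sup] could be its default value [0], and [spec_rad] would say nothing about
    the eigenvalues. *)
Lemma cmods_ubound n (A : 'M[R]_n.+1) : has_ubound (cmods A).
Proof.
pose c := \sum_i \sum_j `|A i j|.
exists (n.+1%:R * c) => _ [z hz <-]; apply: eigenvalue_le hz => i j.
rewrite /c (bigD1 i) //= (bigD1 j) //= -addrA lerDl addr_ge0 //.
  by apply: sumr_ge0.
by apply: sumr_ge0 => k _; apply: sumr_ge0.
Qed.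

Lemma spec_rad_le n (A : 'M[R]_n.+1) (c : R) : 0 <= c ->
  (forall i j, `|A i j| <= c) -> spec_rad A <= n.+1%:R * c.
Proof.
move=> c0 hA; rewrite /spec_rad -/(cmods A).
have [->|/set0P ne] := eqVneq (cmods A) set0.
  by rewrite sup0 mulr_ge0.
by apply: ge_sup => // _ [z hz <-]; apply: eigenvalue_le hz.
Qed.

Lemma spec_rad_ub n (A : 'M[R]_n.+1) z :
  eigenvalue (map_mx toC A) z -> cmod z <= spec_rad A.
Proof.
move=> hz; apply: ub_le_sup; first exact: cmods_ubound.
by exists z.
Qed.

Lemma spec_rad_ge0 n (A : 'M[R]_n.+1) : 0 <= spec_rad A.
Proof.
rewrite /spec_rad -/(cmods A).
have [->|/set0P [x hx]] := eqVneq (cmods A) set0; first by rewrite sup0.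
apply: le_trans (ub_le_sup (cmods_ubound A) hx).
by case: hx => z _ <-; exact: cmod_ge0.
Qed.

(* By Cayley-Hamilton the powers of [A] satisfy a linear recurrence, whose
   characteristic roots are removed one at a time. *)
Lemma pow_bound_roots n (A : 'M[C]_n.+1) (r : R) (s : seq C) :
  0 < r -> (forall z, z \in s -> cmod z < r) ->
  forall B : 'M[C]_n.+1, horner_mx A (\prod_(z <- s) ('X - z%:P)) *m B = 0 ->
  exists2 c : R, 0 <= c & forall k i j, cmod ((A ^+ k *m B) i j) <= c * r ^+ k.
Proof.
move=> r0; elim: s => [|z s IH] hs B.
  rewrite big_nil rmorph1 mul1mx => ->; exists 0 => // k i j.
  by rewrite mulmx0 mxE cmod0 mul0r.
rewrite big_cons mulrC rmorphM /= -mulmxE -mulmxA => hB.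
have [|c c0 hc] := IH _ _ hB.
  by move=> y ys; apply: hs; rewrite inE ys orbT.
have hz : cmod z < r by apply: hs; rewrite inE eqxx.
pose c1 := \sum_i \sum_j cmod (B i j).
have c10 : 0 <= c1 by apply: sumr_ge0 => i _; apply: sumr_ge0 => j _; exact: cmod_ge0.
have rz : 0 < r - cmod z by rewrite subr_gt0.
(* With [K] for this constant, the recursion needs [cmod z * K + c <= r * K], that is
   [K >= c / (r - cmod z)]; the summand [c1] covers the power [0]. *)
exists (c1 + c / (r - cmod z)) => [|k i j].
  by rewrite addr_ge0 // divr_ge0 // ltW.
elim: k => [|k IHk].
  rewrite expr0 mulr1 mul1mx.
  apply: (@le_trans _ _ c1); last by rewrite lerDl divr_ge0 // ltW.
  rewrite /c1 (bigD1 i) //= (bigD1 j) //= -addrA lerDl addr_ge0 //.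
    by apply: sumr_ge0 => *; exact: cmod_ge0.
  by apply: sumr_ge0 => *; apply: sumr_ge0 => *; exact: cmod_ge0.
have -> : A ^+ k.+1 *m B = z *: (A ^+ k *m B) + A ^+ k *m (horner_mx A ('X - z%:P) *m B).
  rewrite rmorphB /= horner_mx_X horner_mx_C exprSr -mulmxE mulmxBl mulmxBr mulmxA.
  by rewrite mul_scalar_mx -scalemxAr addrCA subrr addr0.
rewrite !mxE; apply: le_trans (cmodD _ _) _; rewrite cmodM.
have := hc k i j; rewrite !mxE => h.
apply: (@le_trans _ _ (cmod z * ((c1 + c / (r - cmod z)) * r ^+ k) + c * r ^+ k)).
  apply: lerD; last exact: h.
  by rewrite ler_wpM2l ?cmod_ge0 //; move: IHk; rewrite mxE.
rewrite exprS mulrA -mulrDl mulrA ler_pM2r ?exprn_gt0 //.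
have e : c = c / (r - cmod z) * (r - cmod z) by rewrite mulfVK // gt_eqF.
rewrite [X in _ + X]e -subr_ge0.
rewrite [X in 0 <= X](_ : _ = c1 * (r - cmod z)); last by ring.
by rewrite mulr_ge0 // ltW.
Qed.

(** The upper half of Gelfand's formula, for entries: over the complex numbers the characteristic
    polynomial splits, and all its roots have modulus below [r]. *)
Lemma pow_bound n (A : 'M[R]_n.+1) (r : R) : spec_rad A < r ->
  exists2 c : R, 0 <= c & forall k i j, `|(A ^+ k) i j| <= c * r ^+ k.
Proof.
move=> hr; have r0 : 0 < r := le_lt_trans (spec_rad_ge0 A) hr.
pose A' := map_mx toC A.
have [s hs] := closed_field_poly_normal (char_poly A').
have hz z : z \in s -> cmod z < r.
  move=> zs; apply: le_lt_trans hr; apply: spec_rad_ub.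
  rewrite eigenvalue_root_char hs rootE hornerZ mulf_eq0.
  by rewrite -[X in _ || X]rootE root_prod_XsubC zs orbT.
have := Cayley_Hamilton A'; rewrite hs (monicP (char_poly_monic A')) scale1r => CH.
have [|c c0 hc] := pow_bound_roots r0 hz (B := 1%:M) (A := A').
  by rewrite mulmx1; exact: CH.
exists c => // k i j; have := hc k i j; rewrite mulmx1.
have -> : A' ^+ k = map_mx toC (A ^+ k).
  have -> : toC = real_complex_def (Phant R) by [].
  by rewrite rmorphXn.
by rewrite mxE cmod_toC.
Qed.

End SpectralRadius.

(** * Barrier digits and blocks *)

Lemma nat_gt (R : realType) (x : R) : exists n : nat, x < n%:R.
Proof.
by exists (Num.bound `|x|); apply: le_lt_trans (ler_norm x) (archi_boundP _).
Qed.

Section Barrier.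
Context {R : realType} (d m : nat) (b : 'I_m.+1).
Hypothesis d3 : (3 <= d)%N.

Lemma piinf_cons (c : 'I_m.+1) :
  piinf (R := R) d (fun j => if j == 0%N then b else c) =
  (b : nat)%:R / d%:R + (c : nat)%:R / (d%:R * (d%:R - 1)).
Proof.
have d1 : (3%:R : R) <= d%:R by rewrite ler_nat.
have dn0 : (d%:R : R) != 0 by apply: lt0r_neq0; lra.
have dn1 : (d%:R - 1 : R) != 0 by apply: lt0r_neq0; lra.
apply: cvg_lim => //; rewrite -cvg_shiftS /=.
pose l : R := (b : nat)%:R / d%:R + (c : nat)%:R / (d%:R * (d%:R - 1)).
have -> : (fun n => series (fun j => ((if j == 0%N then b else c) : nat)%:R / (d%:R : R) ^+ j.+1) n.+1)
   = (fun n => l - (c : nat)%:R / (d%:R * (d%:R - 1)) * (d%:R^-1) ^+ n).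
  apply/funext => n; rewrite /series /=; elim: n => [|n IH].
    by rewrite big_nat1 /= expr0 mulr1 expr1 /l addrK.
  rewrite big_nat_recr //= IH /l exprVn exprVn !exprS.
  by field; rewrite ?dn0 ?dn1 ?expf_neq0.
suff : (fun n => l - (c : nat)%:R / (d%:R * (d%:R - 1)) * (d%:R^-1) ^+ n) @ \oo -->
    l - (c : nat)%:R / (d%:R * (d%:R - 1)) * 0 by rewrite mulr0 subr0.
apply: cvgB; first exact: cvg_cst.
apply: cvgMl_tmp; apply: cvg_expr.
by rewrite ger0_norm ?invr_ge0 ?ler0n // invf_lt1; lra.
Qed.

(** The extreme words [b m m m ...] and [b 0 0 0 ...] give the two inequalities, cleared of
    denominators. The barrier enters the rest of the proof in this form. *)
Lemma barrier_ineqs : barrier_digit (R := R) d b ->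
  (b * d.-1 + m < d * d.-1)%N /\ (d * m < (b + d) * d.-1)%N.
Proof.
have d1 : (3%:R : R) <= d%:R by rewrite ler_nat.
have dn0 : (d%:R : R) != 0 by apply: lt0r_neq0; lra.
have dn1 : (d%:R - 1 : R) != 0 by apply: lt0r_neq0; lra.
have dp : (d.-1%:R : R) = d%:R - 1 by rewrite -subn1 natrB //; lia.
move=> h; split.
  have [+ _] := h (fun j => if j == 0%N then b else ord_max) erefl.
  rewrite piinf_cons /= => h1; rewrite -(ltr_nat R) natrD !natrM dp.
  have : (b%:R / d%:R + m%:R / (d%:R * (d%:R - 1)) - 1) * (d%:R * (d%:R - 1)) < (0 : R).
    by rewrite pmulr_llt0 // mulr_gt0; lra.
  rewrite [X in X < 0](_ : _ = b%:R * (d%:R - 1) + m%:R - d%:R * (d%:R - 1)).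
    by rewrite subr_lt0.
  by field; rewrite dn0 dn1.
have [_ [_ +]] := h (fun j => if j == 0%N then b else ord0) erefl.
rewrite piinf_cons /= mul0r addr0 /xi => h1; rewrite -(ltr_nat R) !natrM natrD dp.
have : (m%:R / (d%:R - 1)) * (d%:R * (d%:R - 1)) < (b%:R / d%:R + 1) * (d%:R * (d%:R - 1)) :> R.
  by rewrite ltr_pM2r // mulr_gt0; lra.
rewrite [X in X < _](_ : _ = d%:R * m%:R).
  rewrite [X in _ < X](_ : _ = (b%:R + d%:R) * (d%:R - 1)) //.
  by field.
by field.
Qed.

End Barrier.

Section Blocks.
Context {R : realType} (d m : nat) (p : 'I_m.+1 -> R) (b : 'I_m.+1).
Hypotheses (d3 : (3 <= d)%N) (dm : (d <= m)%N).
Hypotheses (p_gt0 : forall i, 0 < p i) (p_sum1 : \sum_i p i = 1).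
Hypotheses (B1 : (b * d.-1 + m < d * d.-1)%N) (B2 : (d * m < (b + d) * d.-1)%N).

Local Notation E := (mass d p).
Local Notation N := (maxval d m).
Local Notation L := (ln (d%:R : R)).

Definition block l v := [/\ (0 < l)%N, (b * d ^ l.-1 <= v)%N & (v <= b * d ^ l.-1 + N l.-1)%N].

Lemma d_gt0 : (0 < d)%N. Proof. by lia. Qed.
Lemma d_le : (d <= m.+1)%N. Proof. by lia. Qed.
Hint Resolve d_gt0 d_le : core.

(** Adding [B1] and [B2] cancels [b] and leaves [m * (d + 1) < 2 * d * (d - 1)]. So [xi < 2]: a
    cylinder can overlap only with few neighbours of the same length. *)
Lemma xi_lt2 : (m < 2 * d.-1)%N.
Proof. nia. Qed.

Lemma maxval_lt l : (N l < 2 * d ^ l)%N.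
Proof.
have h := maxval_geom m l d_gt0; have := xi_lt2.
have : (0 < d ^ l)%N by rewrite expn_gt0 d_gt0.
rewrite -(ltn_pmul2r (_ : 0 < d.-1)%N); last by lia.
move: (d ^ l)%N h => D; nia.
Qed.

(** The two strict clauses are [B1] and [B2] multiplied by a power of [d]. *)
Lemma block_carry_free l v : block l v -> carry_free d m l v.
Proof.
case: l => [|l] [] //= _ h1 h2.
have h := maxval_geom m l d_gt0.
have D0 : (0 < d ^ l)%N by rewrite expn_gt0 d_gt0.
have bm := ltn_ord b.
split.
- apply: leq_ltn_trans h2 _; rewrite expnS -(ltn_pmul2r (_ : 0 < d.-1)%N); last by lia.
  move: (d ^ l)%N h D0 {h1} => D h D0.
  have : (D * (b * d.-1 + m) < D * (d * d.-1))%N by rewrite ltn_pmul2l.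
  lia.
- rewrite /= expnS; suff : (m * d ^ l + N l < b * d ^ l + d * d ^ l)%N by lia.
  rewrite -(ltn_pmul2r (_ : 0 < d.-1)%N); last by lia.
  move: (d ^ l)%N h D0 {h1 h2} => D h D0.
  have : (D * (d * m) < D * ((b + d) * d.-1))%N by rewrite ltn_pmul2l.
  have e : (m * D * d.-1 + m * D = m * D * d)%N by rewrite -mulnSr prednK.
  lia.
- apply: leq_trans h2 _; rewrite leq_add2r leq_mul2r; lia.
Qed.

Lemma block_cat k l v w : block k v -> (w <= N l)%N -> block (k + l) (v * d ^ l + w).
Proof.
case: k => [|k] [] //= _ h1 h2 h3; split => //; rewrite addSn /= expnD ?maxvalD; nia.
Qed.

Lemma block_mass_gt0 l v : block l v -> 0 < E l v%:Z.
Proof. by move=> /block_carry_free[_ _ ?]; apply: mass_gt0. Qed.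

Lemma block_cons n v : (v <= N n)%N -> block n.+1 (b * d ^ n + v).
Proof. by move=> h; split => //=; lia. Qed.

Lemma mass_cat_block k l v w : block k v -> block l w ->
  E (k + l) (v * d ^ l + w)%N%:Z = E k v%:Z * E l w%:Z.
Proof.
move=> hv /block_carry_free hw; rewrite -(mass_cat p k v%:Z hw).
by congr (mass _ _ _); lia.
Qed.

Lemma block_pow l v j : block l v -> exists2 w, block (j.+1 * l) w &
  E (j.+1 * l) w%:Z = E l v%:Z ^+ j.+1.
Proof.
move=> hv; elim: j => [|j [w hw e]]; first by exists v; rewrite mul1n ?expr1.
exists (v * d ^ (j.+1 * l) + w)%N.
  by rewrite mulSn; apply: block_cat => //; have [] := block_carry_free hw.
by rewrite mulSn mass_cat_block // e -exprS.
Qed.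

Lemma jsr_bounds (r : R) K : 0 <= r ->
  (forall k, (K <= k)%N -> forall s : k.-tuple 'I_m.+1, spec_rad (Mw d p s) <= r ^+ k) ->
  0 <= jsr d p <= r.
Proof.
move=> r0 hK; rewrite /jsr /limn_sup.
set u := (fun k : nat => _ : R).
have u0 k : 0 <= u k by exact: powR_ge0.
have uK k : (K.+1 <= k)%N -> u k <= r.
  move=> Kk; have k0 : (0 < k)%N by lia.
  have -> : r = (r ^+ k) `^ (k%:R^-1).
    by rewrite -powR_mulrn // -powRrM mulfV ?powRr1 // pnatr_eq0 -lt0n.
  rewrite /u; apply: ge0_ler_powR.
  - by rewrite invr_ge0.
  - by rewrite nnegrE; apply: le_trans (bigmax_ge_id _ _ _ _).
  - by rewrite nnegrE exprn_ge0.
  - apply: bigmax_le; first exact: exprn_ge0.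
    by move=> s _; apply: hK; lia.
have ubK n : (K.+1 <= n)%N -> ubound (sdrop u n) r.
  by move=> Kn _ [k /= nk <-]; apply: uK; lia.
have ne n : sdrop u n !=set0 by exists (u n); exists n => /=.
have sups_ge0 n : (K.+1 <= n)%N -> 0 <= sups u n.
  move=> Kn; apply: le_trans (u0 n) _.
  by apply: ub_le_sup; [exists r; exact: ubK|exists n => /=].
(* The tail suprema are controlled only from [K.+1] on, so monotone convergence is applied to the
   shifted sequence. *)
have cv : cvgn (sups u).
  suff : cvgn (fun n => sups u (n + K.+1)%N).
    by move=> /cvg_ex[l hl]; apply/cvg_ex; exists l; rewrite -(cvg_shiftn K.+1).
  apply: nonincreasing_is_cvgn.
    move=> k l kl; apply: ge_sup => // x [j /= lj <-].
    by apply: ub_le_sup; [exists r; apply: ubK; lia|exists j => //=; lia].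
  by exists 0 => _ [n _ <-]; apply: sups_ge0; lia.
apply/andP; split; [apply: limr_ge|apply: limr_le] => //; exists K.+1 => // n /= Kn.
by apply: ge_sup => //; exact: ubK.
Qed.

(** The joint spectral radius exceeds [d ^ (- alpha)], so some long product has spectral radius
    above [r ^ k]. The row sum bound yields an entry, hence a mass, above [r ^ k / A], and prefixing
    [b] turns its value into a block. *)
Lemma heavy_block alpha : (alpha_low d p < alpha%:E)%E ->
  exists l v, block l v /\ - alpha * l%:R * L < ln (E l v%:Z).
Proof.
have d1 : (3%:R : R) <= d%:R by rewrite ler_nat.
have L0 : 0 < L by rewrite ln_gt0; lra.
rewrite /alpha_low /dlog; case: eqP => // j0.
rewrite lte_fin /delta => hj.
pose lam := ln (jsr d p).
have hlam : - alpha * L < lam.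
  have e : - L^-1 * lam * L = - lam by rewrite mulrAC mulNr mulVf ?gt_eqF // mulN1r.
  by move: hj; rewrite -/lam -(ltr_pM2r L0) e; lra.
pose A := NN d m.
have jp : 0 < jsr d p.
  rewrite lt_neqAle eq_sym; apply/andP; split; first exact/eqP.
  suff /andP[] : 0 <= jsr d p <= A%:R by [].
  apply: (@jsr_bounds _ 1) => // k k1 s; apply: (@le_trans _ _ (A%:R * 1)).
    by apply: spec_rad_le => // i j; rewrite Mw_mass ?ger0_norm ?mass_ge0 ?mass_le1 //; lia.
  rewrite mulr1; case: k k1 {s} => // k _.
  by rewrite exprS -[leLHS]mulr1 ler_wpM2l // exprn_ege1 // ler1n.
(* Halfway, on the logarithmic scale, between [d ^ (- alpha)] and the joint spectral radius: for
   long words the surplus pays for the constant [c]. *)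
pose r := expR ((lam - alpha * L) / 2).
have rj : r < jsr d p by rewrite -ltr_ln ?posrE ?expR_gt0 // /r expRK -/lam; lra.
(* The factor [A^-1] is lost in passing from a spectral radius to an entry, [p b] in prefixing the
   barrier digit. *)
pose c := p b / A%:R.
have c0 : 0 < c by rewrite divr_gt0 // ltr0n.
have [K hK] : exists K : nat, forall n, (K <= n)%N ->
    - alpha * n.+1%:R * L < ln (c * r ^+ n).
  have e0 : 0 < (lam + alpha * L) / 2 by lra.
  have [K hK] := nat_gt ((- ln c - alpha * L) / ((lam + alpha * L) / 2)).
  exists K => n hn.
  rewrite lnM ?posrE ?exprn_gt0 ?expR_gt0 // lnXn ?expR_gt0 // expRK -natr1.
  have : (- ln c - alpha * L) / ((lam + alpha * L) / 2) < n%:R.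
    by apply: lt_le_trans hK _; rewrite ler_nat.
  rewrite ltr_pdivrMr // -mulr_natl; nra.
have [k [s [Kk hs]]] : exists k (s : k.-tuple 'I_m.+1), (K <= k)%N /\ r ^+ k < spec_rad (Mw d p s).
  apply: contrapT => no; move: rj; apply/negP; rewrite -leNgt.
  suff /andP[] : 0 <= jsr d p <= r by [].
  apply: (@jsr_bounds r K); first exact/ltW/expR_gt0.
  move=> k Kk s; rewrite leNgt; apply/negP => hs; apply: no.
  by exists k, s.
have rk0 : 0 < r ^+ k by rewrite exprn_gt0 // expR_gt0.
have [z [hz1 hz2]] : exists z, r ^+ k / A%:R < E k z /\ 0 <= z.
  apply: contrapT => no; move: hs; apply/negP; rewrite -leNgt.
  have -> : r ^+ k = A%:R * (r ^+ k / A%:R) by rewrite mulrC divfK // pnatr_eq0.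
  apply: spec_rad_le; first by rewrite divr_ge0 // ltW.
  move=> i j; rewrite Mw_mass; last by lia.
  set z := (_ - _ * _); rewrite ger0_norm ?mass_ge0 //.
  rewrite leNgt; apply/negP => h; apply: no; exists z; split => //.
  have [] // := @mass_in _ d m p k z.
  by rewrite gt_eqF //; apply: lt_trans h; rewrite divr_gt0 // ltr0n.
have zn : z != 0 -> True by [].
have [] := @mass_in _ d m p k z.
  by rewrite gt_eqF //; apply: lt_trans hz1; rewrite divr_gt0 // ltr0n.
case: z hz1 hz2 {zn} => // z hz1 hz2 _ zN.
exists k.+1, (b * d ^ k + z)%N; split; first exact: block_cons.
apply: lt_le_trans (hK _ Kk) _.
have := @mass_term _ d m p p_gt0 k (b * d ^ k + z)%N%:Z b.
rewrite [X in mass d p k X](_ : _ = z%:Z); last by rewrite PoszD PoszM addrAC subrr add0r.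
move=> h; rewrite ler_ln ?posrE; last 2 first.
- by rewrite mulr_gt0.
- by apply: lt_le_trans h; rewrite mulr_gt0 //; apply: lt_trans hz1; rewrite divr_gt0 // ltr0n.
apply: le_trans h; rewrite /c mulrAC -mulrA ler_pM2l //.
exact: ltW.
Qed.

Lemma aa_lt : (aa d m < NN d m)%N.
Proof. by rewrite /NN -addnn ltnS leq_addr. Qed.

Lemma p_le1 i : p i <= 1.
Proof. by rewrite -p_sum1 (bigD1 i) //= lerDl; apply: sumr_ge0 => j _; exact: ltW. Qed.

(** One word [s] witnesses that the infimum lies below [d ^ (- alpha)]. Powers of its matrix [P]
    decay accordingly, and the mass of the block [b s s ... s] is an entry of [P ^+ j *m Mi b]. *)
Lemma light_block alpha : (alpha%:E < alpha_star d p)%E ->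
  exists l v, block l v /\ ln (E l v%:Z) < - alpha * l%:R * L.
Proof.
have d1 : (3%:R : R) <= d%:R by rewrite ler_nat.
have L0 : 0 < L by rewrite ln_gt0; lra.
rewrite /alpha_star; set S := (X in inf X) => hS.
have Sne : S !=set0.
  have h1 : (1 < m.+1)%N by lia.
  exists (spec_rad (Mw d p [tuple Ordinal h1]) `^ (1%:R^-1)), 0%N, [tuple Ordinal h1].
  by split => //; split => //=; apply/eqP => /=; lia.
have infS0 : 0 <= inf S.
  by apply: lb_le_inf => // _ [k [s [_ [_ ->]]]]; exact: powR_ge0.
pose r := expR (- alpha * L).
have : inf S < r.
  move: hS; rewrite /dlog; case: eqP => [-> _|/eqP S0]; first exact: expR_gt0.
  have Sp : 0 < inf S by rewrite lt_neqAle eq_sym S0.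
  rewrite lte_fin /delta => h; rewrite -ltr_ln ?posrE ?expR_gt0 // /r expRK.
  have e : - L^-1 * ln (inf S) * L = - ln (inf S).
    by rewrite mulrAC mulNr mulVf ?gt_eqF // mulN1r.
  by move: h; rewrite -(ltr_pM2r L0) e; lra.
move=> /(inf_lt Sne)[_ [n [s [_ [_ ->]]]] hs].
pose P := Mw d p s.
have hP : spec_rad P < r ^+ n.+1.
  rewrite ltNge; apply/negP => h; move: hs; apply/negP; rewrite -leNgt.
  have {1}-> : r = (r ^+ n.+1) `^ (n.+1%:R^-1).
    by rewrite -powR_mulrn ?ltW ?expR_gt0 // -powRrM mulfV ?powRr1 // ?ltW ?expR_gt0.
  apply: ge0_ler_powR => //; rewrite ?nnegrE ?invr_ge0 ?exprn_ge0 ?ltW ?expR_gt0 //.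
  exact: lt_le_trans (exprn_gt0 _ (expR_gt0 _)) h.
(* The gap between [r1] and [r ^+ n.+1] absorbs the constant [C] once [j] is large. *)
pose r1 := (spec_rad P + r ^+ n.+1) / 2.
have P0 := spec_rad_ge0 P.
have r1P : spec_rad P < r1 by rewrite /r1; lra.
have r1r : r1 < r ^+ n.+1 by rewrite /r1; lra.
have r10 : 0 < r1 by lra.
have [c c0 hc] := pow_bound r1P.
pose C := (NN d m)%:R * (c + 1).
have C0 : 0 < C by rewrite mulr_gt0 ?ltr0n //; lra.
have lr1 : ln r1 < n.+1%:R * (- alpha * L).
  have -> : n.+1%:R * (- alpha * L) = ln (r ^+ n.+1).
    by rewrite lnXn ?expR_gt0 // expRK mulr_natl.
  by rewrite ltr_ln ?posrE // exprn_gt0 // expR_gt0.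
have [j hj] := nat_gt ((ln C + alpha * L) / (n.+1%:R * (- alpha * L) - ln r1)).
pose q := flatten (nseq j (val s)).
have sq : size q = (j * n.+1)%N.
  by rewrite /q size_flatten /shape map_nseq sumn_nseq size_tuple mulnC.
have prodq : \prod_(i <- rev q) Mi d p i = P ^+ j.
  rewrite /q; elim: {sq hj q}j => [|j IH]; first by rewrite big_nil expr0.
  by rewrite /= rev_cat big_cat /= IH exprSr.
have hb : block (size q).+1 (b * d ^ size q + wval d q) by apply/block_cons/wval_le.
exists (size q).+1, (b * d ^ size q + wval d q)%N; split => //.
(* Index [a0] stands for carry [0], so the diagonal entry there is the mass at the value itself. *)
pose a0 := Ordinal aa_lt.
have hE : E (size q).+1 (b * d ^ size q + wval d q)%N%:Z <= C * r1 ^+ j.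
  have <- : Mw d p (in_tuple (b :: q)) a0 a0 = E (size q).+1 (b * d ^ size q + wval d q)%N%:Z.
    by rewrite (Mw_mass _ _ _ _ (ltnW d3)) !subrr mul0r subr0 addr0.
  rewrite /Mw (_ : rev (val (in_tuple (b :: q))) = rcons (rev q) b); last by rewrite rev_cons.
  rewrite big_rcons prodq mxE.
  apply: (@le_trans _ _ (\sum_(k < NN d m) c * r1 ^+ j)).
    apply: ler_sum => k _; apply: le_trans (ler_norm _) _; rewrite normrM.
    rewrite -[leRHS]mulr1; apply: ler_pM; rewrite ?hc //.
    rewrite mxE /pz; case: ifP => _; rewrite ?normr0 // ger0_norm ?p_le1 //.
    exact: ltW.
  rewrite sumr_const card_ord -[leLHS]mulr_natl mulrA ler_pM2r ?exprn_gt0 //.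
  by rewrite /C ler_wpM2l // lerDl.
apply: le_lt_trans (_ : ln (C * r1 ^+ j) < _).
  have h1 := block_mass_gt0 hb.
  have h2 : 0 < C * r1 ^+ j by rewrite mulr_gt0 ?exprn_gt0.
  by move: hE h1 h2; move: (mass _ _ _ _) (C * _) => x y; move=> ? ? ?; rewrite ler_ln ?posrE.
rewrite lnM ?posrE ?exprn_gt0 // lnXn // -mulr_natl sq -natr1 natrM.
by move: hj; rewrite ltr_pdivrMr ?subr_gt0 //; nra.
Qed.

(** Repeating a block multiplies both its length and its log-mass, so each of the two blocks can be
    brought to length [l1 * l2] without changing the side on which it lies. *)
Lemma mixed_blocks alpha : (alpha_low d p < alpha%:E)%E -> (alpha%:E < alpha_star d p)%E ->
  exists l v w, [/\ block l v, block l w, - alpha * l%:R * L < ln (E l v%:Z) &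
    ln (E l w%:Z) < - alpha * l%:R * L].
Proof.
move=> /heavy_block[l1 [v [bv hv]]] /light_block[l2 [w [bw hw]]].
have l10 : (0 < l1)%N by case: bv.
have l20 : (0 < l2)%N by case: bw.
have [v' bv' ev] := block_pow l2.-1 bv.
have [w' bw' ew] := block_pow l1.-1 bw.
move: bv' ev bw' ew; rewrite !prednK // => bv' ev bw' ew.
rewrite [(l1 * l2)%N]mulnC in bw' ew.
exists (l2 * l1)%N, v', w'; split => //.
  rewrite ev lnXn ?block_mass_gt0 // -mulr_natl natrM.
  have : (0 : R) < l2%:R by rewrite ltr0n.
  by move: hv; set x := ln _; move=> hv h; rewrite -(ltr_pM2l h) in hv; lra.
rewrite ew lnXn ?block_mass_gt0 // -mulr_natl natrM.
have : (0 : R) < l1%:R by rewrite ltr0n.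
by move: hw; set x := ln _; move=> hw h; rewrite -(ltr_pM2l h) in hw; lra.
Qed.

End Blocks.

(** * Hausdorff measure *)

Section Hausdorff.
Context {R : realType}.
Implicit Types (s delta : R) (E U : set R).

Lemma diamR_ge0 U : 0 <= diamR U.
Proof.
rewrite /diamR; set D := (X in sup X).
have [hD|/sup_out -> //] := pselect (has_sup D).
have [[z Dz] _] := hD; apply: le_trans (sup_upper_bound hD Dz).
by case: Dz => x _ [y _ <-].
Qed.

Lemma diamR_le U c : 0 <= c -> (forall x y, U x -> U y -> `|x - y| <= c) -> diamR U <= c.
Proof.
move=> c0 hU; rewrite /diamR; set D := (X in sup X).
have [->|/set0P Dne] := eqVneq D set0; first by rewrite sup0.
by apply: ge_sup => // _ [x Ux [y Uy <-]]; exact: hU.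
Qed.

Lemma dist_le_diamR U c x y : (forall x y, U x -> U y -> `|x - y| <= c) ->
  U x -> U y -> `|x - y| <= diamR U.
Proof.
move=> hU Ux Uy; apply: ub_le_sup; last by exists x => //; exists y.
by exists c => _ [u Uu [v Uv <-]]; exact: hU.
Qed.

Definition cost s (U : nat -> set R) : \bar R := (\sum_(0 <= n <oo) ((diamR (U n)) `^ s)%:E)%E.

Lemma cost_ge0 s (U : nat -> set R) : (0 <= cost s U)%E.
Proof. by apply: nneseries_ge0 => n _ _; rewrite lee_fin powR_ge0. Qed.

Lemma hausdorff_null s E :
  (forall delta e, 0 < delta -> 0 < e ->
     exists2 U, delta_cover delta E U & (cost s U <= e%:E)%E) ->
  hausdorff_measure s E = 0%E.
Proof.
move=> h; apply/eqP; rewrite eq_le; apply/andP; split.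
  apply: ge_ereal_sup => _ [delta delta0 <-].
  apply/lee_addgt0Pr => e e0; rewrite add0e.
  have [U hU cU] := h _ _ delta0 e0.
  by apply: le_trans cU; apply: ereal_inf_lbound; exists U.
apply: le_trans (_ : hausdorff_pre s 1 E <= _)%E.
  by apply: le_ereal_inf_tmp => _ [U _ <-]; exact: cost_ge0.
by apply: ereal_sup_ubound; exists 1 => //=.
Qed.

Lemma hausdorff_nullP s E delta e : hausdorff_measure s E = 0%E ->
  0 < delta -> 0 < e ->
  exists2 U, delta_cover delta E U & (cost s U <= e%:E)%E.
Proof.
move=> h d0 e0.
have : (hausdorff_pre s delta E < e%:E)%E.
  apply: (@le_lt_trans _ _ 0%E); last by rewrite lte_fin.
  by rewrite -h; apply: ereal_sup_ubound; exists delta.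
move=> /ereal_inf_lt[_ [U hU <-]] cU.
by exists U => //; exact: ltW.
Qed.

Lemma hausdorff_null_subset s E F : E `<=` F ->
  hausdorff_measure s F = 0%E -> hausdorff_measure s E = 0%E.
Proof.
move=> EF hF; apply: hausdorff_null => delta e d0 e0.
have [U [FU dU] cU] := hausdorff_nullP hF d0 e0.
by exists U => //; split => //; apply: subset_trans FU.
Qed.

Lemma hausdorff_null_finite s E : 0 < s ->
  (forall delta e, 0 < delta -> 0 < e -> exists n (c : nat -> R) r,
     [/\ 0 <= r, 2 * r <= delta, n%:R * (2 * r) `^ s <= e &
      forall x, E x -> exists2 i, (i < n)%N & `|x - c i| <= r]) ->
  hausdorff_measure s E = 0%E.
Proof.
move=> s0 h; apply: hausdorff_null => delta e d0 e0.
have [n [c [r [r0 rd ne hc]]]] := h _ _ d0 e0.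
pose U i : set R := [set x | (i < n)%N /\ `|x - c i| <= r].
have dU i x y : U i x -> U i y -> `|x - y| <= 2 * r.
  move=> [_ hx] [_ hy].
  rewrite (_ : x - y = (x - c i) - (y - c i)); last by ring.
  by apply: le_trans (ler_normB _ _) _; lra.
have r20 : 0 <= 2 * r by lra.
exists U.
  split; first by move=> x /hc[i ni hi]; exists i.
  by move=> i x y Ux Uy; apply: le_trans rd; exact: dU Ux Uy.
apply: (@le_trans _ _ (n%:R * (2 * r) `^ s)%:E); last by rewrite lee_fin.
rewrite /cost (nneseries_split 0 n); last by move=> k _; rewrite lee_fin powR_ge0.
(* The sets from index [n] on are empty and have diameter [0]; they cost nothing because [s > 0]. *)
rewrite add0n [X in (_ + X)%E]eseries0 ?adde0; last first.
  move=> k nk _; rewrite (_ : U k = set0); last first.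
    by apply/seteqP; split => x //= []; rewrite ltnNge nk.
  rewrite (_ : diamR set0 = 0) ?powR0 ?gt_eqF //.
  by apply/eqP; rewrite eq_le diamR_ge0 diamR_le.
rewrite sumEFin lee_fin big_mkord.
have -> : n%:R * (2 * r) `^ s = \sum_(i < n) (2 * r) `^ s.
  by rewrite sumr_const card_ord mulr_natl.
apply: ler_sum => i _; apply: ge0_ler_powR; rewrite ?nnegrE ?diamR_ge0 ?(ltW s0) //.
by apply: diamR_le => // x y; exact: dU.
Qed.

Lemma hausdorff_null_point s x : 0 < s -> hausdorff_measure s [set x] = 0%E.
Proof.
move=> s0; apply: hausdorff_null_finite => // delta e d0 e0.
exists 1%N, (fun=> x), 0; split; rewrite ?mulr0 ?powR0 ?gt_eqF ?mulr0 ?(ltW d0) ?(ltW e0) //.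
by move=> _ ->; exists 0%N => //; rewrite subrr normr0.
Qed.

(** Covers of cost [e / 2 ^ n.+1] are merged along a bijection between [nat] and its square. *)
Lemma hausdorff_null_bigcup s (F : nat -> set R) :
  (forall j, hausdorff_measure s (F j) = 0%E) ->
  hausdorff_measure s (\bigcup_j F j) = 0%E.
Proof.
move=> hF; apply: hausdorff_null => delta e d0 e0.
pose P n (B : nat -> set R) := delta_cover delta (F n) B /\
  (cost s B <= (e / (2 ^ n.+1)%:R)%:E)%E.
have [G PG] : {G : nat -> nat -> set R & forall n, P n (G n)}.
  apply: (@choice _ _ P) => n; rewrite /P.
  have e1 : 0 < e / (2 ^ n.+1)%:R by rewrite divr_gt0 // ltr0n expn_gt0.
  by have [B hB cB] := hausdorff_nullP (hF n) d0 e1; exists B.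
pose mu (U : set R) : \bar R := ((diamR U) `^ s)%:E.
have muG_ge0 x : (0 <= (mu \o uncurry G) x)%E by rewrite lee_fin powR_ge0.
have /card_esym/ppcard_eqP[f] := card_nat2.
exists (uncurry G \o f).
  split => [x [j _ /(PG j).1.1 [k _ xk]]|n x y].
    by exists (f^-1%FUN (j, k)) => //=; rewrite invK ?inE.
  by move=> /=; case: (f n) => j k /=; apply: (PG j).1.2.
apply: (@le_trans _ _ (\esum_(i in setT) (mu \o uncurry G) i)%E).
  rewrite /cost -/(mu _).
  rewrite (_ : (\sum_(0 <= n <oo) _)%E = (\sum_(n <oo) (mu \o uncurry G) (f n))%E) //.
  rewrite -(esum_pred_image (mu \o uncurry G) _ xpredT) ?[fun=> _]set_true//.
  by rewrite image_eq.
rewrite (_ : esum _ _ = (\sum_(i <oo) \sum_(j <oo ) mu (G i j))%E); last first.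
  pose J : nat -> set (nat * nat) := fun i => [set (i, j) | j in setT].
  rewrite (_ : setT = \bigcup_k J k); last first.
    by rewrite predeqE => -[a b]; split => // _; exists a => //; exists b.
  rewrite esum_bigcupT /=; last 2 first.
    - apply/trivIsetP => i j _ _ ij.
      rewrite predeqE => -[n m] /=; split => //= -[] [_] _ [<-{n} _].
      by move=> [m' _] [] /esym/eqP; rewrite (negbTE ij).
    - by move=> x; exact: muG_ge0.
  rewrite -(image_id [set: nat]) -fun_true esum_pred_image//; last first.
    by move=> n _; apply: esum_ge0 => x _; exact: muG_ge0.
  apply: eq_eseriesr => /= j _.
  rewrite -(esum_pred_image (mu \o uncurry G) (pair j) predT)//=; last first.
    by move=> ? ? _ _; exact: (@can_inj _ _ _ snd).
    by move=> n _; exact: (muG_ge0 (j, n)).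
  by congr esum; rewrite predeqE => -[a b]; split; move=> [i _ <-]; exists i.
apply: le_trans (epsilon_trick0 xpredT (ltW e0)).
apply: lee_nneseries => [i _ _|i _]; last exact: (PG i).2.
exact: cost_ge0.
Qed.

(* An inverse-Hoelder map pulls covers of [E] back to covers of the unit interval. *)
Lemma hausdorff_pos s E (X : R -> R) C :
  (forall y, 0 <= y < 1 -> E (X y)) ->
  (forall y y', 0 <= y < 1 -> 0 <= y' < 1 -> `|y - y'| <= C * `|X y - X y'| `^ s) ->
  0 <= s -> 0 < C -> hausdorff_measure s E <> 0%E.
Proof.
(* With cost at most [(4 * C)^-1], the pulled back intervals, of length [2 * C] times a summand of
   the cost, have total length at most [1 / 2] and cannot cover [[0, 1)]. *)
move=> hE hX s0 C0 /hausdorff_nullP => /(_ 1 (4 * C)^-1 ltr01).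
rewrite invr_gt0 mulr_gt0 // => /(_ isT)[U [EU dU] cU].
pose V n := [set y | 0 <= y < 1 /\ U n (X y)].
pose rho n := C * (diamR (U n)) `^ s.
have rho0 n : 0 <= rho n by rewrite mulr_ge0 ?powR_ge0 ?ltW.
have [c hc] : {c : nat -> R & forall n y, V n y -> `|y - c n| <= rho n}.
  apply: (@choice _ _ (fun n c => forall y, V n y -> `|y - c| <= rho n)) => n.
  have [V0|/set0P[c [c01 Uc]]] := eqVneq (V n) set0.
    by exists 0 => y; rewrite V0.
  exists c => y [y01 Uy]; apply: le_trans (hX _ _ y01 c01) _.
  rewrite ler_pM2l //; apply: ge0_ler_powR; rewrite ?nnegrE ?diamR_ge0 //.
  exact: dist_le_diamR (dU n) Uy Uc.
pose I n : set R := `[c n - rho n, c n + rho n]%classic.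
have cover : `[0 : R, 1[%classic `<=` \bigcup_n I n.
  move=> y /=; rewrite in_itv /= => y01.
  have [n _ Un] := EU _ (hE _ y01).
  exists n => //; rewrite /I /= in_itv /=.
  by have := hc n y (conj y01 Un); rewrite ler_norml; lra.
have e01 : lebesgue_measure (`[0, 1[%classic : set R) = 1%E.
  by rewrite lebesgue_measure_itv /= lte_fin ltr01 -EFinB subr0.
have : (1%E <= \sum_(n <oo) lebesgue_measure (I n))%E.
  rewrite -e01; exact: (measure_sigma_subadditive lebesgue_measure
    (fun n => measurable_itv _) (measurable_itv _) cover).
apply/negP; rewrite -ltNge.
apply: (@le_lt_trans _ _ (\sum_(n <oo) ((2 * C)%:E * ((diamR (U n)) `^ s)%:E))%E).
  apply: lee_nneseries => n _.
    by move=> _; exact: measure_ge0.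
  rewrite lebesgue_measure_itv /= lte_fin; case: ifP => _.
    by rewrite -EFinB -EFinM lee_fin /rho; lra.
  by rewrite -EFinM lee_fin !mulr_ge0 ?powR_ge0 // ltW.
rewrite nneseriesZl; last by move=> n _; rewrite lee_fin powR_ge0.
apply: le_lt_trans (_ : ((2 * C)%:E * ((4 * C)^-1)%:E < _)%E).
  by rewrite lee_pmul2l // ?lte_fin ?mulr_gt0.
rewrite -EFinM lte_fin.
have -> : 2 * C * (4 * C)^-1 = 2^-1 by field; rewrite gt_eqF.
lra.
Qed.

End Hausdorff.

(** * Ball measures of a self-similar measure *)

Section SelfSimilar.
Context {R : realType} (d m : nat) (p : 'I_m.+1 -> R) (mu : probability R R).
Hypotheses (d3 : (3 <= d)%N).
Hypotheses (p_gt0 : forall i, 0 < p i) (p_sum1 : \sum_i p i = 1).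
Hypothesis mu_compact : exists K : set R, compact K /\ mu (~` K) = 0%E.
Hypothesis mu_selfsim : forall A : set R, measurable A ->
  mu A = (\sum_(i < m.+1) (p i)%:E * mu [set (d%:R * x - (i : nat)%:R)%R | x in A])%E.

Local Notation xi := (xi (R := R) d m).
Local Notation E := (mass d p).
Local Notation N := (maxval d m).

Definition prob (A : set R) : R := fine (mu A).
Definition rescale (c v : R) (A : set R) : set R := [set c * x - v | x in A].

Lemma rescaleE c v A : c != 0 -> rescale c v A = (fun y => c^-1 * (y + v)) @^-1` A.
Proof.
move=> c0; apply/seteqP; split => [_ [x Ax <-] /=|y /= Ay].
  by rewrite subrK mulKf.
by exists (c^-1 * (y + v)); rewrite // mulVKf // addrK.
Qed.

Lemma measurable_rescale c v A : c != 0 -> measurable A -> measurable (rescale c v A).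
Proof.
move=> c0 mA; rewrite rescaleE // -[X in measurable X]setTI.
have mf : measurable_fun [set: R] (fun y : R => c^-1 * (y + v)).
  by apply: measurable_funM => //; apply: measurable_funD.
exact: mf.
Qed.

Lemma prob_ge0 A : 0 <= prob A.
Proof. by rewrite fine_ge0. Qed.

Lemma probE A : measurable A -> mu A = (prob A)%:E.
Proof. by move=> mA; rewrite fineK // fin_num_measure. Qed.

Lemma prob_mono A B : measurable A -> measurable B -> A `<=` B -> prob A <= prob B.
Proof.
by move=> mA mB AB; rewrite -lee_fin -!probE //; apply: le_measure; rewrite ?inE.
Qed.

Lemma prob_le1 A : measurable A -> prob A <= 1.
Proof. by move=> mA; rewrite -lee_fin -probE // probability_le1. Qed.

Lemma prob_setC A : measurable A -> prob (~` A) = 1 - prob A.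
Proof.
move=> mA; rewrite /prob probability_setC // (probE mA).
by rewrite -EFinB.
Qed.

Lemma dk_neq0 k : (d%:R ^+ k : R) != 0.
Proof. by rewrite expf_neq0 // pnatr_eq0; lia. Qed.
Hint Resolve dk_neq0 : core.

Lemma dk_gt0 k : (0 : R) < d%:R ^+ k.
Proof. by rewrite exprn_gt0 // ltr0n; lia. Qed.
Hint Resolve dk_gt0 : core.

(** Iterating self-similarity [k] times gives a sum over words in which the rescaling depends only
    on the value, so the weights add up to [mass]. *)
Lemma prob_selfsim k A : measurable A ->
  prob A = \sum_(v < (N k).+1) E k v%:Z * prob (rescale (d%:R ^+ k) v%:R A).
Proof.
move=> mA; rewrite -(mass_sum_words d p k (fun v => prob (rescale (d%:R ^+ k) v%:R A))).
elim: k A mA => [|k IH] A mA.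
  rewrite (big_pred1 [tuple]); last by move=> s; apply/esym/eqP; exact: tuple0.
  rewrite /weight big_nil mul1r /= expr0; congr (prob _).
  apply/seteqP; split => [x Ax|_ [x Ax <-]]; last by rewrite mul1r subr0.
  by exists x; rewrite // mul1r subr0.
have d0 : (d%:R : R) != 0 by rewrite pnatr_eq0; lia.
rewrite (@sum_cons_tuple R m k (fun s => weight p s * prob (rescale (d%:R ^+ k.+1) (wval d s)%:R A))).
rewrite {1}/prob mu_selfsim //.
rewrite (eq_bigr (fun i : 'I_m.+1 => (p i * prob (rescale d%:R (i : nat)%:R A))%:E)); last first.
  by move=> i _; rewrite EFinM -probE //; exact: measurable_rescale.
rewrite sumEFin /=; apply: eq_bigr => i _.
rewrite IH; last exact: measurable_rescale.
rewrite mulr_sumr; apply: eq_bigr => s _.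
rewrite /weight big_cons mulrA; congr (_ * prob _).
rewrite /rescale image_comp size_tuple; apply: eq_imagel => x _ /=.
by rewrite exprS natrD natrM natrX; ring.
Qed.

Lemma maxval_xi k : (N k)%:R <= xi * d%:R ^+ k.
Proof.
have h := maxval_geom m k (ltn_trans (isT : 0 < 2)%N d3).
have d1 : (2%:R : R) <= d.-1%:R by rewrite ler_nat; lia.
have e : (d%:R - 1 : R) = d.-1%:R by rewrite -subn1 natrB //; lia.
rewrite /Defs.xi e mulrAC ler_pdivlMr; last by lra.
by rewrite -natrX -!natrM ler_nat; lia.
Qed.

(** Rescaling by [d ^ k] multiplies the distance to [[0, xi]] by at least [d ^ k], so for large [k]
    every rescaled copy of [A] misses the compact carrier of [mu]. *)
Lemma prob_out e (A : set R) : 0 < e -> measurable A ->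
  (forall x : R, A x -> x < - e \/ xi + e < x) -> prob A = 0.
Proof.
move=> e0 mA hA.
have [K [cK K0]] := mu_compact.
have mK : measurable (~` K).
  by apply: measurableC; apply: closed_measurable; apply: compact_closed.
have [M hM] : exists M : R, forall x, K x -> `|x| <= M.
  have [M [_ hM]] := compact_bounded cK.
  by exists (M + 1) => x Kx; apply: hM => //; rewrite ltrDl.
have [k hk] : exists k, M < d%:R ^+ k * e.
  have [k hk] : exists k : nat, M / e < k%:R.
    by exists (Num.bound `|M / e|); apply: le_lt_trans (ler_norm _) (archi_boundP _).
  exists k; rewrite -ltr_pdivrMr //; apply: lt_le_trans hk _.
  rewrite -natrX ler_nat; apply: ltnW; apply: ltn_expl; lia.
rewrite (prob_selfsim k) //; apply: big1 => v _.
suff -> : prob (rescale (d%:R ^+ k) v%:R A) = 0 by rewrite mulr0.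
apply/eqP; rewrite eq_le prob_ge0 andbT.
have -> : 0 = prob (~` K) by rewrite /prob K0.
apply: prob_mono => //; first exact: measurable_rescale.
move=> _ [x Ax <-] Kx; have := hM _ Kx.
have v0 : (0 : R) <= v%:R by rewrite ler0n.
have vN : (v%:R : R) <= xi * d%:R ^+ k.
  by apply: le_trans (maxval_xi k); rewrite ler_nat -ltnS.
have D0 := dk_gt0 k.
case: (hA _ Ax) => hx; rewrite ler_norml => /andP[h1 h2].
  have : d%:R ^+ k * x < d%:R ^+ k * - e by rewrite ltr_pM2l.
  lra.
have : d%:R ^+ k * (xi + e) < d%:R ^+ k * x by rewrite ltr_pM2l.
lra.
Qed.

Lemma prob_in e (A : set R) : 0 < e -> measurable A ->
  (forall x : R, - e <= x <= xi + e -> A x) -> prob A = 1.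
Proof.
move=> e0 mA hA.
have : prob (~` A) = 0.
  apply: (prob_out e0); first exact: measurableC.
  move=> x nA; have [x1|x1] := ltP x (- e); first by left.
  have [x2|x2] := ltP (xi + e) x; first by right.
  by exfalso; apply: nA; apply: hA; rewrite x1 x2.
by rewrite prob_setC // => /eqP; rewrite subr_eq0 => /eqP.
Qed.

Lemma measurable_ballR (x r : R) : measurable (ball x r).
Proof. by apply: open_measurable; exact: ball_open. Qed.
Hint Resolve measurable_ballR : core.

Lemma rescale_ball k v x r t : rescale (d%:R ^+ k) v (ball x r) t <->
  `|x - (v + t) / d%:R ^+ k| < r.
Proof.
rewrite rescaleE // /ball /= [_^-1 * _]mulrC [t + v]addrC //.
Qed.

Lemma mass_le_ball e k (v : nat) x r : 0 < e -> (v <= N k)%N ->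
  (forall t, - e <= t <= xi + e -> `|x - (v%:R + t) / d%:R ^+ k| < r) ->
  E k v%:Z <= prob (ball x r).
Proof.
move=> e0 vN h; have vN' : (v < (N k).+1)%N by [].
rewrite (prob_selfsim k) // (bigD1 (Ordinal vN')) //=.
rewrite (prob_in e0); last 2 first.
- exact: measurable_rescale.
- by move=> t ht; apply/rescale_ball; exact: h.
rewrite mulr1 lerDl; apply: sumr_ge0 => i _.
by rewrite mulr_ge0 ?mass_ge0 ?prob_ge0.
Qed.

Lemma ball_le_mass e k x r : 0 < e ->
  prob (ball x r) <= \sum_(v < (N k).+1 | `[< exists2 t, - e <= t <= xi + e &
    `|x - ((v : nat)%:R + t) / d%:R ^+ k| < r >]) E k v%:Z.
Proof.
move=> e0; rewrite (prob_selfsim k) // [leRHS]big_mkcond /=; apply: ler_sum => v _.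
have mr : measurable (rescale (d%:R ^+ k) v%:R (ball x r)) by exact: measurable_rescale.
case: asboolP => hv.
  by rewrite -[leRHS]mulr1 ler_wpM2l ?mass_ge0 // prob_le1.
rewrite (prob_out e0) ?mulr0 // => t /rescale_ball ht.
have [x1|x1] := ltP t (- e); first by left.
have [x2|x2] := ltP (xi + e) t; first by right.
by exfalso; apply: hv; exists t; rewrite ?x1 ?x2.
Qed.

Lemma ball_le_one_mass e k (w : nat) x r : 0 < e ->
  (forall (v : nat) t, v != w -> - e <= t <= xi + e -> r <= `|x - (v%:R + t) / d%:R ^+ k|) ->
  prob (ball x r) <= E k w%:Z.
Proof.
move=> e0 h; apply: le_trans (ball_le_mass k x r e0) _.
have [wN|wN] := leqP w (N k); last first.
  rewrite big_pred0 ?mass_ge0 // => v; apply/asboolP => -[t ht].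
  apply/negP; rewrite -leNgt; apply: h => //; have := ltn_ord v; lia.
have wN' : (w < (N k).+1)%N by [].
rewrite big_mkcond /= (bigD1 (Ordinal wN')) //= big1 ?addr0.
  by case: ifP => _ //; rewrite mass_ge0.
move=> v; rewrite -val_eqE /= => vw; case: asboolP => // -[t ht].
by rewrite ltNge h.
Qed.

(** A cylinder that meets the ball satisfies [x * d ^ k - v = t] up to [3] with [t] between [-1] and
    [xi + 1 < 3], whence the [6]. Fewer than [26] values qualify, and the heaviest of them is
    taken. *)
Lemma ball_le_near_mass k x (r : R) : 0 < r -> r * d%:R ^+ k = 3 -> xi < 2 ->
  0 < prob (ball x r) ->
  exists v : nat, [/\ (v <= N k)%N, `|x * d%:R ^+ k - v%:R| <= 6 &
    prob (ball x r) <= 26 * E k v%:Z].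
Proof.
move=> r0 rk xi2 P0.
pose Q (v : 'I_(N k).+1) := `[< exists2 t, - 1 <= t <= xi + 1 &
    `|x - ((v : nat)%:R + t) / d%:R ^+ k| < r >].
have hP := ball_le_mass k x r ltr01; rewrite -/Q in hP.
have Qd v : Q v -> `|x * d%:R ^+ k - (v : nat)%:R| <= 6.
  move=> /asboolP[t ht].
  rewrite -(ltr_pM2r (dk_gt0 k)) rk -[X in _ * X](ger0_norm (ltW (dk_gt0 k))) -normrM.
  by rewrite mulrBl divfK // ltr_norml ler_norml; lra.
have [v0 Qv0] : exists v0, Q v0.
  apply: contrapT => no; move: P0; apply/negP; rewrite -leNgt.
  apply: le_trans hP _; rewrite big_pred0 // => v; apply/negbTE/negP => Qv.
  by apply: no; exists v.
pose v1 := [arg max_(v > v0 | Q v) E k (v : nat)%:Z]%O.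
have [Qv1 hv1] : Q v1 /\ forall v, Q v -> E k (v : nat)%:Z <= E k (v1 : nat)%:Z.
  by rewrite /v1; case: arg_maxP.
exists v1; split; [by rewrite -ltnS|exact: Qd|].
apply: le_trans hP _.
apply: (@le_trans _ _ (\sum_(v | Q v) E k (v1 : nat)%:Z)); first exact: ler_sum.
rewrite sumr_const -[leLHS]mulr_natl ler_wpM2r ?mass_ge0 // ler_nat.
(* Values within [12] of [v1], shifted by [13 - v1], land in ['I_26]. *)
pose f (v : 'I_(N k).+1) : 'I_26 := inord (v + 13 - v1)%N.
suff /leq_card_in : {in Q &, injective f} by rewrite card_ord.
have dv v : Q v -> (v1 < v + 13)%N /\ (v < v1 + 13)%N.
  move=> /Qd h; have h' := Qd _ Qv1.
  have : `|v%:R - v1%:R| <= (12 : R).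
    rewrite (_ : _ - _ = (x * d%:R ^+ k - (v1 : nat)%:R) - (x * d%:R ^+ k - (v : nat)%:R)); last by ring.
    by apply: le_trans (ler_normB _ _) _; lra.
  rewrite ler_norml => /andP[a1 a2]; split; rewrite -(ltr_nat R) natrD; lra.
move=> v w Qv Qw /(congr1 val) /=; have [h1 h2] := dv _ Qv; have [h3 h4] := dv _ Qw.
rewrite !inordK; [|lia|lia] => h.
by apply/val_inj => /=; lia.
Qed.

End SelfSimilar.

(** * Pressure *)

Lemma ler_sum_uniq (R : realType) (T : eqType) (s1 s2 : seq T) (F : T -> R) :
  uniq s1 -> uniq s2 -> {subset s1 <= s2} -> (forall x, 0 <= F x) ->
  \sum_(x <- s1) F x <= \sum_(x <- s2) F x.
Proof.
move=> u1 u2 s12 F0; rewrite [leRHS](bigID (mem s1)) /=.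
have -> : \sum_(x <- s2 | x \in s1) F x = \sum_(x <- s1) F x.
  rewrite -big_filter; apply: perm_big.
  apply: uniq_perm => // [|x]; first exact: filter_uniq.
  by rewrite mem_filter andb_idr // => /s12.
by rewrite lerDl; apply: sumr_ge0 => i _; exact: F0.
Qed.

(* Fekete's lemma for superadditive sequences. *)
Lemma superadditive_cvg (R : realType) (a : nat -> R) (M : R) :
  (forall k l, (0 < k)%N -> (0 < l)%N -> a k + a l <= a (k + l)%N) ->
  (forall k, (0 < k)%N -> a k <= M * k%:R) ->
  a k / k%:R @[k --> \oo] --> sup [set a k.+1 / k.+1%:R | k in [set: nat]].
Proof.
move=> sa aM; set S := [set a k.+1 / k.+1%:R | k in _].
have kp (k : nat) : (0 : R) < k.+1%:R by rewrite ltr0n.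
have hS : has_sup S.
  split; first by exists (a 1%N / 1%:R), 0%N.
  by exists M => _ [k _ <-]; rewrite ler_pdivrMr // aM.
apply/cvgrPdist_le => e e0.
have e20 : 0 < e / 2 by rewrite divr_gt0.
have [_ [k _ <-] hk] := sup_adherent e20 hS.
set t := a k.+1 / k.+1%:R in hk.
pose c := \sum_(r < k.+2) `|a r|.
have ac (r : nat) : (r <= k.+1)%N -> - c <= a r.
  move=> rk; rewrite lerNl; have rk' : (r < k.+2)%N by [].
  apply: (@le_trans _ _ `|a r|); first by rewrite -normrN ler_norm.
  by rewrite /c (bigD1 (Ordinal rk')) //= lerDl; apply: sumr_ge0.
have mul_a q : a k.+1 * q.+1%:R <= a (q.+1 * k.+1)%N.
  elim: q => [|q IH]; first by rewrite mulr1 mul1n.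
  rewrite [in leRHS]mulSn addnC; apply: le_trans (sa _ _ _ _) => //.
  by rewrite -natr1 mulrDr mulr1 lerD2r.
have lb n : (k.+1 < n)%N -> n%:R * t - (k.+1%:R * `|t| + c) <= a n.
  (* The remainder runs from [1] to [k.+1] instead of from [0], because superadditivity is available
     only at positive indices. *)
  move=> kn; pose q := (n.-1 %/ k.+1)%N; pose r := (n.-1 %% k.+1).+1.
  have en : n = (q * k.+1 + r)%N by rewrite /q /r addnS -divn_eq; lia.
  have rk : (r <= k.+1)%N by rewrite /r ltn_pmod.
  have q0 : (0 < q)%N by rewrite divn_gt0 //; lia.
  rewrite en; apply: le_trans (sa _ _ _ _) => //; last by rewrite muln_gt0 q0.
  have := mul_a q.-1; rewrite prednK // => h.
  apply: le_trans (lerD h (ac _ rk)).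
  have -> : a k.+1 = t * k.+1%:R by rewrite /t divfK // gt_eqF.
  rewrite natrD natrM mulrDl.
  have : r%:R * t <= k.+1%:R * `|t|.
    apply: le_trans (ler_norm _) _; rewrite normrM ger0_norm //.
    by rewrite ler_wpM2r // ler_nat.
  nra.
have [K hK] := nat_gt ((k.+1%:R * `|t| + c) / (e / 2)).
exists (maxn K k.+2) => // n /= hn.
have nK : (K <= n)%N by apply: leq_trans hn; rewrite leq_maxl.
have nk : (k.+2 <= n)%N by apply: leq_trans hn; rewrite leq_maxr.
case: n nK nk {hn} => // n nK nk.
have ub : a n.+1 / n.+1%:R <= sup S by apply: sup_upper_bound => //; exists n.
rewrite ger0_norm ?subr_ge0 // lerBlDr -lerBlDl.
apply: (@le_trans _ _ (t - e / 2)); first by lra.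
rewrite ler_pdivlMr //; apply: le_trans (lb _ nk).
have : (k.+1%:R * `|t| + c) < e / 2 * n.+1%:R.
  rewrite [ltRHS]mulrC -ltr_pdivrMr //; apply: lt_le_trans hK _.
  by rewrite ler_nat.
nra.
Qed.

Section Pressure.
Context {R : realType} (d m : nat) (p : 'I_m.+1 -> R) (b : 'I_m.+1).
Hypotheses (d3 : (3 <= d)%N) (dm : (d <= m)%N).
Hypotheses (p_gt0 : forall i, 0 < p i) (p_sum1 : \sum_i p i = 1).
Hypotheses (B1 : (b * d.-1 + m < d * d.-1)%N) (B2 : (d * m < (b + d) * d.-1)%N).
Local Notation E := (mass d p).
Local Notation N := (maxval d m).
Local Notation L := (ln (d%:R : R)).
Local Notation block := (block d b).
Definition lmass k v : R := ln (E k v%:Z).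

Lemma lmassE k v : lmass k v = ln (E k v%:Z).
Proof. by []. Qed.

(** The index counts the letters after [b]: the elements are blocks of length [n.+1]. *)
Definition blocks n : seq nat := [seq (b * d ^ n + v)%N | v <- iota 0 (N n).+1].

Arguments blocks : simpl never.

Lemma mem_blocks n v : (v \in blocks n) <-> block n.+1 v.
Proof.
split.
  case/mapP => u; rewrite mem_iota add0n => /andP[_ hu] ->; exact: block_cons.
case=> /= _ h1 h2; apply/mapP; exists (v - b * d ^ n)%N; last by rewrite subnKC.
by rewrite mem_iota; lia.
Qed.

Lemma blocks_uniq n : uniq (blocks n).
Proof. by rewrite map_inj_uniq ?iota_uniq // => u v /addnI. Qed.

Lemma size_blocks n : size (blocks n) = (N n).+1.
Proof. by rewrite size_map size_iota. Qed.

Definition expsum n (q : R) : R := \sum_(w <- blocks n) expR (q * lmass n.+1 w).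

Lemma expsum_gt0 n q : 0 < expsum n q.
Proof.
rewrite /expsum /blocks /= big_cons; apply: ltr_pwDl; first exact: expR_gt0.
by apply: sumr_ge0 => w _; exact: expR_ge0.
Qed.

Lemma block_le l v : block l v -> (v <= N l)%N.
Proof. by move=> h; have [] := block_carry_free d3 dm B1 B2 h. Qed.

Lemma lmass_cat k l v w : (v <= N k)%N -> carry_free d m l w ->
  lmass (k + l) (v * d ^ l + w) = lmass k v + lmass l w.
Proof.
move=> hv hw; have d0 : (0 < d)%N by lia.
have dm' : (d <= m.+1)%N by lia.
have [_ _ wN] := hw.
rewrite /lmass -lnM ?posrE ?(mass_gt0 p_gt0) //.
by rewrite -mass_cat //; congr (ln (mass _ _ _ _)); rewrite PoszD PoszM.
Qed.

(** Concatenation embeds pairs of blocks into the blocks of the total length: the second factor is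
    below [d ^ l.+1], so Euclidean division recovers the pair, and the masses multiply. *)
Lemma expsum_cat k l q : expsum k q * expsum l q <= expsum (k + l).+1 q.
Proof.
rewrite {1 2}/expsum big_distrlr /=.
rewrite (eq_big_seq (fun i => \sum_(j <- blocks l) expR (q * lmass (k.+1 + l.+1) (i * d ^ l.+1 + j)))).
  rewrite -(big_allpairs_dep (h := fun i j => (i * d ^ l.+1 + j)%N) (r2 := fun=> blocks l) (F := fun w => expR (q * lmass (k.+1 + l.+1) w))).
  rewrite /expsum -addSn -addnS; apply: ler_sum_uniq => [|||x].
  - apply: allpairs_uniq; rewrite ?blocks_uniq //.
    move=> [i j] [i' j'] /allpairsP[[x y] [_ /mem_blocks hj [-> ->]]].
    move=> /allpairsP[[x' y'] [_ /mem_blocks hj' [-> ->]]] /= e.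
    have [jl _ _] := block_carry_free d3 dm B1 B2 hj.
    have [jl' _ _] := block_carry_free d3 dm B1 B2 hj'.
    have D0 : (0 < d ^ l.+1)%N by rewrite expn_gt0; lia.
    have e1 : x = x'.
      have := congr1 (fun u => u %/ d ^ l.+1)%N e; rewrite !divnMDl // !divn_small // !addn0.
      exact.
    by move: e; rewrite e1 => /addnI ->.
  - exact: blocks_uniq.
  - move=> w /allpairsPdep[i [j [/mem_blocks hi /mem_blocks hj ->]]].
    rewrite addSn -addnS in hi *.
    apply/mem_blocks; rewrite -addSn; apply: block_cat => //; exact: block_le.
  - exact: expR_ge0.
move=> i /mem_blocks hi; apply: eq_big_seq => j /mem_blocks hj.
rewrite -expRD lmass_cat ?mulrDr //; first exact: block_le.
exact: (block_carry_free d3 dm B1 B2 hj).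
Qed.

Definition lexpsum n q : R := ln (expsum n q).

Lemma lexpsum_cat k l q : lexpsum k q + lexpsum l q <= lexpsum (k + l).+1 q.
Proof.
rewrite /lexpsum -lnM ?posrE ?expsum_gt0 // ler_ln ?posrE ?mulr_gt0 ?expsum_gt0 //.
exact: expsum_cat.
Qed.

Context (pm : R).
Hypotheses (pm_gt0 : 0 < pm) (pm_le : forall i, pm <= p i).

Lemma lmass_bound k v : (v <= N k)%N -> k%:R * ln pm <= lmass k v <= 0.
Proof.
move=> vN; have d0 : (0 < d)%N by lia.
have dm' : (d <= m.+1)%N by lia.
have E0 := mass_gt0 p_gt0 d0 dm' vN.
apply/andP; split.
  rewrite mulr_natl -lnXn // ler_ln ?posrE ?exprn_gt0 //.
  exact: mass_lb.
by rewrite -ln1 ler_ln ?posrE // mass_le1.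
Qed.

(** There are at most [2 * d ^ n] blocks, and each log-mass is at most [- ln pm] per letter in
    absolute value. This linear bound makes the pressure finite. *)
Lemma lexpsum_le n q : lexpsum n q <= (ln (2 * d%:R) + `|q| * - ln pm) * n.+1%:R.
Proof.
have pm1 : pm <= 1 by apply: le_trans (pm_le ord0) (p_le1 p_gt0 p_sum1 _).
have lpm : ln pm <= 0 by rewrite -ln1 ler_ln ?posrE.
have d1 : (3%:R : R) <= d%:R by rewrite ler_nat.
rewrite -[leRHS](expRK) /lexpsum ler_ln ?posrE ?expsum_gt0 ?expR_gt0 //.
apply: (@le_trans _ _ (\sum_(w <- blocks n) expR (`|q| * - ln pm * n.+1%:R))).
  rewrite /expsum big_seq [leRHS]big_seq; apply: ler_sum => w /mem_blocks hw.
  rewrite ler_expR; have /andP[h1 h2] := lmass_bound (block_le hw).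
  apply: le_trans (ler_norm _) _; rewrite normrM -mulrA ler_wpM2l //.
  by rewrite ler0_norm //; lra.
rewrite big_const_seq count_predT size_blocks iter_addr_0 mulrDl expRD -[leLHS]mulr_natl.
rewrite ler_pM2r ?expR_gt0 // mulrC expRM_natl lnK ?posrE; last by lra.
have := maxval_lt d3 dm B1 B2 n => h.
apply: (@le_trans _ _ (2 * d%:R ^+ n)); first by rewrite -natrX -natrM ler_nat.
rewrite exprMn; apply: ler_pM => //.
- by rewrite exprS -[leLHS]mulr1 ler_pM2l // exprn_ege1 //; lra.
- by apply: ler_weXn2l => //; lra.
Qed.

Definition pressure q : R := sup [set lexpsum k q / k.+1%:R | k in [set: nat]].

Lemma pressure_cvg q : lexpsum k.-1 q / k%:R @[k --> \oo] --> pressure q.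
Proof.
apply: (@superadditive_cvg _ (fun k => lexpsum k.-1 q) (ln (2 * d%:R) + `|q| * - ln pm)).
  by case=> // k [|l] // _ _; rewrite addSn addnS /=; exact: lexpsum_cat.
by case=> // k _; exact: lexpsum_le.
Qed.

Lemma lexpsum_le_pressure n q : lexpsum n q <= pressure q * n.+1%:R.
Proof.
rewrite -ler_pdivrMr ?ltr0n //; apply: ub_le_sup; last by exists n.
exists (ln (2 * d%:R) + `|q| * - ln pm) => _ [k _ <-].
by rewrite ler_pdivrMr ?ltr0n //; exact: lexpsum_le.
Qed.

Lemma expsum_le n q : expsum n q <= expR (pressure q * n.+1%:R).
Proof. by rewrite -[leLHS]lnK ?posrE ?expsum_gt0 // ler_expR lexpsum_le_pressure. Qed.

Lemma pressure_gt q t : t < pressure q -> exists n, t < lexpsum n q / n.+1%:R.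
Proof.
move=> /sup_gt => -[|_ [n _ <-] h]; last by exists n.
by exists (lexpsum 0 q / 1%:R), 0%N.
Qed.

Lemma tauhatE (Xi : forall k, {set k.-tuple 'I_m.+1}) q : is_Xi (R:=R) d Xi ->
  tauhat d p b Xi q = - pressure q / L.
Proof.
move=> hXi; have d0 : (0 < d)%N by lia.
have dm' : (d <= m.+1)%N by lia.
apply: cvg_lim => //; rewrite -cvg_shiftS /=.
have -> : (fun k : nat => Defs.delta d / k.+1%:R * ln (\sum_(s in Xi k) Defs.eta d p [tuple of b :: s] `^ q))
  = (fun k => Defs.delta d * (lexpsum k q / k.+1%:R)).
  apply/funext => k; rewrite -mulrA; congr (_ * _); rewrite mulrC; congr (ln _ * _).
  rewrite (eq_bigr (fun s : k.-tuple 'I_m.+1 => expR (q * lmass k.+1 (b * d ^ k + wval d s)))); last first.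
    move=> s _; rewrite etaE //.
    have -> : wval d [tuple of b :: s] = (b * d ^ k + wval d s)%N by rewrite /= (size_tuple s).
    rewrite /powR gt_eqF //.
    apply: (mass_gt0 p_gt0) => //; rewrite [maxval _ _ _]/= leq_add ?leq_mul2r -1?ltnS ?ltn_ord ?orbT //.
    by have := wval_le d s; rewrite size_tuple.
  rewrite (sum_Xi k (fun v => expR (q * lmass k.+1 (b * d ^ k + v))) d0 dm' hXi).
  rewrite /expsum /blocks big_map -(big_mkord xpredT (fun v => expR (q * lmass k.+1 (b * d ^ k + v)))).
  by rewrite /index_iota subn0.
suff : Defs.delta d * (lexpsum k q / k.+1%:R) @[k --> \oo] --> Defs.delta d * pressure q.
  by rewrite /Defs.delta mulNr [_^-1 * _]mulrC -mulNr.
by apply: cvgMl_tmp; have := @pressure_cvg q; rewrite -cvg_shiftS.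
Qed.

End Pressure.

(** * Inserting the barrier digit *)

Section Shift.
Context {R : realType} (d m : nat) (p : 'I_m.+1 -> R) (b : 'I_m.+1).
Hypotheses (d3 : (3 <= d)%N) (dm : (d <= m)%N).
Hypotheses (p_gt0 : forall i, 0 < p i) (p_sum1 : \sum_i p i = 1).
Hypotheses (B1 : (b * d.-1 + m < d * d.-1)%N) (B2 : (d * m < (b + d) * d.-1)%N).
Context (pm : R).
Hypotheses (pm_gt0 : 0 < pm) (pm_le : forall i, pm <= p i).

Local Notation E := (mass d p).
Local Notation N := (maxval d m).
Local Notation D k := ((d ^ k)%N%:Z).

Lemma mass_term_pm n z i : (i <= m)%N -> E n (z - i%:Z * D n) <= pm^-1 * E n.+1 z.
Proof.
move=> im; have im' : (i < m.+1)%N by [].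
rewrite -ler_pdivrMl ?invr_gt0 // invrK.
apply: le_trans (mass_term d p_gt0 n z (Ordinal im')).
by rewrite ler_wpM2r ?mass_ge0.
Qed.

Lemma mass_step n z z' C : (forall i : 'I_m.+1, E n (z - (i : nat)%:Z * D n) <= C * z') ->
  0 <= C * z' -> E n.+1 z <= m.+1%:R * C * z'.
Proof.
move=> h h0 /=; rewrite -mulrA.
have -> : m.+1%:R * (C * z') = \sum_(i < m.+1) (C * z').
  by rewrite sumr_const card_ord mulr_natl.
apply: ler_sum => i _; rewrite -[leRHS]mul1r; apply: ler_pM; rewrite ?mass_ge0 ?(ltW (p_gt0 _)) //.
exact: p_le1.
Qed.

(** Consider the leading digit [i] of a word with value [z + d ^ k.+1]. If [i >= d], replacing it by
    [i - d] costs a factor [pm^-1]; if [i = d - 1], the tail has value [z + d ^ k] and the induction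
    on [l] applies; a smaller [i] leaves a tail above [maxval k]. The constant depends on [l] but
    not on [k]. *)
Lemma mass_shift_up l : exists2 C, 0 <= C & forall k z, (l <= k)%N -> D (k - l) <= z ->
  E k (z + D k) <= C * E k z.
Proof.
have dk0 k : 0 < D k by rewrite ltz_nat expn_gt0; lia.
have NE k : (N k)%:Z < 2 * D k by rewrite -[2]/(2%:Z) -PoszM ltz_nat; exact: (maxval_lt d3 dm B1 B2).
elim: l => [|l [C C0 IH]].
  exists 0 => // k z _; rewrite subn0 => hz; rewrite mul0r mass_out //.
  have := NE k; move: (D k) (N k) hz => X Y; lia.
have pmi : 0 < pm^-1 by rewrite invr_gt0.
exists (m.+1%:R * ((1 + C) * pm^-1)); first by rewrite !mulr_ge0 ?addr_ge0 // ltW.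
case=> // k z; rewrite ltnS subSS => lk hz.
have zD : 0 < z by apply: lt_le_trans (dk0 _) hz.
have dS : D k.+1 = d%:Z * D k by rewrite expnS PoszM.
have E0 : 0 <= pm^-1 * E k.+1 z by rewrite mulr_ge0 ?mass_ge0 // ltW.
apply: mass_step; last by rewrite -mulrA mulr_ge0 // addr_ge0.
move=> i; rewrite -mulrA.
have [di|id] := leqP d i.
  have -> : z + D k.+1 - (i : nat)%:Z * D k = z - (i - d)%N%:Z * D k.
    by rewrite dS -subzn //; ring.
  apply: le_trans (mass_term_pm _ _ _) _; first by have := ltn_ord i; lia.
  by rewrite -[leLHS]mul1r ler_wpM2r // lerDl.
have [e|ne] := eqVneq (i : nat) d.-1.
  have -> : z + D k.+1 - (i : nat)%:Z * D k = z + D k.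
    have ed : d%:Z = 1 + (i : nat)%:Z by rewrite e -intS prednK //; lia.
    by rewrite dS ed; ring.
  apply: le_trans (IH _ _ lk hz) _.
  have := @mass_term_pm k z 0 (leq0n _); rewrite mul0r subr0 => h.
  rewrite mulrDl mul1r; apply: (@le_trans _ _ (C * (pm^-1 * E k.+1 z))); last by rewrite lerDr.
  by rewrite ler_wpM2l.
rewrite mass_out; first by rewrite mulr_ge0 // addr_ge0.
apply/orP; right; apply: lt_trans (NE k) _.
have : (d%:Z - (i : nat)%:Z) >= 2 by move: id ne; lia.
move=> h; have h2 : 2 * D k <= (d%:Z - (i : nat)%:Z) * D k by rewrite ler_pM2r.
rewrite dS; have -> : z + d%:Z * D k - (i : nat)%:Z * D k = z + (d%:Z - (i : nat)%:Z) * D k by ring.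
by apply: le_lt_trans h2 _; rewrite ltrDr.
Qed.

(** The mirror image at the right end, under the exchange of digits [i] and [m - i]. *)
Lemma mass_shift_down l : exists2 C, 0 <= C & forall k z, (l <= k)%N ->
  z + D (k - l) <= (N k)%:Z -> E k (z - D k) <= C * E k z.
Proof.
have dk0 k : 0 < D k by rewrite ltz_nat expn_gt0; lia.
have NE k : (N k)%:Z < 2 * D k by rewrite -[2]/(2%:Z) -PoszM ltz_nat; exact: (maxval_lt d3 dm B1 B2).
elim: l => [|l [C C0 IH]].
  exists 0 => // k z _; rewrite subn0 => hz; rewrite mul0r mass_out //.
  have := NE k; move: (D k) (N k) hz => X Y; lia.
have pmi : 0 < pm^-1 by rewrite invr_gt0.
exists (m.+1%:R * ((1 + C) * pm^-1)); first by rewrite !mulr_ge0 ?addr_ge0 // ltW.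
case=> // k z; rewrite ltnS subSS => lk hz.
have dS : D k.+1 = d%:Z * D k by rewrite expnS PoszM.
have hz' : z - m%:Z * D k + D (k - l) <= (N k)%:Z.
  by move: hz; rewrite /= PoszD PoszM; lra.
have E0 : 0 <= pm^-1 * E k.+1 z by rewrite mulr_ge0 ?mass_ge0 // ltW.
apply: mass_step; last by rewrite -mulrA mulr_ge0 // addr_ge0.
move=> i; rewrite -mulrA.
have e1 : z - D k.+1 - (i : nat)%:Z * D k = z - (i + d)%N%:Z * D k.
  by rewrite dS PoszD; ring.
rewrite e1; have [im|im] := leqP (i + d) m.
  apply: le_trans (mass_term_pm _ _ im) _.
  by rewrite -[leLHS]mul1r ler_wpM2r // lerDl.
have [e|ne] := eqVneq (i + d)%N m.+1.
  have -> : z - (i + d)%N%:Z * D k = z - m%:Z * D k - D k by rewrite e intS; ring.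
  apply: le_trans (IH _ _ lk hz') _.
  have h := @mass_term_pm k z m (leqnn _).
  rewrite mulrDl mul1r; apply: (@le_trans _ _ (C * (pm^-1 * E k.+1 z))); last by rewrite lerDr.
  by rewrite ler_wpM2l.
rewrite mass_out; first by rewrite mulr_ge0 // addr_ge0.
apply/orP; left.
have h : (2 : int) <= (i + d)%N%:Z - m%:Z by move: im ne; lia.
have h2 : 2 * D k <= ((i + d)%N%:Z - m%:Z) * D k by rewrite ler_pM2r.
have h3 := NE k; have h4 := dk0 (k - l)%N.
move: h2 h3 h4 hz'; rewrite mulrBl.
move: ((i + d)%N%:Z * D k) (m%:Z * D k) (D k) (D (k - l)) => a1 a2 a3 a4; lra.
Qed.

(** Since [maxval k < 2 * d ^ k], a word with value [b * d ^ k + v] has leading digit [b - 1], [b]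
    or [b + 1]; the outer two cases are the two shifts. The cost is uniform as long as [v] keeps the
    distance [d ^ (k - l)] from both ends. *)
Lemma lmass_barrier l : exists2 c, 0 <= c & forall k v, (l <= k)%N ->
  (d ^ (k - l) <= v)%N -> (v + d ^ (k - l) <= N k)%N ->
  `|lmass d p k.+1 (b * d ^ k + v) - lmass d p k v| <= c.
Proof.
have [C1 C10 h1] := mass_shift_up l; have [C2 C20 h2] := mass_shift_down l.
have dk0 k : 0 < D k by rewrite ltz_nat expn_gt0; lia.
have NE k : (N k)%:Z < 2 * D k by rewrite -[2]/(2%:Z) -PoszM ltz_nat; exact: (maxval_lt d3 dm B1 B2).
have d0 : (0 < d)%N by lia.
have dm' : (d <= m.+1)%N by lia.
pose C := m.+1%:R * (1 + C1 + C2).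
have C0 : 0 < C by rewrite mulr_gt0 ?ltr0n //; lra.
exists (`|ln C| + `|ln (p b)|); first by rewrite addr_ge0.
move=> k v lk hv hv'.
have vN : (v <= N k)%N by apply: leq_trans hv'; exact: leq_addr.
have Ev : 0 < E k v%:Z by exact: mass_gt0.
have low : p b * E k v%:Z <= E k.+1 (b * d ^ k + v)%N%:Z.
  have := mass_term d p_gt0 k (b * d ^ k + v)%N%:Z b.
  by rewrite PoszD PoszM addrAC subrr add0r.
have Ebv : 0 < E k.+1 (b * d ^ k + v)%N%:Z by apply: lt_le_trans low; rewrite mulr_gt0.
have high : E k.+1 (b * d ^ k + v)%N%:Z <= C * E k v%:Z.
  apply: mass_step; last by rewrite mulr_ge0 ?mass_ge0 //; lra.
  move=> i; set z := (_ - _).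
  have ez : z = v%:Z + ((b : nat)%:Z - (i : nat)%:Z) * D k by rewrite /z PoszD PoszM; ring.
  have E0 : 0 <= E k v%:Z by exact: ltW.
  have [e|nb] := eqVneq (b : nat) i.
    have -> : z = v%:Z by rewrite ez e subrr mul0r addr0.
    by rewrite -[leLHS]mul1r ler_wpM2r //; lra.
  have [e|n1] := eqVneq (b : nat) i.+1.
    have -> : z = v%:Z + D k by rewrite ez e intS; ring.
    by apply: le_trans (h1 _ _ lk _) _ => //; rewrite ler_wpM2r //; lra.
  have [e|n2] := eqVneq (b.+1 : nat) i.
    have -> : z = v%:Z - D k by rewrite ez -e intS; ring.
    by apply: le_trans (h2 _ _ lk _) _ => //; rewrite ler_wpM2r //; lra.
  rewrite mass_out; first by rewrite mulr_ge0 //; lra.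
  rewrite ez; have [h|h] : (2 : int) <= (b : nat)%:Z - (i : nat)%:Z \/ (b : nat)%:Z - (i : nat)%:Z <= - 2.
  - by move: nb n1 n2; lia.
  - have : 2 * D k <= ((b : nat)%:Z - (i : nat)%:Z) * D k by rewrite ler_pM2r.
    move: (NE k) (dk0 k); set a1 := (_ - _) * D k; move: a1 (D k) => a1 a2 {ez}; lia.
  - have : ((b : nat)%:Z - (i : nat)%:Z) * D k <= -2 * D k by rewrite ler_pM2r.
    move: (NE k) (dk0 k) vN; set a1 := (_ - _) * D k; move: a1 (D k) (N k) => a1 a2 a3 {ez}; lia.
have l1 : ln (p b) + lmass d p k v <= lmass d p k.+1 (b * d ^ k + v).
  by rewrite /lmass -lnM ?posrE // ler_ln ?posrE // mulr_gt0.
have l2 : lmass d p k.+1 (b * d ^ k + v) <= ln C + lmass d p k v.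
  by rewrite /lmass -lnM ?posrE // ler_ln ?posrE // mulr_gt0.
have a1 := ler_norm (ln C); have a2 := ler_norm (- ln (p b)); rewrite normrN in a2.
have b1 := normr_ge0 (ln C); have b2 := normr_ge0 (ln (p b)).
by rewrite ler_norml; lra.
Qed.

End Shift.

(** * The upper bound *)

Lemma exp_nat_gt (R : realType) (d : nat) (x : R) : (2 <= d)%N ->
  exists K : nat, forall k, (K <= k)%N -> x < d%:R ^+ k.
Proof.
move=> d2; have [K hK] := nat_gt x; exists K => k Kk.
apply: lt_le_trans hK _; rewrite -natrX ler_nat.
by apply: leq_trans Kk _; apply: ltnW; apply: ltn_expl.
Qed.

Section UpperBound.
Context {R : realType} (d m : nat) (p : 'I_m.+1 -> R) (b : 'I_m.+1) (mu : probability R R).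
Hypotheses (d3 : (3 <= d)%N) (dm : (d <= m)%N).
Hypotheses (p_gt0 : forall i, 0 < p i) (p_sum1 : \sum_i p i = 1).
Hypotheses (B1 : (b * d.-1 + m < d * d.-1)%N) (B2 : (d * m < (b + d) * d.-1)%N).
Hypothesis mu_compact : exists K : set R, compact K /\ mu (~` K) = 0%E.
Hypothesis mu_selfsim : forall A : set R, measurable A ->
  mu A = (\sum_(i < m.+1) (p i)%:E * mu [set (d%:R * x - (i : nat)%:R)%R | x in A])%E.

Local Notation xi := (xi (R := R) d m).
Local Notation E := (mass d p).
Local Notation N := (maxval d m).
Local Notation L := (ln (d%:R : R)).
Local Notation lmass := (lmass d p).
Local Notation pressure := (pressure d p b).
Local Notation prob := (prob mu).

Lemma L_gt0 : 0 < L.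
Proof.
have d1 : (3%:R : R) <= d%:R by rewrite ler_nat.
by rewrite ln_gt0; lra.
Qed.

Lemma maxvalE k : (N k)%:R = xi * d%:R ^+ k - xi.
Proof.
have h := maxval_geom m k (ltn_trans (isT : 0 < 2)%N d3).
have d1 : (2%:R : R) <= d.-1%:R by rewrite ler_nat; lia.
have e : (d%:R - 1 : R) = d.-1%:R by rewrite -subn1 natrB //; lia.
have d10 : (d.-1%:R : R) != 0 by rewrite gt_eqF //; lra.
apply: (mulIf d10); rewrite /Defs.xi e mulrBl mulrAC !divfK //.
by rewrite -natrX -!natrM -h natrD addrK.
Qed.

Lemma xi_bounds : 1 <= xi < 2.
Proof.
have d1 : (2%:R : R) <= d.-1%:R by rewrite ler_nat; lia.
have e : (d%:R - 1 : R) = d.-1%:R by rewrite -subn1 natrB //; lia.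
rewrite /Defs.xi e ler_pdivlMr ?ltr_pdivrMr; [|lra|lra].
rewrite mul1r -natrM ler_nat ltr_nat (xi_lt2 d3 dm B1 B2) andbT; lia.
Qed.

(** The index [j] is both the first scale considered and the additive constant allowed, so that a
    countable union over [j] suffices. *)
Definition heavy_set (q u : R) (j : nat) : set R := [set x | forall k, (j <= k)%N ->
  exists v, [/\ (v <= N k)%N, `|x * d%:R ^+ k - v%:R| <= 6 &
    - j%:R - k%:R * (L * u) <= q * lmass k.+1 (b * d ^ k + v)]].

Context (pm : R).
Hypotheses (pm_gt0 : 0 < pm) (pm_le : forall i, pm <= p i).

(** Markov counting: each selected value contributes at least [expR (- j - k * L * u)] to the
    exponential sum, which is at most [expR (pressure q * k.+1)]. Covering by intervals of length
    [12 / d ^ k] then costs an amount decaying exponentially in [k]. *)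
Lemma heavy_set_null q u s j : 0 < s -> L * u + pressure q < L * s ->
  hausdorff_measure s (heavy_set q u j) = 0%E.
Proof.
move=> s0 hs; apply: hausdorff_null_finite => // delta e delta0 e0.
have L0 := L_gt0.
pose c := j%:R + pressure q + s * ln 12.
have [K1 hK1] := @exp_nat_gt R d (12 / delta) (ltnW d3).
have [K2 hK2] := nat_gt ((c - ln e) / (L * s - L * u - pressure q)).
pose k := (j + K1 + K2)%N.
pose Y := [seq v <- iota 0 (N k).+1 | - j%:R - k%:R * (L * u) <= q * lmass k.+1 (b * d ^ k + v)].
have D0 : (0 : R) < d%:R ^+ k := dk_gt0 d3 k.
exists (size Y), (fun i => (nth 0%N Y i)%:R / d%:R ^+ k), (6 / d%:R ^+ k).
have e12 : 2 * (6 / d%:R ^+ k) = 12 / d%:R ^+ k :> R by rewrite mulrA -natrM.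
rewrite e12; split.
- by rewrite divr_ge0 // ltW.
- rewrite ler_pdivrMr // mulrC -ler_pdivrMr //; apply/ltW/hK1.
  by rewrite /k addnAC leq_addl.
- have hY : (size Y)%:R * expR (- j%:R - k%:R * (L * u)) <= expR (pressure q * k.+1%:R).
    apply: le_trans (expsum_le d3 dm p_gt0 p_sum1 B1 B2 pm_gt0 pm_le k q).
    rewrite /expsum /blocks big_map (bigID (fun v => - j%:R - k%:R * (L * u) <= q * lmass k.+1 (b * d ^ k + v))) /=.
    rewrite -[X in _ <= X + _]big_filter -/Y.
    apply: (@le_trans _ _ (\sum_(v <- Y) expR (- j%:R - k%:R * (L * u)))).
      by rewrite big_const_seq count_predT iter_addr_0 mulr_natl.
    rewrite -[leLHS]addr0; apply: lerD; last by apply: sumr_ge0 => *; exact: expR_ge0.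
    rewrite big_seq [leRHS]big_seq; apply: ler_sum => v.
    by rewrite mem_filter => /andP[hv _]; rewrite ler_expR.
  rewrite /powR gt_eqF ?divr_gt0 // ln_div ?posrE // lnXn ?ltr0n; last by lia.
  rewrite -(ler_pM2r (expR_gt0 (- j%:R - k%:R * (L * u)))) mulrAC.
  apply: le_trans (_ : expR (pressure q * k.+1%:R) * expR (s * (ln 12 - L *+ k)) <= _).
    by rewrite ler_pM2r ?expR_gt0.
  rewrite -[e]lnK ?posrE // -!expRD ler_expR.
  have : (c - ln e) / (L * s - L * u - pressure q) < k%:R.
    by apply: lt_le_trans hK2 _; rewrite ler_nat /k leq_addl.
  rewrite ltr_pdivrMr; last by lra.
  rewrite /c -[L *+ k]mulr_natl -natr1; nra.
- move=> x /(_ k) []; first by rewrite /k -addnA leq_addr.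
  move=> v [vN xv hv].
  have vY : v \in Y by rewrite mem_filter hv mem_iota.
  exists (index v Y); first by rewrite index_mem.
  rewrite nth_index // -(ler_pM2r D0) divfK ?gt_eqF //.
  by rewrite -[X in _ * X](ger0_norm (ltW D0)) -normrM mulrBl divfK ?gt_eqF.
Qed.

Lemma support_itv x : msupport mu x -> 0 <= x <= xi.
Proof.
have hout := prob_out d3 mu_compact mu_selfsim.
move=> hx; apply/andP; split; rewrite leNgt; apply/negP => h.
  have r0 : 0 < - x / 2 by lra.
  have := hx _ r0; rewrite (probE mu (measurable_ballR x _)) (hout _ _ r0) ?ltxx //.
    exact: measurable_ballR.
  by move=> t; rewrite /ball /= ltr_norml => /andP[h1 h2]; left; lra.
have r0 : 0 < (x - xi) / 2 by lra.
have := hx _ r0; rewrite (probE mu (measurable_ballR x _)) (hout _ _ r0) ?ltxx //.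
  exact: measurable_ballR.
by move=> t; rewrite /ball /= ltr_norml => /andP[h1 h2]; right; lra.
Qed.

Lemma local_dim_bound x alpha e : msupport mu x -> local_dim_is mu x alpha -> 0 < e ->
  exists K, forall k, (K <= k)%N ->
    0 < prob (ball x (3 / d%:R ^+ k)) /\
    (alpha + e) * (ln 3 - k%:R * L) <= ln (prob (ball x (3 / d%:R ^+ k))) <=
    (alpha - e) * (ln 3 - k%:R * L).
Proof.
move=> hx hloc e0.
have /cvgrPdist_le/(_ e e0)[e1 /= e10 he1] := hloc.
have [K hK] := @exp_nat_gt R d (3 / e1 + 3) (ltnW d3).
exists K => k /hK Kk.
have h3 : 0 < 3 / e1 by rewrite divr_gt0.
have D0 : (0 : R) < d%:R ^+ k by lra.
have r0 : (0 : R) < 3 / d%:R ^+ k by rewrite divr_gt0.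
have r1 : 3 / d%:R ^+ k < e1.
  by rewrite ltr_pdivrMr // mulrC -ltr_pdivrMr //; lra.
have r2 : 3 / d%:R ^+ k < 1 :> R by rewrite ltr_pdivrMr //; lra.
have lr : ln (3 / d%:R ^+ k : R) = ln 3 - k%:R * L.
  by rewrite ln_div ?posrE // lnXn ?ltr0n ?mulr_natl //; lia.
have lneg : ln (3 / d%:R ^+ k : R) < 0 by apply: ln_lt0; rewrite r0 r2.
have P0 : 0 < prob (ball x (3 / d%:R ^+ k)).
  have := hx _ r0; rewrite (probE mu (measurable_ballR x _)) lte_fin //.
split => //.
have : `|alpha - ln (fine (mu (ball x (3 / d%:R ^+ k)))) / ln (3 / d%:R ^+ k)| <= e.
  apply: he1 => //=; rewrite sub0r normrN ger0_norm // ltW //.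
rewrite -/(prob _) -lr; set l := ln _ in lneg *; set y := ln (prob _).
have ey : y = y / l * l by rewrite divfK // lt_eqF.
by rewrite ler_norml => /andP[h1 h2]; apply/andP; split; rewrite ey ler_nM2r //; lra.
Qed.

(** The sign of [q] decides which cylinder is needed. For [q >= 0] its mass must be large, so the
    heaviest one near [x] is used; for [q < 0] it must be small, so any cylinder inside the ball
    will do. *)
Lemma level_set_heavy x alpha q e : msupport mu x -> local_dim_is mu x alpha -> 0 < e ->
  x != 0 -> x != xi -> exists j, heavy_set q (q * alpha + `|q| * e) j x.
Proof.
move=> hx hloc e0 x0 x1.
have d0 : (0 < d)%N by lia.
have dm' : (d <= m.+1)%N by lia.
have L0 := L_gt0.
have /andP[xi1 xi2] := xi_bounds.
have /andP[x00 x11'] := support_itv hx.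
have xp : 0 < x by rewrite lt_neqAle eq_sym x0.
have x11 : x < xi by rewrite lt_neqAle x1.
have [K1 hK1] := local_dim_bound hx hloc e0.
(* The [10] leaves room for the error [6], for the margin [d ^ (k - l)] and for the offset [xi < 2]
   in [maxvalE]. *)
have [l hl] : exists l, 10 <= x * d%:R ^+ l /\ 10 <= (xi - x) * d%:R ^+ l.
  have [l1 hl1] := @exp_nat_gt R d (10 / x) (ltnW d3).
  have [l2 hl2] := @exp_nat_gt R d (10 / (xi - x)) (ltnW d3).
  exists (l1 + l2)%N; split; rewrite mulrC -ler_pdivrMr ?subr_gt0 //; apply/ltW.
    by apply: hl1; exact: leq_addr.
  by apply: hl2; exact: leq_addl.
have [c c0 hc] := lmass_barrier d3 dm p_gt0 p_sum1 B1 B2 pm_gt0 pm_le l.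
pose C := `|q| * c + `|q| * (`|alpha| + e) * ln 3 + `|q| * ln 26.
have [K2 hK2] := nat_gt C.
exists (l + K1 + K2)%N => k hk.
have lk : (l <= k)%N by apply: leq_trans hk; rewrite -addnA leq_addr.
have K1k : (K1 <= k)%N by apply: leq_trans hk; rewrite addnAC leq_addl.
have hj : C <= (l + K1 + K2)%:R.
  by apply/ltW; apply: lt_le_trans hK2 _; rewrite ler_nat leq_addl.
have D0 : (0 : R) < d%:R ^+ k := dk_gt0 d3 k.
have [P0 /andP[P1 P2]] := hK1 _ K1k.
have ln3 : 0 <= ln (3 : R) by rewrite ln_ge0; lra.
have ln26 : 0 <= ln (26 : R) by rewrite ln_ge0; lra.
set T : R := (d ^ (k - l))%:R.
have eT : d%:R ^+ k = T * d%:R ^+ l :> R by rewrite /T natrX -exprD subnK.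
have T1 : 1 <= T by rewrite /T ler1n expn_gt0 d0.
have xk1 : 10 * T <= x * d%:R ^+ k.
  by rewrite eT mulrCA [leLHS]mulrC; apply: ler_wpM2l; [lra|case: hl].
have xk2 : 10 * T <= (xi - x) * d%:R ^+ k.
  by rewrite eT mulrCA [leLHS]mulrC; apply: ler_wpM2l; [lra|case: hl].
have near_ok (v : nat) : `|x * d%:R ^+ k - v%:R| <= 6 ->
    [/\ (v <= N k)%N, (d ^ (k - l) <= v)%N & (v + d ^ (k - l) <= N k)%N].
  rewrite ler_norml => /andP[h1 h2].
  have h3 : (v + d ^ (k - l) <= N k)%N.
    rewrite -(ler_nat R) natrD -/T maxvalE; lra.
  split => //; first by apply: leq_trans h3; exact: leq_addr.
  by rewrite -(ler_nat R) -/T; lra.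
have from_mass (v : nat) : `|x * d%:R ^+ k - v%:R| <= 6 ->
    - (`|q| * (`|alpha| + e) * ln 3 + `|q| * ln 26) - k%:R * (L * (q * alpha + `|q| * e)) <= q * lmass k v ->
    exists v, [/\ (v <= N k)%N, `|x * d%:R ^+ k - v%:R| <= 6 &
      - (l + K1 + K2)%:R - k%:R * (L * (q * alpha + `|q| * e)) <= q * lmass k.+1 (b * d ^ k + v)].
  move=> hv hq; have [v1 v2 v3] := near_ok _ hv.
  exists v; split => //.
  have := hc _ _ lk v2 v3; set y := lmass k.+1 _; set z := lmass k v in hq *.
  move=> hyz; have : `|q * (y - z)| <= `|q| * c by rewrite normrM ler_wpM2l.
  rewrite ler_norml => /andP[h _]; move: h hj hq; rewrite /C mulrBr; lra.
have a1 := ler_norm alpha; have a2 := ler_norm (- alpha); rewrite normrN in a2.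
have [q0|q0] := leP 0 q.
  have r0 : (0 : R) < 3 / d%:R ^+ k by rewrite divr_gt0.
  have rk : 3 / d%:R ^+ k * d%:R ^+ k = 3 :> R by rewrite divfK // gt_eqF.
  have [v [vN hv hP]] := ball_le_near_mass d3 p_gt0 mu_compact mu_selfsim r0 rk xi2 P0.
  apply: (from_mass v) => //.
  have Ev : 0 < E k v%:Z by apply: (mass_gt0 p_gt0).
  have : ln (prob (ball x (3 / d%:R ^+ k))) <= ln 26 + lmass k v.
    by rewrite /lmass -lnM ?posrE // ler_ln ?posrE // mulr_gt0.
  rewrite ger0_norm // => h.
  have {}h : (alpha + e) * (ln 3 - k%:R * L) - ln 26 <= lmass k v by lra.
  apply: le_trans (ler_wpM2l q0 h).
  have : q * ((alpha + e) * ln 3) >= - (q * (`|alpha| + e) * ln 3).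
    by rewrite -mulrA -mulrN ler_wpM2l // -mulNr ler_wpM2r //; lra.
  nra.
pose v := Num.truncn (x * d%:R ^+ k).
have xk0 : 0 <= x * d%:R ^+ k by rewrite mulr_ge0 // ltW.
have /andP[v1 v2] := truncn_itv xk0; rewrite -/v in v1 v2.
rewrite -natr1 in v2.
have hv : `|x * d%:R ^+ k - v%:R| <= 6 by rewrite ler_norml; lra.
apply: (from_mass v) => //.
have [vN _ _] := near_ok _ hv.
have Ev : 0 < E k v%:Z by apply: (mass_gt0 p_gt0).
have half : 0 < 2^-1 :> R by rewrite invr_gt0.
have hE : E k v%:Z <= prob (ball x (3 / d%:R ^+ k)).
  apply: (mass_le_ball d3 p_gt0 mu_compact mu_selfsim half) => // t /andP[t1 t2].
  rewrite ltr_pdivlMr // -[X in _ * X < _](ger0_norm (ltW D0)) -normrM mulrBl divfK ?gt_eqF //.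
  by rewrite ltr_norml; lra.
have : lmass k v <= ln (prob (ball x (3 / d%:R ^+ k))).
  by rewrite /lmass ler_ln ?posrE.
move=> h; have {}h : lmass k v <= (alpha - e) * (ln 3 - k%:R * L) by lra.
have nq : 0 <= - q by lra.
have := ler_wpM2l nq h; rewrite ltr0_norm // => {}h.
have : - q * ((alpha - e) * ln 3) <= - q * ((`|alpha| + e) * ln 3).
  by rewrite ler_wpM2l // ler_wpM2r //; lra.
have : 0 <= - q * ln 26 by rewrite mulr_ge0.
move: h; move: (ln 3) (ln 26) L (lmass k v) => a3 a26 LL z; nra.
Qed.

Lemma level_set_null alpha q s : 0 < s -> q * alpha + pressure q / L < s ->
  hausdorff_measure s [set x | msupport mu x /\ local_dim_is mu x alpha] = 0%E.
Proof.
move=> s0 hs; have L0 := L_gt0.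
pose e := (s - (q * alpha + pressure q / L)) / (2 * (`|q| + 1)).
have q1 : 0 < `|q| + 1 by rewrite ltr_wpDl.
have e0 : 0 < e by rewrite divr_gt0 ?mulr_gt0 ?subr_gt0.
pose u := q * alpha + `|q| * e.
have hu : L * u + pressure q < L * s.
  have -> : L * u + pressure q = L * (u + pressure q / L).
    by field; rewrite gt_eqF.
  rewrite ltr_pM2l // /u.
  have : (`|q| + 1) * e < s - (q * alpha + pressure q / L).
    have -> : (`|q| + 1) * e = (s - (q * alpha + pressure q / L)) / 2.
      by rewrite /e; field; rewrite !gt_eqF.
    lra.
  lra.
pose G j : set R := if j is j'.+2 then heavy_set q u j' else if j is 0%N then [set 0] else [set xi].
apply: (@hausdorff_null_subset _ _ _ (\bigcup_j G j)); last first.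
  apply: hausdorff_null_bigcup => -[|[|j]].
  - exact: hausdorff_null_point.
  - exact: hausdorff_null_point.
  - exact: heavy_set_null.
move=> x [hx hloc].
have [->|x0] := eqVneq x 0; first by exists 0%N.
have [->|x1] := eqVneq x xi; first by exists 1%N.
have [j hj] := level_set_heavy q hx hloc e0 x0 x1.
by exists j.+2.
Qed.

End UpperBound.

(** * Typical blocks *)

Section ExponentialFamily.
Context {R : realType}.

Lemma continuous_moment (T : Type) (s : seq T) (f : T -> R) :
  continuous (fun q : R => \sum_(w <- s) f w * expR (q * f w)).
Proof.
elim: s => [|w s IH] q.
  under eq_fun do rewrite big_nil; exact: cvg_cst.
under eq_fun do rewrite big_cons.
apply: cvgD; last exact: IH.
apply: cvgMl_tmp.
apply: (@cvg_comp _ _ _ (fun x : R => x * f w) expR _ (nbhs (q * f w))); last exact: continuous_expR.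
by apply: cvgMr_tmp; exact: cvg_id.
Qed.

(** The choice of [q] gives [f v * expR (q * f v) >= f v * (1 + q * f v) = f v + c], while the other
    terms are at least [- |f w|] each, since negative values of [f] are damped for [q >= 0]. *)
Lemma moment_gt0 (T : eqType) (s : seq T) (f : T -> R) v : v \in s -> 0 < f v ->
  exists q, 0 <= q /\ 0 < \sum_(w <- s) f w * expR (q * f w).
Proof.
move=> vs fv; pose c := \sum_(w <- s) `|f w|.
have c0 : 0 <= c by apply: sumr_ge0.
exists (c / f v ^+ 2); have q0 : 0 <= c / f v ^+ 2 by rewrite divr_ge0 // exprn_ge0 // ltW.
split => //; set q := c / _.
have low w : - `|f w| <= f w * expR (q * f w).
  have [fw|fw] := leP 0 (f w).
    by apply: (@le_trans _ _ 0); rewrite ?oppr_le0 ?mulr_ge0 ?expR_ge0.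
  rewrite ltr0_norm // opprK -[leLHS]mulr1 ler_nM2l // -expR0 ler_expR.
  by rewrite mulr_ge0_le0 // ltW.
have : \sum_(w <- rem v s) - `|f w| <= \sum_(w <- rem v s) f w * expR (q * f w).
  exact: ler_sum.
rewrite sumrN [X in 0 < X](big_rem v) //=.
have ec : c = `|f v| + \sum_(w <- rem v s) `|f w| by rewrite /c (big_rem v).
have : f v + c <= f v * expR (q * f v).
  have -> : f v + c = f v * (1 + q * f v) by rewrite /q; field; rewrite gt_eqF.
  by rewrite ler_pM2l // expR_ge1Dx.
have := normr_ge0 (f v); lra.
Qed.

Lemma moment_zero (T : eqType) (s : seq T) (f : T -> R) v w :
  v \in s -> w \in s -> 0 < f v -> f w < 0 ->
  exists q, \sum_(w <- s) f w * expR (q * f w) = 0.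
Proof.
move=> vs ws fv fw; pose g q := \sum_(w <- s) f w * expR (q * f w).
have [q1 [q10 g1]] := moment_gt0 vs fv.
have nfw : 0 < - f w by rewrite oppr_gt0.
have [q2 [q20 g2]] := moment_gt0 (f := fun w => - f w) ws nfw.
have g3 : g (- q2) < 0.
  rewrite -oppr_gt0 -sumrN; move: g2.
  rewrite (eq_bigr (fun i => - (f i * expR (- q2 * f i)))) // => u _.
  by rewrite mulrN mulNr mulNr.
have q21 : - q2 <= q1 by lra.
have cg : {within `[- q2, q1], continuous g}.
  by apply: continuous_subspaceT; exact: continuous_moment.
have [|c _ hc] := @IVT R g (- q2) q1 0 q21 cg; last by exists c.
by rewrite ge_min le_max (ltW g1) (ltW g3) /= orbT.
Qed.

End ExponentialFamily.

Section Typical.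
Context {R : realType} (d m : nat) (p : 'I_m.+1 -> R) (b : 'I_m.+1).
Hypotheses (d3 : (3 <= d)%N) (dm : (d <= m)%N).
Hypotheses (p_gt0 : forall i, 0 < p i) (p_sum1 : \sum_i p i = 1).
Hypotheses (B1 : (b * d.-1 + m < d * d.-1)%N) (B2 : (d * m < (b + d) * d.-1)%N).
Context (pm : R).
Hypotheses (pm_gt0 : 0 < pm) (pm_le : forall i, pm <= p i).
Context (alpha : R).

Local Notation E := (mass d p).
Local Notation N := (maxval d m).
Local Notation L := (ln (d%:R : R)).
Local Notation lmass := (lmass d p).
Local Notation block := (block d b).
Local Notation lexpsum := (lexpsum d p b).
Local Notation pressure := (pressure d p b).
Local Notation blocks := (blocks d b).

(* Local dimension [alpha] prescribes the mass [d ^ (- k * alpha)] at scale [d ^ (- k)]. *)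
Definition dev k v : R := lmass k v + alpha * (k%:R * L).

Lemma devE k v : dev k v = lmass k v + alpha * (k%:R * L).
Proof. by []. Qed.

Lemma lexpsum_mul c n q : c.+1%:R * lexpsum n q <= lexpsum (c.+1 * n.+1).-1 q.
Proof.
elim: c => [|c IH]; first by rewrite mul1r mul1n.
have -> : (c.+2 * n.+1).-1 = (n + (c.+1 * n.+1).-1).+1 by rewrite !mulSn; lia.
rewrite -[c.+2%:R]natr1 mulrDl mul1r addrC.
apply: le_trans (lexpsum_cat d3 dm p_gt0 B1 B2 _ _ _).
by rewrite lerD2l.
Qed.

Lemma dk_expsum n q : expR (lexpsum n q + q * (alpha * (n.+1%:R * L))) =
  \sum_(w <- blocks n) expR (q * dev n.+1 w).
Proof.
rewrite expRD lnK ?posrE ?expsum_gt0 // mulr_suml; apply: eq_bigr => w _.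
by rewrite -expRD -mulrDr.
Qed.

Lemma lexpsum_ge n w q : w \in blocks n -> q * lmass n.+1 w <= lexpsum n q.
Proof.
move=> hw; rewrite -[leLHS]expRK ler_ln ?posrE ?expR_gt0 ?expsum_gt0 //.
rewrite /expsum (big_rem w) //= lerDl; apply: sumr_ge0 => *; exact: expR_ge0.
Qed.

(** Log-masses lie between [n.+1 * ln pm] and [0], so the dependence on [q], per letter, is
    Lipschitz uniformly in the level. This is what lets one finite grid of [q] serve all levels. *)
Lemma lexpsum_lip n q q' : lexpsum n q <= lexpsum n q' + n.+1%:R * (- ln pm) * `|q - q'|.
Proof.
set c := _ * `|q - q'|.
rewrite -[lexpsum n q']/(ln _) -[c]expRK -lnM ?posrE ?expsum_gt0 ?expR_gt0 //.
rewrite ler_ln ?posrE ?mulr_gt0 ?expsum_gt0 ?expR_gt0 // /expsum mulr_suml.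
rewrite big_seq [leRHS]big_seq; apply: ler_sum => w /(mem_blocks d3 dm B1 B2) hw.
rewrite -expRD ler_expR.
have /andP[h1 h2] := lmass_bound d3 dm p_gt0 p_sum1 B1 B2 pm_gt0 pm_le (block_le d3 dm B1 B2 hw).
rewrite -lerBlDl -mulrBl; apply: le_trans (ler_norm _) _.
rewrite normrM mulrC /c ler_wpM2r // ler0_norm //; lra.
Qed.

(* Powers of blocks only improve the exponential sums, so a common multiple of finitely
   many lengths does at least as well as each of them; outside a compact interval of [q]
   a heavy and a light block suffice, inside it a finite grid does. *)
Lemma good_level l v w t t' : block l.+1 v -> block l.+1 w ->
  0 < dev l.+1 v -> dev l.+1 w < 0 -> t < t' ->
  (forall q, t' < q * alpha + pressure q / L) -> 0 < L ->
  exists c, forall q, t * ((c.+1 * l.+1)%:R * L) <=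
    lexpsum (c.+1 * l.+1).-1 q + q * (alpha * ((c.+1 * l.+1)%:R * L)).
Proof.
move=> bv bw dv dw tt' hpr L0.
pose gam n q := lexpsum n q / n.+1%:R + q * (alpha * L).
have gamE n q : gam n q * n.+1%:R = lexpsum n q + q * (alpha * (n.+1%:R * L)).
  by rewrite /gam mulrDl divfK ?pnatr_eq0 //; ring.
have gam_mul c n q : gam n q <= gam (c.+1 * n.+1).-1 q.
  rewrite /gam lerD2r prednK ?muln_gt0 // ler_pdivrMr ?ltr0n // mulrAC.
  rewrite ler_pdivlMr ?ltr0n ?muln_gt0 // natrM mulrA [_ * c.+1%:R]mulrC.
  by rewrite ler_wpM2r //; exact: lexpsum_mul.
suff [c hc] : exists c, forall q, t * L <= gam (c.+1 * l.+1).-1 q.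
  exists c => q; have c0 : (0 < c.+1 * l.+1)%N by rewrite muln_gt0.
  have := hc q; rewrite -(ler_pM2r (_ : 0 < (c.+1 * l.+1)%:R)) ?ltr0n //.
  by have := gamE (c.+1 * l.+1).-1 q; rewrite prednK // => ->; rewrite -mulrA [L * _]mulrC.
have gam_ge x q : x \in blocks l -> q * dev l.+1 x <= gam l q * l.+1%:R.
  by move=> hx; rewrite gamE /dev mulrDr lerD2r; exact: lexpsum_ge.
pose a := Num.min (dev l.+1 v) (- dev l.+1 w).
have a0 : 0 < a by rewrite lt_min dv oppr_gt0.
(* Beyond [Q] a single word suffices: [v] for positive and [w] for negative [q] makes the logarithm
   of the tilted sum at least [|q| * a]. *)
pose Q := `|t * L| * l.+1%:R / a.
have Q0 : 0 <= Q by rewrite /Q divr_ge0 ?mulr_ge0 // ltW.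
have outside q : Q < `|q| -> t * L <= gam l q.
  move=> hq; have la : `|t * L| * l.+1%:R <= `|q| * a by rewrite -ler_pdivrMr // ltW.
  rewrite -(ler_pM2r (_ : 0 < l.+1%:R)) ?ltr0n //.
  apply: (@le_trans _ _ (`|q| * a)).
    by apply: le_trans la; rewrite ler_wpM2r // ler_norm.
  have [q0|q0] := leP 0 q.
    apply: le_trans (gam_ge v q _); last exact/mem_blocks.
    by rewrite ger0_norm // ler_wpM2l // ge_min lexx.
  apply: le_trans (gam_ge w q _); last exact/mem_blocks.
  rewrite ltr0_norm // mulNr -mulrN ler_wnM2l ?(ltW q0) //.
  by rewrite lerNr ge_min lexx orbT.
pose lam := - ln pm + `|alpha| * L.
have lam0 : 0 <= - ln pm.
  have pm1 : pm <= 1 by apply: le_trans (pm_le ord0) (p_le1 p_gt0 p_sum1 _).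
  by rewrite oppr_ge0 -ln1 ler_ln ?posrE.
have lam1 : 0 <= lam by rewrite addr_ge0 // mulr_ge0 // ltW.
have lip n q q' : gam n q <= gam n q' + lam * `|q - q'|.
  have h := lexpsum_lip n q q'.
  have n0 : (0 : R) < n.+1%:R by rewrite ltr0n.
  have {}h : lexpsum n q / n.+1%:R <= lexpsum n q' / n.+1%:R + - ln pm * `|q - q'|.
    rewrite ler_pdivrMr // mulrDl divfK ?gt_eqF //.
    by apply: le_trans h _; rewrite lerD2l; lra.
  have : q * (alpha * L) <= q' * (alpha * L) + `|alpha| * L * `|q - q'|.
    rewrite -lerBlDl -mulrBl; apply: le_trans (ler_norm _) _.
    by rewrite normrM [`|alpha * L|]normrM (ger0_norm (ltW L0)) mulrC.
  move: h; rewrite /gam /lam; move: (lexpsum n q / _) (lexpsum n q' / _) => x y h1 h2.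
  by rewrite [_ * `|q - q'|]mulrDl; lra.
pose e := (t' - t) * L.
have e0 : 0 < e by rewrite mulr_gt0 // subr_gt0.
have [f hf] : {f : R -> nat & forall q, t * L + e <= gam (f q) q}.
  apply: (@choice _ _ (fun q n => t * L + e <= gam n q)) => q.
  have : t' * L - q * (alpha * L) < pressure q.
    have := hpr q; rewrite -(ltr_pM2r L0) mulrDl divfK ?gt_eqF //; lra.
  move=> /pressure_gt[n hn]; exists n.
  have -> : t * L + e = t' * L by rewrite /e; ring.
  by rewrite /gam -lerBlDr ltW.
pose h := e / (lam + 1).
have h0 : 0 < h by rewrite divr_gt0 // ltr_wpDl.
have hlam : lam * h <= e.
  by rewrite /h mulrA ler_pdivrMr ?ltr_wpDl // mulrC ler_pM2l // lerDl.
pose I := (Num.truncn (2 * Q / h)).+1.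
pose g i : R := - Q + i%:R * h.
(* A common multiple of the levels chosen at the grid points; by [gam_mul] it does as well as each
   of them. *)
pose c := (\prod_(i < I) (f (g i)).+1)%N.
have c0 : (0 < c)%N by rewrite prodn_gt0.
exists c.-1 => q; rewrite prednK //.
have [hq|hq] := ltP Q `|q|.
  by have := gam_mul c.-1 l q; rewrite prednK //; apply: le_trans; exact: outside.
have /andP[q1 q2] : - Q <= q <= Q by rewrite -ler_norml.
pose i := Num.truncn ((q + Q) / h).
have iq : 0 <= (q + Q) / h by rewrite divr_ge0 ?(ltW h0) //; lra.
have /andP[i1 i2] := truncn_itv iq.
have iI : (i < I)%N.
  rewrite ltnS /i; apply: le_truncn; rewrite ler_pM2r ?invr_gt0 //; lra.
have dist : `|q - g i| <= h.
  move: i1 i2; rewrite -/i -natr1 ler_pdivlMr // ltr_pdivrMr // => i1 i2.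
  rewrite /g ler_norml; lra.
have := lip (c * l.+1).-1 (g i) q.
rewrite distrC => h1.
have h2 : lam * `|q - g i| <= e by apply: le_trans hlam; rewrite ler_wpM2l.
have h3 : gam (f (g i)) (g i) <= gam (c * l.+1).-1 (g i).
  pose c' := (c %/ (f (g i)).+1 * l.+1)%N.
  have ec : (c * l.+1)%N = (c' * (f (g i)).+1)%N.
    rewrite /c' mulnAC divnK // /c (bigD1 (Ordinal iI)) //=; exact: dvdn_mulr.
  have c'0 : (0 < c')%N by rewrite lt0n; apply/eqP => z; have := muln_gt0 c l.+1; rewrite ec z mul0n c0.
  by have := gam_mul c'.-1 (f (g i)) (g i); rewrite prednK // -ec.
have := hf (g i); lra.
Qed.

(* [concats n i]: values of the [i]-fold concatenations of words of [blocks n]. *)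
Fixpoint concats n i : seq nat :=
  if i is i'.+1 then [seq (v * d ^ (i' * n.+1) + w)%N | v <- blocks n, w <- concats n i']
  else [:: 0%N].

Lemma concatsS n i : concats n i.+1 =
  [seq (v * d ^ (i * n.+1) + w)%N | v <- blocks n, w <- concats n i].
Proof. by []. Qed.

Lemma concats_carry_free n i w : w \in concats n i -> carry_free d m (i * n.+1) w.
Proof.
elim: i w => [|i IH] w.
  by rewrite inE => /eqP ->; exact: carry_free0.
rewrite concatsS => /allpairsPdep[u [v [/(mem_blocks d3 dm B1 B2) hu /IH hv ->]]].
by rewrite mulSn; apply: carry_free_cat => //; exact: (block_carry_free d3 dm B1 B2).
Qed.

Lemma concats_block n i w : (0 < i)%N -> w \in concats n i -> block (i * n.+1) w.
Proof.
case: i => // i _ /allpairsPdep[u [v [/(mem_blocks d3 dm B1 B2) hu hv ->]]].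
have [_ _ hv'] := concats_carry_free hv.
by rewrite mulSn; apply: block_cat.
Qed.

Lemma concats_uniq n i : uniq (concats n i).
Proof.
elim: i => // i IH; rewrite concatsS; apply: allpairs_uniq; rewrite ?blocks_uniq //.
move=> [u v] [u' v'] /allpairsP[[x y] [_ hy [-> ->]]].
move=> /allpairsP[[x' y'] [_ hy' [-> ->]]] /= e.
have [y1 _ _] := concats_carry_free hy; have [y2 _ _] := concats_carry_free hy'.
have D0 : (0 < d ^ (i * n.+1))%N by rewrite expn_gt0; apply/orP; left; lia.
have e1 : x = x'.
  by have := congr1 (fun u => u %/ d ^ (i * n.+1))%N e; rewrite !divnMDl // !divn_small // !addn0.
by move: e; rewrite e1 => /addnI ->.
Qed.

Lemma dev_concat n i u w : u \in blocks n -> w \in concats n i ->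
  dev (n.+1 + i * n.+1) (u * d ^ (i * n.+1) + w) = dev n.+1 u + dev (i * n.+1) w.
Proof.
move=> /(mem_blocks d3 dm B1 B2) hu hw; rewrite /dev (lmass_cat d3 dm p_gt0 B1 B2) //; last exact: concats_carry_free.
  by rewrite natrD; ring.
exact: (block_le d3 dm B1 B2).
Qed.

Lemma sum_concats (F : nat -> R) n i : \sum_(w <- concats n i.+1) F w =
  \sum_(u <- blocks n) \sum_(w <- concats n i) F (u * d ^ (i * n.+1) + w)%N.
Proof. by rewrite concatsS big_allpairs_dep. Qed.

Section Moments.
Context (n : nat) (q : R).
Hypothesis q_centre : \sum_(w <- blocks n) dev n.+1 w * expR (q * dev n.+1 w) = 0.

Let Z := \sum_(w <- blocks n) expR (q * dev n.+1 w).
Let V := \sum_(w <- blocks n) dev n.+1 w ^+ 2 * expR (q * dev n.+1 w).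

(** Tilted weights multiply and deviations add under concatenation, so the [i] factors behave like
    independent centred variables: the mean stays zero and the variance is additive. The factor [Z]
    in the last clause replaces a division. *)
Lemma concats_moments i :
  [/\ \sum_(w <- concats n i) expR (q * dev (i * n.+1) w) = Z ^+ i,
      \sum_(w <- concats n i) dev (i * n.+1) w * expR (q * dev (i * n.+1) w) = 0 &
      Z * (\sum_(w <- concats n i) dev (i * n.+1) w ^+ 2 * expR (q * dev (i * n.+1) w)) =
        i%:R * V * Z ^+ i].
Proof.
elim: i => [|i [IH0 IH1 IH2]].
  have dev0 : dev 0 0 = 0 by rewrite /dev /lmass /= ln1 !mul0r mulr0 addr0.
  by rewrite /= !big_seq1 mul0n dev0 mulr0 expR0 expr0n /= !mul0r mulr0.
pose e0 u := expR (q * dev n.+1 u); pose e1 w := expR (q * dev (i * n.+1) w).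
have he u w : u \in blocks n -> w \in concats n i ->
    expR (q * dev (i.+1 * n.+1) (u * d ^ (i * n.+1) + w)) = e0 u * e1 w.
  by move=> hu hw; rewrite mulSn dev_concat // mulrDr expRD.
split; rewrite sum_concats.
- rewrite (eq_big_seq (fun u => e0 u * Z ^+ i)); first by rewrite -mulr_suml exprS.
  move=> u hu; rewrite -IH0 mulr_sumr; apply: eq_big_seq => w hw.
  by rewrite he.
- rewrite (eq_big_seq (fun u => (dev n.+1 u * e0 u) * Z ^+ i)).
    by rewrite -mulr_suml q_centre mul0r.
  move=> u hu; rewrite (eq_big_seq (fun w => dev n.+1 u * e0 u * e1 w +
    e0 u * (dev (i * n.+1) w * e1 w))).
    by rewrite big_split /= -mulr_sumr IH0 -mulr_sumr IH1 mulr0 addr0.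
  by move=> w hw; rewrite he // mulSn dev_concat //; ring.
- set V1 := \sum_(w <- concats n i) _ in IH2.
  rewrite (eq_big_seq (fun u => (dev n.+1 u ^+ 2 * e0 u) * Z ^+ i + e0 u * V1)).
    rewrite big_split /= -!mulr_suml -/V -/Z mulrDr -natr1 exprS.
    have -> : Z * (Z * V1) = Z * (i%:R * V * Z ^+ i) by rewrite IH2.
    ring.
  move=> u hu; rewrite (eq_big_seq (fun w => dev n.+1 u ^+ 2 * e0 u * e1 w +
    (2 * dev n.+1 u * e0 u * (dev (i * n.+1) w * e1 w) + e0 u * (dev (i * n.+1) w ^+ 2 * e1 w)))).
    by rewrite !big_split /= -!mulr_sumr IH0 IH1 mulr0 add0r.
  by move=> w hw; rewrite he // mulSn dev_concat //; ring.
Qed.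

(* Chebyshev's inequality for the tilted weights [exp (q * dev)]. *)
Lemma typical_words (t : R) : expR (t * (n.+1%:R * L)) <= Z ->
  exists c, forall i, (0 < i)%N -> exists G : seq nat,
    [/\ uniq G, forall w, w \in G -> block (i ^ 2 * n.+1) w,
      forall w, w \in G -> `|dev (i ^ 2 * n.+1) w| <= c * i%:R &
      expR (t * ((i ^ 2 * n.+1)%:R * L) - c * i%:R) <= (size G)%:R].
Proof.
move=> hZ; have Z0 : 0 < Z := lt_le_trans (expR_gt0 _) hZ.
have V0 : 0 <= V by apply: sumr_ge0 => w _; rewrite mulr_ge0 ?expR_ge0 ?sqr_ge0.
(* Since [c1 ^ 2 >= 2 * V / Z], the atypical words carry at most half of the tilted weight. *)
pose c1 := 1 + 2 * V / Z.
have c10 : 0 <= 2 * V / Z by rewrite divr_ge0 ?mulr_ge0 // ltW.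
have hc1 : 2 * V <= c1 ^+ 2 * Z.
  rewrite -ler_pdivrMr // /c1 expr2; nra.
exists (c1 * (1 + `|q|) + ln 2) => i i0.
have ip : (1 : R) <= i%:R by rewrite ler1n.
have ln2 : 0 <= ln (2 : R) by rewrite ln_ge0; lra.
pose typ w := `|dev (i ^ 2 * n.+1) w| <= c1 * i%:R.
have [M0 _ M2] := concats_moments (i ^ 2)%N.
pose e w := expR (q * dev (i ^ 2 * n.+1) w).
have atyp : \sum_(w <- concats n (i ^ 2) | ~~ typ w) e w <= Z ^+ (i ^ 2) / 2.
  have c1i : 0 < (c1 * i%:R) ^+ 2 by rewrite exprn_gt0 // mulr_gt0 // /c1; lra.
  rewrite -(ler_pM2l c1i) -(ler_pM2l Z0).
  apply: (@le_trans _ _ ((i ^ 2)%:R * V * Z ^+ (i ^ 2))).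
    rewrite -M2 ler_pM2l // mulr_sumr [leRHS](bigID typ) /= -[leLHS]add0r.
    apply: lerD.
      by apply: sumr_ge0 => w _; rewrite mulr_ge0 ?expR_ge0 ?sqr_ge0.
    apply: ler_sum => w; rewrite /typ -ltNge => hw.
    rewrite ler_pM2r ?expR_gt0 // -[leRHS]real_normK ?num_real //.
    have hc : 0 <= c1 * i%:R by rewrite mulr_ge0 // /c1; lra.
    by rewrite ler_sqr ?nnegrE // ltW.
  have Zi : 0 < Z ^+ (i ^ 2) by rewrite exprn_gt0.
  rewrite exprMn natrX.
  have : i%:R ^+ 2 * V * Z ^+ (i ^ 2) * 2 <= c1 ^+ 2 * Z * i%:R ^+ 2 * Z ^+ (i ^ 2).
    rewrite mulrAC ler_pM2r //; have := sqr_ge0 (i%:R : R); nra.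
  lra.
have typZ : Z ^+ (i ^ 2) / 2 <= \sum_(w <- concats n (i ^ 2) | typ w) e w.
  have : Z ^+ (i ^ 2) = \sum_(w <- concats n (i ^ 2)) e w by rewrite -M0.
  rewrite (bigID typ) /=; lra.
exists [seq w <- concats n (i ^ 2) | typ w]; split.
- by rewrite filter_uniq // concats_uniq.
- by move=> w; rewrite mem_filter => /andP[_]; apply: concats_block; rewrite expn_gt0 i0.
- move=> w; rewrite mem_filter => /andP[hw _]; apply: le_trans hw _.
  rewrite ler_wpM2r //; have : 0 <= c1 * `|q| by rewrite mulr_ge0 // /c1; lra.
  lra.
set G := [seq w <- _ | _].
(* A typical word has tilted weight at most [expR (|q| * c1 * i)], which converts weight into a
   number of words. *)
have hG : \sum_(w <- concats n (i ^ 2) | typ w) e w <= (size G)%:R * expR (`|q| * (c1 * i%:R)).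
  rewrite -big_filter -/G.
  apply: (@le_trans _ _ (\sum_(w <- G) expR (`|q| * (c1 * i%:R)))); last first.
    by rewrite big_const_seq count_predT iter_addr_0 mulr_natl.
  rewrite big_seq [leRHS]big_seq; apply: ler_sum => w.
  rewrite mem_filter => /andP[hw _]; rewrite ler_expR.
  by apply: le_trans (ler_norm _) _; rewrite normrM ler_wpM2l.
rewrite -(ler_pM2r (expR_gt0 (`|q| * (c1 * i%:R)))); apply: le_trans hG.
apply: le_trans typZ; rewrite ler_pdivlMr // -expRD.
have -> : (2 : R) = expR (ln 2) by rewrite lnK ?posrE.
rewrite -expRD.
apply: (@le_trans _ _ (expR (t * (n.+1%:R * L)) ^+ (i ^ 2))).
  rewrite expRK -expRM_natl ler_expR natrM.
  have : ln (2 : R) <= ln 2 * i%:R by rewrite -[leLHS]mulr1 ler_wpM2l.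
  have : 0 <= c1 * i%:R by rewrite mulr_ge0 // /c1; lra.
  nra.
by apply: lerXn2r; rewrite ?nnegrE ?expR_ge0 ?(ltW Z0).
Qed.

End Moments.

Lemma dev_pow l v c : block l.+1 v -> exists2 w, w \in blocks (c.+1 * l.+1).-1 &
  dev (c.+1 * l.+1) w = c.+1%:R * dev l.+1 v.
Proof.
move=> hv; have [w hw e] := block_pow p d3 dm B1 B2 c hv.
have c0 : (0 < c.+1 * l.+1)%N by rewrite muln_gt0.
exists w; first by apply/(mem_blocks d3 dm B1 B2); rewrite prednK.
rewrite !devE !lmassE e lnXn; last exact: (block_mass_gt0 d3 dm p_gt0 B1 B2 hv).
by rewrite natrM -mulr_natl; ring.
Qed.

(** At a good level the exponential sum is large at every [q], in particular at the [q] where the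
    tilted mean vanishes. Powers of the heavy and the light block guarantee that such a [q]
    exists. *)
Lemma typical_blocks t t' : (alpha_low d p < alpha%:E)%E -> (alpha%:E < alpha_star d p)%E ->
  t < t' -> (forall q, t' < q * alpha + pressure q / L) ->
  exists n c, forall i, (0 < i)%N -> exists G : seq nat,
    [/\ uniq G, forall w, w \in G -> block (i ^ 2 * n.+1) w,
      forall w, w \in G -> `|dev (i ^ 2 * n.+1) w| <= c * i%:R &
      expR (t * ((i ^ 2 * n.+1)%:R * L) - c * i%:R) <= (size G)%:R].
Proof.
have L0 : 0 < L.
  have d1 : (3%:R : R) <= d%:R by rewrite ler_nat.
  by rewrite ln_gt0; lra.
move=> lo hi tt' hpr.
have [l [v [w [hv hw dv dw]]]] := mixed_blocks d3 dm p_gt0 p_sum1 B1 B2 lo hi.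
move=> {lo hi}.
case: l hv hw dv dw => [[]//|l] hv hw dv dw.
have {}dv : 0 < dev l.+1 v by rewrite devE lmassE; lra.
have {}dw : dev l.+1 w < 0 by rewrite devE lmassE; lra.
have [c hc] := good_level hv hw dv dw tt' hpr L0.
have [v' hv' ev] := dev_pow c hv; have [w' hw' ew] := dev_pow c hw.
have c0 : (0 < c.+1 * l.+1)%N by rewrite muln_gt0.
exists (c.+1 * l.+1).-1.
have [q hq] : exists q, \sum_(w <- blocks (c.+1 * l.+1).-1)
    dev (c.+1 * l.+1).-1.+1 w * expR (q * dev (c.+1 * l.+1).-1.+1 w) = 0.
  rewrite prednK //; apply: (moment_zero hv' hw').
    by rewrite ev mulr_gt0.
  by rewrite ew nmulr_llt0.
apply: (typical_words hq); by rewrite -dk_expsum ler_expR prednK.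
Qed.

End Typical.

(** * Moran sets in the level set *)

(** Absorbs the quadratic errors of the stagewise construction into its cubic length; the two
    regimes meet at [2 * B / A]. *)
Lemma square_le_cube (R : realType) (A B : R) : 0 < A -> 0 <= B ->
  exists C, forall j : nat, B * j.+1%:R ^+ 2 <= A * j%:R ^+ 3 + C.
Proof.
move=> A0 B0; exists (2 * B + 2 * B * (2 * B / A) ^+ 2) => j.
set y := 2 * B / A; have y0 : 0 <= y by rewrite divr_ge0 ?mulr_ge0 // ltW.
have eB : 2 * B = A * y by rewrite /y mulrCA divff ?mulr1 // gt_eqF.
have hj : B * j.+1%:R ^+ 2 <= 2 * B * j%:R ^+ 2 + 2 * B.
  rewrite -natr1; have := sqr_ge0 (j%:R - 1 : R); nra.
apply: (le_trans hj); suff : 2 * B * j%:R ^+ 2 <= A * j%:R ^+ 3 + 2 * B * y ^+ 2 by lra.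
have j0 : (0 : R) <= j%:R by [].
rewrite eB; have [h|h] := leP y j%:R.
  have : A * y * j%:R ^+ 2 <= A * j%:R ^+ 3.
    by rewrite [j%:R ^+ 3]exprS mulrA ler_wpM2r ?sqr_ge0 // ler_pM2l.
  have : 0 <= A * y * y ^+ 2.
    by apply: mulr_ge0; rewrite ?sqr_ge0 // mulr_ge0 // ltW.
  lra.
have : A * y * j%:R ^+ 2 <= A * y * y ^+ 2.
  by apply: ler_wpM2l; [rewrite mulr_ge0 // ltW|rewrite ler_sqr ?nnegrE // ltW].
have : 0 <= A * j%:R ^+ 3 by rewrite mulr_ge0 ?exprn_ge0 // ltW.
lra.
Qed.

(* The arithmetic of [point_local_dim]: [y0 < y < y2] are indices of consecutive scales,
   [P0 <= P1 <= P2] the lengths of the corresponding prefixes, [E0] and [E2] the logarithms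
   of their masses. *)
Lemma local_dim_estimate (R : realType) (L c ln3 e y M x r a P0 P1 P2 E0 E2 C J y0 y2 : R) :
  0 < L -> 0 <= c -> 0 <= ln3 -> 0 < e -> 1 <= y -> 0 <= M ->
  E2 <= x -> x <= E0 -> - c * y2 ^+ 2 <= E2 + a * (P2 * L) -> E0 + a * (P0 * L) <= c * y0 ^+ 2 ->
  ln3 - P2 * L <= r -> r <= ln3 - P1 * L ->
  P2 = P0 + M * (y ^+ 2 + y2 ^+ 2) -> P0 <= P1 -> P1 <= P2 -> y ^+ 3 <= 3 * P1 ->
  (`|a| * (2 * (M * L) + ln3) + c) * y2 ^+ 2 <= e * L / 6 * y ^+ 3 + C ->
  J <= y -> y2 = y + 1 -> y0 = y - 1 ->
  `|C| + e * ln3 < J * (e * L / 6) -> C <= `|C| ->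
  `|a * r - x| <= e * - r.
Proof.
move=> L0 c0 l0 e0 y1 M0 h1 h2 h3 h4 h5 h6 hP h7 h8 h9 h10 h11 h12 h13 h14 h15.
have y22 : 1 <= y2 ^+ 2 by rewrite h12 expr2; nra.
have yy2 : y ^+ 2 <= y2 ^+ 2 by rewrite h12 !expr2; nra.
have y02 : y0 ^+ 2 <= y2 ^+ 2 by rewrite h12 h13 !expr2; nra.
have PL : (P2 - P0) * L <= 2 * (M * L) * y2 ^+ 2.
  have -> : (P2 - P0) * L = (M * L) * (y ^+ 2 + y2 ^+ 2) by rewrite hP; ring.
  have ML : 0 <= M * L by rewrite mulr_ge0 // ltW.
  have -> : 2 * (M * L) * y2 ^+ 2 = (M * L) * (2 * y2 ^+ 2) by ring.
  rewrite ler_wpM2l //; lra.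
have P01 : P0 * L <= P1 * L by rewrite ler_pM2r.
have P12 : P1 * L <= P2 * L by rewrite ler_pM2r.
have l1 : ln3 <= ln3 * y2 ^+ 2 by rewrite -[leLHS]mulr1 ler_wpM2l.
pose K := 2 * (M * L) * y2 ^+ 2 + ln3 * y2 ^+ 2.
have b2 : `|r + P2 * L| <= K by rewrite ler_norml /K; lra.
have b0 : `|r + P0 * L| <= K by rewrite ler_norml /K; lra.
have a2 : `|a * (r + P2 * L)| <= `|a| * K by rewrite normrM ler_wpM2l.
have a0 : `|a * (r + P0 * L)| <= `|a| * K by rewrite normrM ler_wpM2l.
have cy : c * y0 ^+ 2 <= c * y2 ^+ 2 by rewrite ler_wpM2l.
have main : `|a * r - x| <= (`|a| * (2 * (M * L) + ln3) + c) * y2 ^+ 2.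
  have -> : (`|a| * (2 * (M * L) + ln3) + c) * y2 ^+ 2 = `|a| * K + c * y2 ^+ 2 by rewrite /K; ring.
  move: a2 a0; rewrite !ler_norml !mulrDr => /andP[a21 a22] /andP[a01 a02]; lra.
apply: (le_trans main); apply: (le_trans h10).
have yc : y <= y ^+ 3 by rewrite -[leLHS]expr1 ler_weXn2l.
have eL : 0 < e * L / 6 by rewrite divr_gt0 // mulr_gt0.
have s1 : J * (e * L / 6) <= y ^+ 3 * (e * L / 6) by rewrite ler_pM2r //; lra.
have s2 : e * (L * y ^+ 3) <= e * (L * (3 * P1)) by rewrite !ler_pM2l.
have s3 : e * (P1 * L - ln3) <= e * - r by rewrite ler_pM2l //; lra.
lra.
Qed.

(** * Mixed radix digits of the unit interval *)

Section MixedRadix.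
Context {R : realType} (S : nat -> nat).
Hypothesis S_gt0 : forall i, (0 < S i)%N.

Definition radix j : nat := \prod_(i < j) S i.
Definition mdigit (y : R) i : nat := (Num.truncn (y * (radix i.+1)%:R) %% S i)%N.

Lemma radix_gt0 j : (0 < radix j)%N.
Proof. by rewrite prodn_gt0. Qed.

Lemma mdigit_lt y i : (mdigit y i < S i)%N.
Proof. by rewrite ltn_mod. Qed.

Lemma truncn_radix y j : 0 <= y ->
  Num.truncn (y * (radix j.+1)%:R) = (Num.truncn (y * (radix j)%:R) * S j + mdigit y j)%N.
Proof.
move=> y0; rewrite {1}(divn_eq (Num.truncn (y * (radix j.+1)%:R)) (S j)); congr (_ * _ + _)%N.
have yr k : 0 <= y * (radix k)%:R by rewrite mulr_ge0.
have /andP[h1 h2] := truncn_itv (yr j.+1).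
have Sp : (0 : R) < (S j)%:R by rewrite ltr0n.
apply/esym/truncn_def.
have er : y * (radix j.+1)%:R = y * (radix j)%:R * (S j)%:R.
  by rewrite /radix big_ord_recr /= natrM mulrA.
apply/andP; split.
  rewrite -(ler_pM2r Sp) -er; apply: le_trans h1; rewrite -natrM ler_nat.
  exact: leq_divM.
rewrite -(ltr_pM2r Sp) -er; apply: lt_le_trans h2 _; rewrite -natrM ler_nat.
by rewrite ltn_ceil.
Qed.

Lemma mdigit_agree y y' j : 0 <= y < 1 -> 0 <= y' < 1 ->
  (forall i, (i < j)%N -> mdigit y i = mdigit y' i) -> `|y - y'| <= (radix j)%:R^-1.
Proof.
move=> /andP[y0 y1] /andP[y0' y1'] h.
have e : Num.truncn (y * (radix j)%:R) = Num.truncn (y' * (radix j)%:R).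
  elim: j h => [|j IH] h.
    have e1 z : 0 <= z < 1 -> Num.truncn (z * (radix 0)%:R : R) = 0%N.
      by move=> hz; apply: truncn_def; rewrite /radix big_ord0 mulr1.
    by rewrite !e1 // ?y0 ?y0'.
  rewrite !truncn_radix // h // IH // => i ij; apply: h.
  exact: ltnW.
have rp : (0 : R) < (radix j)%:R by rewrite ltr0n radix_gt0.
have yr z : 0 <= z -> 0 <= z * (radix j)%:R :> R by move=> z0; rewrite mulr_ge0.
have /andP[h1 h2] := truncn_itv (yr _ y0); have /andP[h3 h4] := truncn_itv (yr _ y0').
rewrite -(ler_pM2r rp) mulVf ?gt_eqF // -[X in _ * X](ger0_norm (ltW rp)) -normrM mulrBl.
move: h1 h2 h3 h4; rewrite e -natr1 ler_norml => h1 h2 h3 h4; lra.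
Qed.

End MixedRadix.

Section Moran.
Context {R : realType} (d m : nat) (p : 'I_m.+1 -> R) (b : 'I_m.+1) (mu : probability R R).
Hypotheses (d3 : (3 <= d)%N) (dm : (d <= m)%N).
Hypothesis p_gt0 : forall i, 0 < p i.
Hypotheses (B1 : (b * d.-1 + m < d * d.-1)%N) (B2 : (d * m < (b + d) * d.-1)%N).
Hypothesis mu_compact : exists K : set R, compact K /\ mu (~` K) = 0%E.
Hypothesis mu_selfsim : forall A : set R, measurable A ->
  mu A = (\sum_(i < m.+1) (p i)%:E * mu [set (d%:R * x - (i : nat)%:R)%R | x in A])%E.

Local Notation xi := (xi (R := R) d m).
Local Notation E := (mass d p).
Local Notation N := (maxval d m).
Local Notation L := (ln (d%:R : R)).
Local Notation lmass := (lmass d p).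
Local Notation block := (block d b).
Local Notation prob := (prob mu).

Context (alpha : R).
Local Notation dev := (dev d p alpha).

Context (M : nat) (c t : R) (G : nat -> seq nat).
Hypothesis M_gt0 : (0 < M)%N.
Definition len i : nat := (i.+1 ^ 2 * M)%N.
Hypotheses (G_uniq : forall i, uniq (G i)) (G_block : forall i w, w \in G i -> block (len i) w).
Hypotheses (G_dev : forall i w, w \in G i -> `|dev (len i) w| <= c * i.+1%:R).
Hypothesis G_size : forall i, expR (t * ((len i)%:R * L) - c * i.+1%:R) <= (size (G i))%:R.

Definition pos j : nat := \sum_(i < j) len i.

Lemma posS j : pos j.+1 = (pos j + len j)%N.
Proof. by rewrite /pos big_ord_recr. Qed.

Lemma pos_ge j : (M * j ^ 3 <= 3 * pos j)%N.
Proof.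
elim: j => [|j IH]; first by rewrite /pos big_ord0; lia.
by rewrite posS /len; move: IH; rewrite !expnS expn0; nia.
Qed.

Lemma pos_gej j : (j <= pos j)%N.
Proof.
elim: j => // j IH; rewrite posS; have : (0 < len j)%N by rewrite muln_gt0 expn_gt0.
lia.
Qed.

Lemma pos_step j : (pos j.+2)%:R = (pos j)%:R + M%:R * (j.+1%:R ^+ 2 + j.+2%:R ^+ 2) :> R.
Proof.
have lenE k : (len k)%:R = k.+1%:R ^+ 2 * M%:R :> R by rewrite /len natrM natrX.
by rewrite 2!posS natrD [X in X + _]natrD !lenE mulrDr -addrA ![_ * M%:R]mulrC.
Qed.

Section Point.
Context (w : nat -> nat).
Hypothesis wG : forall i, w i \in G i.

Fixpoint prefix j : nat := if j is j'.+1 then (prefix j' * d ^ len j' + w j')%N else 0%N.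

Lemma prefix_carry_free j : carry_free d m (pos j) (prefix j).
Proof.
elim: j => [|j IH]; first by rewrite /pos big_ord0; exact: carry_free0.
rewrite posS /=; apply: carry_free_cat => //.
exact: (block_carry_free d3 dm B1 B2 (G_block (wG _))).
Qed.

Lemma prefix_dev j : `|dev (pos j) (prefix j)| <= c * j%:R ^+ 2.
Proof.
have c0 : 0 <= c.
  by have := le_trans (normr_ge0 _) (G_dev (wG 0%N)); rewrite mulr1.
elim: j => [|j IH].
  by rewrite /pos big_ord0 devE lmassE /= ln1 mul0r mulr0 addr0 normr0 expr0n mulr0.
have -> : dev (pos j.+1) (prefix j.+1) = dev (pos j) (prefix j) + dev (len j) (w j).
  rewrite posS !devE /= (lmass_cat d3 dm p_gt0 B1 B2) ?natrD; first by ring.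
    by have [] := prefix_carry_free j.
  exact: (block_carry_free d3 dm B1 B2 (G_block (wG _))).
apply: le_trans (ler_normD _ _) _.
apply: le_trans (lerD IH (G_dev (wG j))) _.
rewrite -mulrDr ler_wpM2l // -natr1; have : (0 : R) <= j%:R by []; nra.
Qed.

Definition D j : R := d%:R ^+ pos j.
Lemma D_gt0 j : 0 < D j. Proof. exact: dk_gt0. Qed.
(** The block after the prefix starts with [b], so the tail ranges over [[b / d, (b + xi) / d]]
    instead of [[0, xi]]. This keeps the point away from all other cylinders. *)
Definition lower j : R := ((prefix j)%:R + (b : nat)%:R / d%:R) / D j.
Definition upper j : R := ((prefix j)%:R + ((b : nat)%:R + xi) / d%:R) / D j.
Definition point : R := sup [set lower j | j in [set: nat]].

Lemma D_cat j : D j.+1 = D j * d%:R ^+ len j.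
Proof. by rewrite /D posS exprD. Qed.

Lemma D_leS j : D j <= D j.+1.
Proof.
have d0 : (0 < d)%N by apply: leq_trans d3.
by rewrite D_cat ler_peMr ?(ltW (D_gt0 j)) // exprn_ege1 // ler1n.
Qed.

Lemma word_bounds j : (b : nat)%:R / d%:R * d%:R ^+ len j <= (w j)%:R :> R /\
  (w j)%:R <= ((b : nat)%:R + xi) / d%:R * d%:R ^+ len j - xi.
Proof.
have d0 : (d%:R : R) != 0 by rewrite pnatr_eq0; lia.
have [] := G_block (wG j); case: (len j) => // l _ /= h1 h2.
rewrite exprS mulrA divfK // mulrA divfK // -natrX -natrM ler_nat h1; split => //.
have hN := maxvalE (R := R) d3 dm B1 B2 l.
move: h2; rewrite -(ler_nat R) natrD hN natrM natrX; lra.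
Qed.

Lemma interval_step j : lower j <= lower j.+1 /\ upper j.+1 <= upper j.
Proof.
have d1 : (3%:R : R) <= d%:R by rewrite ler_nat.
have Dp := D_gt0 j; have lp := dk_gt0 (R:=R) d3 (len j).
have [w1 w2] := word_bounds j.
have b0 : 0 <= (b : nat)%:R / d%:R :> R by rewrite divr_ge0.
(* Equivalent to [b <= m], as [xi * (d - 1) = m]. *)
have hb : ((b : nat)%:R + xi) / d%:R <= xi.
  have bm : ((b : nat)%:R : R) <= m%:R by rewrite ler_nat -ltnS ltn_ord.
  have e : xi * (d%:R - 1) = m%:R by rewrite /Defs.xi divfK // gt_eqF //; lra.
  rewrite ler_pdivrMr; lra.
rewrite /lower /upper D_cat [(_ * _)^-1]invfM !mulrA; split.
  rewrite [leRHS]mulrAC ler_pM2r ?invr_gt0 // ler_pdivlMr // /= natrD natrM natrX; lra.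
rewrite [leLHS]mulrAC ler_pM2r ?invr_gt0 // ler_pdivrMr // /= natrD natrM natrX; lra.
Qed.

Lemma lower_le_upper i j : lower i <= upper j.
Proof.
have d1 : (3%:R : R) <= d%:R by rewrite ler_nat.
have mono_lo k l : lower k <= lower (k + l)%N.
  elim: l => [|l IH]; first by rewrite addn0.
  by rewrite addnS; apply: le_trans IH _; have [] := interval_step (k + l).
have mono_up k l : upper (k + l)%N <= upper k.
  elim: l => [|l IH]; first by rewrite addn0.
  by rewrite addnS; apply: le_trans IH; have [] := interval_step (k + l).
apply: le_trans (mono_lo i j) _; apply: le_trans (mono_up j i).
rewrite [(j + i)%N]addnC /lower /upper ler_pM2r ?invr_gt0 ?D_gt0 // lerD2l.
have /andP[xi1 _] := xi_bounds (R := R) d3 dm B1 B2.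
rewrite ler_pM2r ?invr_gt0; lra.
Qed.

Lemma point_itv j : (b : nat)%:R / d%:R <= point * D j - (prefix j)%:R <= ((b : nat)%:R + xi) / d%:R.
Proof.
have ub : has_ubound [set lower j | j in [set: nat]].
  by exists (upper 0) => _ [i _ <-]; exact: lower_le_upper.
have h1 : lower j <= point by apply: ub_le_sup => //; exists j.
have h2 : point <= upper j.
  by apply: ge_sup; [exists (lower 0), 0%N|move=> _ [i _ <-]; exact: lower_le_upper].
move: h1 h2; rewrite /lower /upper ler_pdivrMr ?D_gt0 // ler_pdivlMr ?D_gt0 //; lra.
Qed.

(* The distance from a point in a barrier cylinder to the translates of the support
   that are attached to the other words of the same length. *)
Definition gap : R :=
  Num.min (1 - ((b : nat)%:R + xi) / d%:R) (1 + (b : nat)%:R / d%:R - xi).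

Lemma gap_gt0 : 0 < gap.
Proof.
have d1 : (3%:R : R) <= d%:R by rewrite ler_nat.
have dp : (d.-1%:R : R) = d%:R - 1 by rewrite -subn1 natrB //; lia.
have h1 : (b : nat)%:R * (d%:R - 1) + m%:R < d%:R * (d%:R - 1) :> R.
  by rewrite -dp -!natrM -natrD ltr_nat.
have h2 : d%:R * m%:R < ((b : nat)%:R + d%:R) * (d%:R - 1) :> R.
  by rewrite -dp -natrD -!natrM ltr_nat.
have e : xi * (d%:R - 1) = m%:R by rewrite /Defs.xi divfK // gt_eqF //; lra.
have d10 : (0 : R) < d%:R - 1 by lra.
rewrite lt_min !subr_gt0; apply/andP; split.
  rewrite ltr_pdivrMr; last by lra.
  by rewrite mul1r -(ltr_pM2r d10) mulrDl e.
have -> : 1 + (b : nat)%:R / d%:R = ((b : nat)%:R + d%:R) / d%:R :> R.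
  by field; rewrite gt_eqF //; lra.
rewrite ltr_pdivlMr; last by lra.
by rewrite -(ltr_pM2r d10) mulrAC e mulrC.
Qed.

Lemma ball_lower j r : 3 / D j <= r -> E (pos j) (prefix j)%:Z <= prob (ball point r).
Proof.
move=> hr; have Dp := D_gt0 j.
have /andP[xi1 xi2] := xi_bounds (R := R) d3 dm B1 B2.
have /andP[x1 x2] := point_itv j.
have b0 : 0 <= (b : nat)%:R / d%:R :> R by rewrite divr_ge0.
have g0 := gap_gt0; move: g0; rewrite /gap lt_min => /andP[g1 _].
have half : 0 < 2^-1 :> R by rewrite invr_gt0.
have [_ _ pN] := prefix_carry_free j.
apply: (mass_le_ball d3 p_gt0 mu_compact mu_selfsim half) => // u /andP[t1 t2].
apply: lt_le_trans hr; rewrite ltr_pdivlMr // -[X in _ * X < _](ger0_norm (ltW Dp)) -normrM.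
rewrite mulrBl divfK; last by rewrite gt_eqF.
by rewrite ltr_norml; lra.
Qed.

(** Half of the gap is spent on the radius, the other half on the neighbourhood of the support
    required by [ball_le_one_mass]. *)
Lemma ball_upper j r : r <= gap / 2 / D j -> prob (ball point r) <= E (pos j) (prefix j)%:Z.
Proof.
move=> hr; have Dp := D_gt0 j.
have /andP[x1 x2] := point_itv j.
have g0 := gap_gt0.
have g1 : gap <= 1 - ((b : nat)%:R + xi) / d%:R by rewrite /gap ge_min lexx.
have g2 : gap <= 1 + (b : nat)%:R / d%:R - xi by rewrite /gap ge_min lexx orbT.
have half : 0 < gap / 2 by lra.
apply: (ball_le_one_mass d3 p_gt0 mu_compact mu_selfsim half) => v u vp /andP[t1 t2].
have nD : D j = `|D j| by rewrite ger0_norm // ltW.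
apply: (le_trans hr); rewrite ler_pdivrMr // [X in _ <= _ * X]nD -normrM.
rewrite mulrBl divfK; last by rewrite gt_eqF.
have [h|h|h] := ltngtP v (prefix j); last by rewrite h eqxx in vp.
  have : v%:R + 1 <= (prefix j)%:R :> R by rewrite natr1 ler_nat.
  move=> h'; apply: le_trans (ler_norm _); lra.
have : (prefix j)%:R + 1 <= v%:R :> R by rewrite natr1 ler_nat.
move=> h'; rewrite distrC; apply: le_trans (ler_norm _); lra.
Qed.

Lemma prefix_mass_gt0 j : 0 < E (pos j) (prefix j)%:Z.
Proof. by have [_ _ pN] := prefix_carry_free j; apply: (mass_gt0 p_gt0) => //; lia. Qed.

Lemma D_unbounded x : exists j, x < D j.
Proof.
have [K hK] := @exp_nat_gt R d x (ltnW d3).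
by exists K; apply: hK; exact: pos_gej.
Qed.

Lemma point_support : msupport mu point.
Proof.
move=> r r0; rewrite (probE mu (measurable_ballR _ _)) lte_fin.
have [j hj] := D_unbounded (3 / r).
apply: lt_le_trans (prefix_mass_gt0 j) _; apply: ball_lower.
by rewrite ler_pdivrMr ?D_gt0 // mulrC -ler_pdivrMr // ltW.
Qed.

Lemma ln_D j : ln (D j) = (pos j)%:R * L.
Proof. by rewrite /D lnXn ?mulr_natl // ltr0n; lia. Qed.

Lemma lmass_prefix j : - c * j%:R ^+ 2 <= lmass (pos j) (prefix j) + alpha * ((pos j)%:R * L)
  <= c * j%:R ^+ 2.
Proof. by rewrite mulNr -ler_norml; exact: prefix_dev. Qed.

Lemma scale_exists J r : 0 < r -> r < 3 / D J ->
  exists j, [/\ (J <= j)%N, 3 / D j.+1 <= r & r < 3 / D j].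
Proof.
move=> r0 hr.
have ex : exists j, 3 / D j <= r.
  have [j hj] := D_unbounded (3 / r); exists j.
  by rewrite ler_pdivrMr ?D_gt0 // mulrC -ler_pdivrMr // ltW.
have [i hi mini] := ex_minnP ex.
have monoD k l : D k <= D (k + l)%N.
  elim: l => [|l IH]; first by rewrite addn0.
  by rewrite addnS; apply: le_trans IH (D_leS _).
have Ji : (J < i)%N.
  rewrite ltnNge; apply/negP => iJ; move: hr; apply/negP; rewrite -leNgt.
  apply: le_trans hi; rewrite ler_pM2l // lef_pV2 ?posrE ?D_gt0 //.
  by rewrite -(subnKC iJ).
case: i hi mini Ji => // i hi mini Ji; exists i; split => //.
by rewrite ltNge; apply/negP => /mini; rewrite ltnn.
Qed.

(** The mass of a small ball is squeezed between the masses of two prefixes that are two stages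
    apart; both the lengths skipped and the deviations are quadratic in the stage. *)
Lemma point_local_dim : local_dim_is mu point alpha.
Proof.
have leJ (J1 J2 j : nat) : ((J1 + J2).+2 <= j.+1)%N -> (J1 <= j.+1)%N /\ (J2 <= j.+1)%N by lia.
have L0 := L_gt0 (R := R) d3.
have c0 : 0 <= c.
  by have := le_trans (normr_ge0 _) (G_dev (wG 0%N)); rewrite mulr1.
have ln30 : 0 <= ln (3 : R) by rewrite ln_ge0; lra.
apply/cvgrPdist_le => e e0.
pose C0 := `|alpha| * (2 * (M%:R * L) + ln 3) + c.
have C00 : 0 <= C0.
  by rewrite addr_ge0 // mulr_ge0 // addr_ge0 // !mulr_ge0 // ltW.
have A0 : 0 < e * L / 6 by rewrite divr_gt0 // mulr_gt0.
have [C hC] := square_le_cube A0 C00.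
have [J1 hJ1] := nat_gt ((`|C| + e * ln 3) / (e * L / 6)).
have [J2 hJ2] := @exp_nat_gt R d (6 / gap) (ltnW d3).
pose J := (J1 + J2).+2.
exists (Num.min 1 (3 / D J)) => /=.
  by rewrite lt_min ltr01 divr_gt0 // D_gt0.
move=> r /=; rewrite sub0r normrN => hr r0.
rewrite (ger0_norm (ltW r0)) lt_min in hr; have /andP[r1 rJ] := hr.
have [j [Jj rj1 rj2]] := scale_exists r0 rJ.
have lnr : ln r < 0 by rewrite ln_lt0 // r0 r1.
have D1 := D_gt0 j; have D2 := D_gt0 j.+1.
have lr1 : ln 3 - (pos j.+1)%:R * L <= ln r.
  by rewrite -ln_D -ln_div ?posrE // ler_ln ?posrE // divr_gt0.
have lr2 : ln r <= ln 3 - (pos j)%:R * L.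
  by rewrite -ln_D -ln_div ?posrE // ler_ln ?posrE ?divr_gt0 // ltW.
case: j Jj rj1 rj2 D1 D2 lr1 lr2 => // j Jj rj1 rj2 D1 D2 lr1 lr2.
have [J1j J2j] := leJ _ _ _ Jj.
have J2l : (J2 <= len j)%N.
  by apply: (leq_trans J2j); rewrite /len expnS expn1 -mulnA leq_pmulr // muln_gt0.
have low := ball_lower rj1.
(* One stage is given up here: its block is long enough that [d ^ len j] exceeds [6 / gap], so the
   radius falls below the isolation distance of the earlier cylinder. *)
have up : prob (ball point r) <= E (pos j) (prefix j)%:Z.
  apply: ball_upper; apply: (le_trans (ltW rj2)).
  have Dj := D_gt0 j; have g0 := gap_gt0; have T0 := dk_gt0 (R := R) d3 (len j).
  have := hJ2 _ J2l; rewrite ltr_pdivrMr // => h.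
  have -> : gap / 2 / D j = gap * d%:R ^+ len j / 2 / (D j * d%:R ^+ len j).
    by field; rewrite !gt_eqF.
  rewrite D_cat ler_pM2r ?invr_gt0 ?mulr_gt0 //; lra.
have P0 : 0 < prob (ball point r) := lt_le_trans (prefix_mass_gt0 _) low.
have {}low : lmass (pos j.+2) (prefix j.+2) <= ln (prob (ball point r)).
  by rewrite !lmassE ler_ln ?posrE // prefix_mass_gt0.
have {}up : ln (prob (ball point r)) <= lmass (pos j) (prefix j).
  by rewrite !lmassE ler_ln ?posrE // prefix_mass_gt0.
have /andP[m1 _] := lmass_prefix j.+2; have /andP[_ m2] := lmass_prefix j.
rewrite -/(prob _).
have -> : alpha - ln (prob (ball point r)) / ln r = (alpha * ln r - ln (prob (ball point r))) / ln r.
  by field; rewrite lt_eqF.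
rewrite normrM normfV ler_pdivrMr; last by rewrite normr_gt0 lt_eqF.
rewrite [`|ln r|]ltr0_norm //.
have posj := pos_step j.
have posj1 : (pos j)%:R <= (pos j.+1)%:R :> R by rewrite ler_nat posS leq_addr.
have posj2 : (pos j.+1)%:R <= (pos j.+2)%:R :> R by rewrite ler_nat [pos j.+2]posS leq_addr.
have cub : j.+1%:R ^+ 3 <= 3 * (pos j.+1)%:R :> R.
  rewrite -natrX -natrM ler_nat; apply: leq_trans (pos_ge _).
  by rewrite leq_pmull.
have hCj := hC j.+1.
have j1 : (1 : R) <= j.+1%:R by rewrite ler1n.
have Mp : (0 : R) <= M%:R by [].
have jJ : J1%:R <= j.+1%:R :> R by rewrite ler_nat.
have j12 : j.+2%:R = j.+1%:R + 1 :> R by rewrite natr1.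
have j01 : j%:R = j.+1%:R - 1 :> R by rewrite -natr1 addrK.
move: hJ1; rewrite ltr_pdivrMr // => hJ1.
have Cn := ler_norm C.
exact: (local_dim_estimate L0 c0 ln30 e0 j1 Mp low up m1 m2 lr1 lr2 posj posj1 posj2 cub hCj jJ j12 j01 hJ1 Cn).
Qed.

End Point.

Lemma prefix_agree w w' j : (forall i, (i < j)%N -> w i = w' i) -> prefix w j = prefix w' j.
Proof.
elim: j => //= j IH h; rewrite h // IH // => i ij; apply: h.
exact: ltnW.
Qed.

(** On the scale [D j.+1] the prefixes differ by at least [1], while both tails lie in one interval
    of length [xi / d], which is at most [1 - gap]. *)
Lemma separation w w' j : (forall i, w i \in G i) -> (forall i, w' i \in G i) ->
  (forall i, (i < j)%N -> w i = w' i) -> w j != w' j ->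
  gap / D j.+1 <= `|point w - point w'|.
Proof.
move=> wG wG' agree wj.
have : prefix w j.+1 != prefix w' j.+1 by rewrite /= (prefix_agree agree) eqn_add2l.
move=> {wj agree}; wlog lt : w w' wG wG' / (prefix w j.+1 < prefix w' j.+1)%N.
  move=> H; rewrite neq_ltn => /orP[h|h]; first by apply: H => //; rewrite neq_ltn h.
  by rewrite distrC; apply: H => //; rewrite neq_ltn h.
move=> _; have Dp := D_gt0 j.+1.
have /andP[_ h1] := point_itv wG j.+1; have /andP[h2 _] := point_itv wG' j.+1.
have g1 : gap <= 1 - ((b : nat)%:R + xi) / d%:R by rewrite /gap ge_min lexx.
have lt1 : (prefix w j.+1)%:R + 1 <= (prefix w' j.+1)%:R :> R by rewrite natr1 ler_nat.
rewrite ler_pdivrMr // distrC; apply: (@le_trans _ _ ((point w' - point w) * D j.+1)).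
  have b0 : 0 <= (b : nat)%:R / d%:R :> R by rewrite divr_ge0.
  rewrite mulrBl; lra.
by rewrite ler_pM2r // ler_norm.
Qed.

Lemma size_G_gt0 i : (0 < size (G i))%N.
Proof. by rewrite -(ltr_nat R); apply: lt_le_trans (G_size i); exact: expR_gt0. Qed.

Local Notation S := (fun i => size (G i)).

Lemma dev_bound_ge0 : 0 <= c.
Proof.
have /(G_dev) h : nth 0%N (G 0) 0 \in G 0 by rewrite mem_nth // size_G_gt0.
by have := le_trans (normr_ge0 _) h; rewrite mulr1.
Qed.

Lemma radix_ge j : expR (t * ((pos j)%:R * L) - c * j%:R ^+ 2) <= (radix S j)%:R.
Proof.
have c0 := dev_bound_ge0.
elim: j => [|j IH].
  by rewrite /radix /pos !big_ord0 mul0r mulr0 expr0n mulr0 subr0 expR0.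
rewrite /radix big_ord_recr /= natrM.
apply: le_trans (ler_pM (expR_ge0 _) (expR_ge0 _) IH (G_size j)).
rewrite -expRD ler_expR posS natrD.
have : c * (j%:R ^+ 2 + j.+1%:R) <= c * j.+1%:R ^+ 2.
  rewrite ler_wpM2l // -natr1; have : (0 : R) <= j%:R by []; nra.
by rewrite mulrDr mulrDl mulrDr; set x := t * _; set y := t * _; lra.
Qed.

(** The logarithms of the two sides are of order [- t * pos j * L] and [- s * pos j.+1 * L]. The
    surplus [(t - s) * pos j * L] is cubic in [j] and beats the last stage and the loss
    [c * j ^ 2]. *)
Lemma radix_separation s : 0 < s -> s < t ->
  exists C, 0 < C /\ forall j, (radix S j)%:R^-1 <= C * (gap / D j.+1) `^ s.
Proof.
move=> s0 st; have L0 := L_gt0 (R := R) d3; have c0 := dev_bound_ge0.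
have g0 := gap_gt0.
have M0 : (0 : R) < M%:R by rewrite ltr0n.
have A0 : 0 < (t - s) * L * M%:R / 3 by rewrite divr_gt0 // !mulr_gt0 // subr_gt0.
have B0 : 0 <= c + s * (L * M%:R) by rewrite addr_ge0 // !mulr_ge0 // ltW.
have [C hC] := square_le_cube A0 B0.
exists (expR (C - s * ln gap)); split; first exact: expR_gt0.
move=> j; have Dp := D_gt0 j.+1.
have Rp : (0 : R) < (radix S j)%:R by rewrite ltr0n radix_gt0 // => i; exact: size_G_gt0.
apply: (@le_trans _ _ (expR (- (t * ((pos j)%:R * L) - c * j%:R ^+ 2)))).
  by rewrite expRN lef_pV2 ?posrE ?expR_gt0 // radix_ge.
rewrite /powR gt_eqF ?divr_gt0 // -expRD ler_expR ln_div ?posrE // ln_D posS natrD.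
have lenE : (len j)%:R = j.+1%:R ^+ 2 * M%:R :> R by rewrite /len natrM natrX.
have cub : (t - s) * L * M%:R / 3 * j%:R ^+ 3 <= (t - s) * L * (pos j)%:R.
  rewrite -!mulrA !ler_pM2l ?subr_gt0 //.
  have : M%:R * j%:R ^+ 3 <= 3 * (pos j)%:R :> R by rewrite -natrX -!natrM ler_nat pos_ge.
  by move=> h; rewrite [3^-1 * _]mulrC mulrA ler_pdivrMr // [_ * 3]mulrC.
have sq : c * j%:R ^+ 2 <= c * j.+1%:R ^+ 2.
  by rewrite ler_wpM2l // -natr1; have : (0 : R) <= j%:R by []; nra.
have := hC j; rewrite lenE; nra.
Qed.

Definition digits (y : R) i : nat := nth 0%N (G i) (mdigit S y i).

Lemma digits_in y i : digits y i \in G i.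
Proof. by rewrite mem_nth // mdigit_lt // => k; exact: size_G_gt0. Qed.

Lemma digits_inj y y' i : digits y i = digits y' i -> mdigit S y i = mdigit S y' i.
Proof.
have lt z : (mdigit S z i < size (G i))%N by apply: mdigit_lt => k; exact: size_G_gt0.
by move/eqP; rewrite nth_uniq // => /eqP.
Qed.

Lemma point_holder s : 0 < s -> s < t -> exists C, 0 < C /\ forall y y', 0 <= y < 1 -> 0 <= y' < 1 ->
    `|y - y'| <= C * `|point (digits y) - point (digits y')| `^ s.
Proof.
move=> s0 st; have [C [C0 hC]] := radix_separation s0 st.
exists C; split => // y y' hy hy'.
have S0 i : (0 < size (G i))%N by exact: size_G_gt0.
have [ag|] := pselect (forall i, digits y i = digits y' i).
  (* Some [S i] may be [1]; that the radices nevertheless tend to infinity is read off [hC], whose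
     right-hand side tends to [0]. *)
  have -> : y = y'; last by rewrite !subrr normr0 mulr_ge0 ?powR_ge0 // ltW.
  apply/eqP; rewrite -subr_eq0 -normr_eq0; apply/negPn/negP => yy.
  have e0 : 0 < `|y - y'| by rewrite lt_neqAle eq_sym yy normr_ge0.
  pose z := (`|y - y'| / C) `^ s^-1.
  have z0 : 0 < z by rewrite powR_gt0 // divr_gt0.
  have [j hj] := D_unbounded (gap / z).
  have : `|y - y'| <= C * (gap / D j.+1) `^ s.
    apply: le_trans (hC j); apply: mdigit_agree => // i _.
    exact: digits_inj.
  apply/negP; rewrite -ltNge mulrC -ltr_pdivlMr //.
  have -> : `|y - y'| / C = z `^ s.
    by rewrite -powRrM mulVf ?gt_eqF // powRr1 // divr_ge0 // ltW.
  have g0 := gap_gt0; have Dp := D_gt0 j; have Dp1 := D_gt0 j.+1.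
  apply: gt0_ltr_powR => //; rewrite ?nnegrE ?divr_ge0 1?ltW //.
  rewrite ltr_pdivrMr //; move: hj; rewrite ltr_pdivrMr // mulrC => hj.
  by apply: (lt_le_trans hj); rewrite ler_pM2l // D_leS.
move/existsNP => ex; have ex' : exists i, digits y i != digits y' i.
  by case: ex => i /eqP h; exists i.
have [j hj minj] := ex_minnP ex'.
have ag i : (i < j)%N -> digits y i = digits y' i.
  move=> ij; apply/eqP/negPn/negP => /minj; by rewrite leqNgt ij.
have sep := separation (digits_in y) (digits_in y') ag hj.
apply: (@le_trans _ _ (C * (gap / D j.+1) `^ s)).
  apply: le_trans (hC j); apply: mdigit_agree => // i /ag.
  exact: digits_inj.
rewrite ler_pM2l //; apply: ge0_ler_powR; rewrite ?nnegrE ?(ltW s0) ?normr_ge0 //.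
by rewrite divr_ge0 // ltW // ?gap_gt0 ?D_gt0.
Qed.

Lemma level_set_moran : exists x, msupport mu x /\ local_dim_is mu x alpha.
Proof.
by exists (point (digits 0)); split; [apply: point_support|apply: point_local_dim];
  exact: digits_in.
Qed.

Lemma level_set_measure s : 0 < s -> s < t ->
  hausdorff_measure s [set x | msupport mu x /\ local_dim_is mu x alpha] <> 0%E.
Proof.
move=> s0 st; have [C [C0 hC]] := point_holder s0 st.
apply: (hausdorff_pos (X := fun y => point (digits y)) _ hC (ltW s0) C0) => y _.
by split; [apply: point_support|apply: point_local_dim]; exact: digits_in.
Qed.

End Moran.

(** * The Legendre transform *)

Section Spectrum.
Context {R : realType} (d m : nat) (p : 'I_m.+1 -> R) (b : 'I_m.+1) (mu : probability R R).
Hypotheses (d3 : (3 <= d)%N) (dm : (d <= m)%N).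
Hypotheses (p_gt0 : forall i, 0 < p i) (p_sum1 : \sum_i p i = 1).
Hypotheses (B1 : (b * d.-1 + m < d * d.-1)%N) (B2 : (d * m < (b + d) * d.-1)%N).
Hypothesis mu_compact : exists K : set R, compact K /\ mu (~` K) = 0%E.
Hypothesis mu_selfsim : forall A : set R, measurable A ->
  mu A = (\sum_(i < m.+1) (p i)%:E * mu [set (d%:R * x - (i : nat)%:R)%R | x in A])%E.
Context (pm : R).
Hypotheses (pm_gt0 : 0 < pm) (pm_le : forall i, pm <= p i).
Local Notation L := (ln (d%:R : R)).
Local Notation pressure := (pressure d p b).

Lemma pressure_block l v q : block d b l v -> q * lmass d p l v <= pressure q * l%:R.
Proof.
case: l => [[]//|n] hv.
apply: le_trans (lexpsum_le_pressure d3 dm p_gt0 p_sum1 B1 B2 pm_gt0 pm_le n q).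
rewrite -[leLHS]expRK ler_ln ?posrE ?expR_gt0 ?expsum_gt0 //.
move/(mem_blocks d3 dm B1 B2) in hv.
rewrite /expsum (bigD1_seq v) ?blocks_uniq //= lerDl.
by apply: sumr_ge0 => w _; exact: expR_ge0.
Qed.

Context (alpha : R).
Hypotheses (lo : (alpha_low d p < alpha%:E)%E) (hi : (alpha%:E < alpha_star d p)%E).

(** A single block bounds the pressure below by [q] times its log-mass per letter: the heavy one for
    [q >= 0], the light one for [q < 0]. This makes the infimum finite, and the dimensions tested in
    [fH_le] positive as [hausdorff_dim] demands. *)
Lemma legendre_ge0 q : 0 <= q * alpha + pressure q / L.
Proof.
have L0 := L_gt0 (R := R) d3.
have [l [v [w [hv hw dv dw]]]] := mixed_blocks d3 dm p_gt0 p_sum1 B1 B2 lo hi.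
have l0 : (0 : R) < l%:R by rewrite ltr0n; case: hv.
suff h : - q * alpha * (l%:R * L) <= pressure q * l%:R.
  have -> : q * alpha + pressure q / L = (q * alpha * (l%:R * L) + pressure q * l%:R) / (l%:R * L).
    by field; rewrite !gt_eqF.
  by rewrite divr_ge0 ?mulr_ge0 ?(ltW L0) // -lerBlDl sub0r -!mulNr.
have [q0|q0] := leP 0 q.
  apply: le_trans (pressure_block q hv); rewrite lmassE.
  have := ler_wpM2l q0 (ltW dv); rewrite !mulrA !mulrN !mulNr; exact.
apply: le_trans (pressure_block q hw); rewrite lmassE.
have := ler_wnM2l (ltW q0) (ltW dw); rewrite !mulrA !mulrN !mulNr; exact.
Qed.

Lemma fH_le q : (fH mu alpha <= (q * alpha + pressure q / L)%:E)%E.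
Proof.
rewrite /fH /hausdorff_dim; case: ifP => [_|_]; first exact: leNye.
apply/lee_addgt0Pr => e e0; rewrite -EFinD.
have h0 := legendre_ge0 q.
apply: ereal_inf_lbound; exists (q * alpha + pressure q / L + e) => //; split.
  by rewrite ltr_wpDl.
apply: (level_set_null d3 dm p_gt0 p_sum1 B1 B2 mu_compact mu_selfsim pm_gt0 pm_le (q := q)).
  by rewrite ltr_wpDl.
by rewrite ltrDl.
Qed.

Lemma fH_ge t t' : t < t' -> (forall q, t' < q * alpha + pressure q / L) ->
  (t%:E <= fH mu alpha)%E.
Proof.
move=> tt' ht'.
have [n [c hG]] := typical_blocks d3 dm p_gt0 p_sum1 B1 B2 pm_gt0 pm_le lo hi tt' ht'.
have /choice[G {}hG] : forall i, exists G : seq nat,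
    [/\ uniq G, forall w, w \in G -> block d b (len n.+1 i) w,
      forall w, w \in G -> `|dev d p alpha (len n.+1 i) w| <= c * i.+1%:R &
      expR (t * ((len n.+1 i)%:R * L) - c * i.+1%:R) <= (size G)%:R].
  by move=> i; exact: hG.
have G1 i : uniq (G i) by case: (hG i).
have G2 i w : w \in G i -> block d b (len n.+1 i) w by case: (hG i) => _ + _ _; exact.
have G3 i w : w \in G i -> `|dev d p alpha (len n.+1 i) w| <= c * i.+1%:R.
  by case: (hG i) => _ _ + _; exact.
have G4 i : expR (t * ((len n.+1 i)%:R * L) - c * i.+1%:R) <= (size (G i))%:R.
  by case: (hG i).
have n0 : (0 < n.+1)%N by [].
(* The empty set has dimension [-oo], so a point of the Moran set is exhibited before measures are
   compared. *)
rewrite /fH /hausdorff_dim; case: ifPn => [/eqP E0|_].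
  have [x hx] := level_set_moran d3 dm p_gt0 B1 B2 mu_compact mu_selfsim n0 G2 G3 G4.
  suff : set0 x by [].
  by rewrite -E0.
apply/ereal_infP => _ [s [s0 hs] <-]; rewrite lee_fin leNgt; apply/negP => st.
exact: (level_set_measure d3 dm p_gt0 B1 B2 mu_compact mu_selfsim n0 G1 G2 G3 G4 s0 st).
Qed.

Lemma fH_legendre :
  fH mu alpha = ereal_inf [set (q * alpha + pressure q / L)%:E | q in [set: R]].
Proof.
apply/eqP; rewrite eq_le; apply/andP; split.
  by apply/ereal_infP => _ [q _ <-]; exact: fH_le.
set T := ereal_inf _.
have T0 : (0 <= T)%E.
  by apply/ereal_infP => _ [q _ <-]; rewrite lee_fin legendre_ge0.
have Tq q : (T <= (q * alpha + pressure q / L)%:E)%E.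
  by apply: ereal_inf_lbound; exists q.
have Tfin : T \is a fin_num by rewrite ge0_fin_numE // (le_lt_trans (Tq 0)) // ltry.
rewrite -(fineK Tfin); apply/lee_addgt0Pr => e e0; rewrite -leeBlDr // -EFinB.
apply: (@fH_ge _ (fine T - e / 2)) => [|q].
  by rewrite ltrD2l ltrN2 ltr_pdivrMr // ltr_pMr // ltr1n.
rewrite ltrBlDr (@le_lt_trans _ _ (q * alpha + pressure q / L)) ?ltrDl ?divr_gt0 //.
by rewrite -lee_fin fineK.
Qed.

End Spectrum.

Theorem theorem5 (R : realType) (d m : nat) (p : 'I_m.+1 -> R)
  (mu : probability R R) (Xi : forall k, {set k.-tuple 'I_m.+1})
  (b : 'I_m.+1) :
  (3 <= d)%N -> (d <= m)%N ->
  (forall i, 0 < p i) -> \sum_(i < m.+1) p i = 1 ->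
  p ord0 <= p ord_max ->
  (forall i : 'I_m.+1, (1 <= i)%N -> (i <= m.-1)%N -> p ord_max <= p i) ->
  (exists K : set R, compact K /\ mu (~` K) = 0%E) ->
  (forall A : set R, measurable A ->
     mu A = (\sum_(i < m.+1) (p i)%:E * mu [set (d%:R * x - (i : nat)%:R)%R | x in A])%E) ->
  is_Xi (R:=R) d Xi ->
  barrier_digit (R:=R) d b ->
  forall alpha : R,
    (alpha_low d p < alpha%:E)%E -> (alpha%:E < alpha_star d p)%E ->
    fH mu alpha = tauhat_star d p b Xi alpha.
Proof.
move=> d3 dm p_gt0 p_sum1 p0m pmi mu_compact mu_selfsim hXi hb alpha lo hi.
have [B1 B2] := barrier_ineqs d3 hb.
(* The normalization makes [p ord0] the smallest weight, which serves as [pm]. *)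
have pm_le i : p ord0 <= p i.
  case: (posnP i) => [i0|i0]; first by rewrite (_ : ord0 = i) //; apply: val_inj.
  case: (ltnP i m) => im.
    by apply: le_trans p0m (pmi i i0 _); rewrite -ltnS prednK // (leq_trans _ dm) // ltnW // ltnW.
  rewrite (_ : i = ord_max) //; apply/val_inj/eqP.
  by rewrite eqn_leq im -ltnS ltn_ord.
rewrite (fH_legendre d3 dm p_gt0 p_sum1 B1 B2 mu_compact mu_selfsim (p_gt0 ord0) pm_le lo hi).
rewrite /tauhat_star; congr ereal_inf; apply: eq_imagel => q _.
by rewrite (tauhatE d3 dm p_gt0 p_sum1 B1 B2 (p_gt0 ord0) pm_le q hXi) mulNr opprK.
Qed.
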